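(* Let $n\ge 1$ and let $\varphi\in\mathcal{F}(\mathbb{C}^n)$. (Necessity) If $S_\varphi$ is bounded on $\mathcal{F}(\mathbb{C}^n)$, then $$(i)\quad \sup_{a\in\mathbb{R}^n}\int_{\mathbb{C}^n}|\varphi(z+ia)|^2\,e^{-\frac12|z|^2}\,dz<\infty,$$ and $$(ii)\quad \sup_{y\in\mathbb{R}^n}|\varphi(x+iy)|\,e^{-\frac14|x|^2}<\infty\quad\text{for every }x\in\mathbb{R}^n.$$ (Sufficiency) Conversely, if $\varphi$ satisfies (i) and $$\sup_{y\in\mathbb{R}^n}\int_{\mathbb{R}^n}|\varphi(x+iy)|\,e^{-\frac14|x|^2}\,dx<\infty,$$ then $\varphi=Gm$ for some $m\in L^\infty(\mathbb{R}^n)$, and consequently $S_\varphi$ is bounded on $\mathcal{F}(\mathbb{C}^n)$.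
   Context: For $z,w\in\mathbb{C}^n$ write $z\cdot w=\sum_j z_jw_j$, $z^2=z\cdot z$, $|z|^2=z\cdot\bar z$; $dz$ denotes Lebesgue measure on $\mathbb{C}^n\cong\mathbb{R}^{2n}$. The Fock space $\mathcal{F}(\mathbb{C}^n)$ is the Hilbert space of all entire functions $F$ on $\mathbb{C}^n$ with $\|F\|^2=\int_{\mathbb{C}^n}|F(z)|^2w_0(z)\,dz<\infty$, where $w_0(z)=c_0e^{-\frac12|z|^2}$ and $c_0=(2\pi)^{-n}$ makes $w_0(z)dz$ a probability measure. Its reproducing kernel is $e^{\frac12 z\cdot\bar w}$. The Gauss-Bargmann transform $G$ is defined on $L^2(\mathbb{R}^n,d\gamma)$, $d\gamma(\xi)=e^{-|\xi|^2}d\xi$ (hence on $L^\infty(\mathbb{R}^n)\subset L^2(\mathbb{R}^n,d\gamma)$), by $$Gf(z)=e^{\frac14 z^2}\int_{\mathbb{R}^n}f(\xi)\,e^{iz\cdot\xi}\,e^{-|\xi|^2}\,d\xi .$$ For $\varphi\in\mathcal{F}(\mathbb{C}^n)$ the operator $S_\varphi$ is given by $$S_\varphi F(z)=\int_{\mathbb{C}^n}F(w)\,\varphi(z-\bar w)\,e^{\frac12 z\cdot\bar w}\,w_0(w)\,dw,$$ initially for $F$ in the dense subspace $\mathcal{D}$ spanned by the functions $w\mapsto e^{\frac12 w\cdot\bar a}$, $a\in\mathbb{C}^n$. ''$S_\varphi$ is bounded on $\mathcal{F}(\mathbb{C}^n)$'' means that $S_\varphi$ extends from $\mathcal{D}$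 to a bounded linear operator on $\mathcal{F}(\mathbb{C}^n)$, i.e. $S_\varphi F\in\mathcal{F}(\mathbb{C}^n)$ and $\|S_\varphi F\|\le C\|F\|$ for all $F\in\mathcal{D}$, with $C$ independent of $F$. *)

(* Defs.v *)
From HB Require Import structures.
From mathcomp Require Import all_boot all_order all_algebra.
From mathcomp Require Import complex.
From mathcomp Require Import all_classical all_reals all_analysis.

Set Implicit Arguments.
Unset Strict Implicit.
Unset Printing Implicit Defensive.

Import Order.TTheory GRing.Theory Num.Theory.
Import numFieldNormedType.Exports.

Local Open Scope classical_set_scope.
Local Open Scope ring_scope.

(* R^n is carried by n-tuples, which the library equips with the product
   of the Borel sigma-algebras; C^n is carried by row vectors over R[i], which
   the library equips with a normed module structure. *)
Notation Rn R n := (n.-tuple (measurableTypeR R)) (only parsing).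
Notation Cn R n := 'rV[R[i]]_n (only parsing).

Section lebesgue_succ.
Local Open Scope ereal_scope.
Context (R : realType) (n : nat).
Variable mu : {sigma_finite_measure set (Rn R n) -> \bar R}.

Definition tuple_cons (p : measurableTypeR R * Rn R n) : Rn R n.+1 :=
  [tuple of p.1 :: p.2].

Lemma measurable_tuple_cons : measurable_fun [set: _] tuple_cons.
Proof. exact: measurable_cons. Qed.

HB.instance Definition _ :=
  isMeasurableFun.Build _ _ _ _ tuple_cons measurable_tuple_cons.

Definition lebesgue_succ : set (Rn R n.+1) -> \bar R :=
  pushforward (@lebesgue_measure R \x mu) tuple_cons.

Let lebesgue_succ0 : lebesgue_succ set0 = 0.
Proof. exact: measure0. Qed.

Let lebesgue_succ_ge0 A : 0 <= lebesgue_succ A.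
Proof. exact: measure_ge0. Qed.

Let lebesgue_succ_sigma_additive : semi_sigma_additive lebesgue_succ.
Proof. exact: measure_semi_sigma_additive. Qed.

HB.instance Definition _ := isMeasure.Build _ _ _ lebesgue_succ
  lebesgue_succ0 lebesgue_succ_ge0 lebesgue_succ_sigma_additive.

Let lebesgue_succ_sigma_finite : sigma_finite setT lebesgue_succ.
Proof.
have /sigma_finiteP[F [TF ndF Foo]] := sigma_finiteT (@lebesgue_measure R).
have /sigma_finiteP[G [TG ndG Goo]] := sigma_finiteT mu.
pose uncons (x : Rn R n.+1) : measurableTypeR R * Rn R n :=
  (thead x, [tuple of behead x]).
have muncons : measurable_fun [set: _] uncons.
  apply: measurable_fun_pair; first exact: measurable_tnth.
  exact: measurable_behead.
have tuple_consK : cancel tuple_cons uncons.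
  by move=> [x t]; rewrite /uncons /tuple_cons; congr pair; exact: val_inj.
exists (fun k => uncons @^-1` (F k `*` G k)).
  rewrite -preimage_bigcup -[LHS](preimage_setT uncons); congr (_ @^-1` _).
  rewrite -setXTT TF TG; apply/seteqP; split=> [[x t] [[i _ Fix] [j _ Gjt]]|].
    exists (maxn i j) => //; split => /=.
    - by move: (x) Fix; exact/subsetPset/ndF/leq_maxl.
    - by move: (t) Gjt; exact/subsetPset/ndG/leq_maxr.
  by move=> [x t] [i _ [? ?]]; split; exists i.
move=> k; have [mF Fk] := Foo k; have [mG Gk] := Goo k; split.
  by rewrite -[X in measurable X]setTI; apply: muncons => //; exact: measurableX.
rewrite /lebesgue_succ /pushforward -comp_preimage.
rewrite (_ : uncons \o _ = id); last exact/funext.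
by rewrite preimage_id product_measure1E// lte_mul_pinfty// ge0_fin_numE.
Qed.

HB.instance Definition _ := Measure_isSigmaFinite.Build _ _ _ lebesgue_succ
  lebesgue_succ_sigma_finite.

End lebesgue_succ.

Fixpoint lebesgue_Rn (R : realType) (n : nat) :
    {sigma_finite_measure set (Rn R n) -> \bar R} :=
  if n is m.+1 then lebesgue_succ (lebesgue_Rn R m) else \d_([tuple] : Rn R 0).

Local Open Scope complex_scope.

Section complex_vectors.
Context (R : realType) (n : nat).
Implicit Types (z w : Cn R n) (x y : Rn R n).

Definition cdot z w : R[i] := \sum_j z 0 j * w 0 j.

Definition conjv z : Cn R n := map_mx conjc z.

(* |z|^2 = z . conj z, to be distinguished from the library's `|z|, which on
   row vectors is the max norm *)
Definition sqnorm z : R := complex.Re (cdot z (conjv z)).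

Definition Rn_Cn x : Cn R n := \row_j (tnth x j)%:C.

(* the identification of R^n x R^n with C^n, (x, y) |-> x + i y *)
Definition Cn_of (p : Rn R n * Rn R n) : Cn R n :=
  Rn_Cn p.1 + 'i%C *: Rn_Cn p.2.

End complex_vectors.

(* Lebesgue measure on C^n = R^n x R^n; integrands on C^n are precomposed
   with Cn_of *)
Definition lebesgue_Cn (R : realType) (n : nat) :
    {measure set (Rn R n * Rn R n)%type -> \bar R} :=
  (lebesgue_Rn R n \x lebesgue_Rn R n)%E.

Definition cexp (R : realType) (z : R[i]) : R[i] :=
  (expR (complex.Re z))%:C * (cos (complex.Im z) +i* sin (complex.Im z)).

Definition cintegral d (T : measurableType d) (R : realType)
    (mu : {measure set T -> \bar R}) (f : T -> R[i]) : R[i] :=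
  (\int[mu]_t complex.Re (f t)) +i* (\int[mu]_t complex.Im (f t)).

(* Frechet differentiability over the field K at every point; for K = R[i]
   this is complex differentiability. Stated over an abstract K, on which the
   library's topology is found. *)
Definition entire (K : numFieldType) (n : nat) (F : 'rV[K]_n -> K) :=
  forall z : 'rV[K]_n, differentiable (F : 'rV[K]_n -> K^o) z.

Section fock.
Context (R : realType) (n : nat).
Implicit Types (F phi : Cn R n -> R[i]) (z w : Cn R n).

Definition w0 z : R := (2 * pi) ^- n * expR (- (sqnorm z / 2)).

Definition fock_sqnorm F : \bar R :=
  (\int[lebesgue_Cn R n]_p (Normc.normc (F (Cn_of p)) ^+ 2 * w0 (Cn_of p))%:E)%E.

Definition fock F := entire F /\ (fock_sqnorm F < +oo)%E.

Definition fock_norm F : R := Num.sqrt (fine (fock_sqnorm F)).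

(* the dense subspace spanned by the functions w |-> exp (w . conj a / 2) *)
Definition exp_span F :=
  exists (k : nat) (c : 'I_k -> R[i]) (a : 'I_k -> Cn R n),
    F = fun w => \sum_(i < k) c i * cexp (cdot w (conjv (a i)) / 2).

Definition S_op phi F z : R[i] :=
  cintegral (lebesgue_Cn R n) (fun p => let w := Cn_of p in
    F w * phi (z - conjv w) * cexp (cdot z (conjv w) / 2) * (w0 w)%:C).

Definition S_bounded phi :=
  exists C : R, forall F, exp_span F ->
    fock (S_op phi F) /\ fock_norm (S_op phi F) <= C * fock_norm F.

Definition Linfty (m : Rn R n -> R[i]) :=
  [/\ measurable_fun setT (fun x => complex.Re (m x) : measurableTypeR R),
      measurable_fun setT (fun x => complex.Im (m x) : measurableTypeR R) &
      finite_norm (lebesgue_Rn R n) +oo%E (fun x => Normc.normc (m x))].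

Definition gauss_bargmann (f : Rn R n -> R[i]) z : R[i] :=
  cexp (cdot z z / 4) *
  cintegral (lebesgue_Rn R n) (fun xi =>
    f xi * cexp ('i%C * cdot z (Rn_Cn xi)) * (expR (- sqnorm (Rn_Cn xi)))%:C).

End fock.

(* Main.v *)
(** The engine is the mean value formula
    [int_{C^n} K(u) e^{-a|u|^2} du = (pi/a)^n K(0)] for an entire [K] with
    absolutely convergent integral: rotate [u] by [e^{it}], average over [t], and
    apply the mean value property of a function of one variable, which is
    Goursat's theorem for [f(e^{s+it})] on the rectangle [s0 <= s <= 0],
    [0 <= t <= 2pi].

    For [k_a(w) = e^{w . conj a / 2}] the formula yields
    [S_phi k_a (z) = phi(z - conj a) e^{z . conj a / 2}].  Boundedness on [k_a]
    with [a] purely imaginary is (i), and (i) implies (ii) because point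
    evaluations are bounded.

    For the sufficiency put
    [m(xi) = (2pi)^{-n} int phi(x - 2i xi) e^{-x^2/4} dx], which is bounded by
    hypothesis.  Inserted in [G m (z)] it gives, after a translation, the Gaussian
    mean of an entire function whose value at [0] is [phi(z)]; hence [phi = G m].
    If [F = sum c_i k_{a_i}] and [g = sum c_i conj(E_{a_i})], with
    [E_z(xi) = e^{i z . xi + z^2/4}] the kernel of [G], then [S_phi F = G(m g)].
    Plancherel's inequality bounds the norm of [G(m g)] by that of [m g], and the
    Gram matrices of the exponentials show that the norms of [g] and [F] are
    proportional. *)

Require Import Defs.
From HB Require Import structures.
From mathcomp Require Import all_boot all_order all_algebra.
From mathcomp Require Import complex.
From mathcomp Require Import all_classical all_reals all_analysis.
From mathcomp Require Import measurable_realfun ess_sup_inf.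
From mathcomp Require Import ring lra.

Set Implicit Arguments.
Unset Strict Implicit.
Unset Printing Implicit Defensive.

Import Order.TTheory GRing.Theory Num.Theory.
Import numFieldNormedType.Exports.

Local Open Scope classical_set_scope.
Local Open Scope ring_scope.
Local Open Scope complex_scope.

(** * Complex exponentials and the bilinear form on C^n *)

Section complex_exponential.
Context (R : realType).
Implicit Types (z w : R[i]) (x y : R).

(** [entire] gives differentiability at each point and nothing about the derivative, so the mean
    value property has to rest on Goursat's bisection. In the coordinates (s, t) of f(e^{s+it})
    circles become segments and the centre moves off to s = -oo, so that rectangles are the only
    contours.

    The formula for m is Fourier inversion on a shifted contour. Formally, phi = G m says that
    e^{-x^2/4} phi(x) is the Fourier transform of m(xi) e^{-xi^2}. In the inversion integral the
    shift of x to x - 2i xi makes the oscillating factor cancel against the cross term of the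
    Gaussian, and e^{-x^2/4} is left. The shifted formula is taken as the definition and checked
    directly.

    Up to a scalar G is unitary and carries the conjugate of E_a to a multiple of k_a, so S_phi is
    multiplication by m read through G. On finite sums of exponentials this needs an upper bound for
    G and the exact Gram matrices on both sides, which are the same matrix up to the factor
    pi^{n/2}. *)

Lemma sqr_normc_ReIm z :
  Normc.normc z ^+ 2 = complex.Re z ^+ 2 + complex.Im z ^+ 2.
Proof. by case: z => a b /=; rewrite sqr_sqrtr// addr_ge0// sqr_ge0. Qed.

Lemma normc_ge0 z : 0 <= Normc.normc z.
Proof. by case: z => a b; exact: sqrtr_ge0. Qed.

Lemma normr_Re_le z : `|complex.Re z| <= Normc.normc z.
Proof.
rewrite -(@ler_pXn2r _ 2)// ?nnegrE ?normc_ge0//.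
by rewrite sqr_normc_ReIm real_normK ?num_real// lerDl sqr_ge0.
Qed.

Lemma normr_Im_le z : `|complex.Im z| <= Normc.normc z.
Proof.
rewrite -(@ler_pXn2r _ 2)// ?nnegrE ?normc_ge0//.
by rewrite sqr_normc_ReIm real_normK ?num_real// lerDr sqr_ge0.
Qed.

Lemma normc_le_ReIm z :
  Normc.normc z <= `|complex.Re z| + `|complex.Im z|.
Proof.
rewrite -(@ler_pXn2r _ 2)// ?nnegrE ?normc_ge0 ?addr_ge0//.
rewrite sqr_normc_ReIm sqrrD !real_normK ?num_real// lerD2r lerDl.
by rewrite mulrn_wge0// mulr_ge0.
Qed.

Lemma normc_real x : Normc.normc x%:C = `|x|.
Proof. by rewrite /Normc.normc /= expr0n addr0 sqrtr_sqr. Qed.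

Lemma normr_complexE z : `|z| = (Normc.normc z)%:C.
Proof. by rewrite normc_def; case: z. Qed.

Lemma normcMreal z x : 0 <= x -> Normc.normc (z * x%:C) = Normc.normc z * x.
Proof. by move=> x0; rewrite Normc.normcM normc_real ger0_norm. Qed.

Lemma normcX2 z : Normc.normc (z ^+ 2) = Normc.normc z ^+ 2.
Proof. by rewrite !expr2 Normc.normcM. Qed.

Lemma normc_conj z : Normc.normc (z^*) = Normc.normc z.
Proof. by case: z => a b /=; rewrite sqrrN. Qed.

Lemma ReDc z w : complex.Re (z + w) = complex.Re z + complex.Re w.
Proof. by case: z; case: w. Qed.

Lemma ImDc z w : complex.Im (z + w) = complex.Im z + complex.Im w.
Proof. by case: z; case: w. Qed.

Lemma ReNc z : complex.Re (- z) = - complex.Re z. Proof. by case: z. Qed.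

Lemma ImNc z : complex.Im (- z) = - complex.Im z. Proof. by case: z. Qed.

Lemma ReMc z w : complex.Re (z * w) =
  complex.Re z * complex.Re w - complex.Im z * complex.Im w.
Proof. by case: z; case: w. Qed.

Lemma ImMc z w : complex.Im (z * w) =
  complex.Re z * complex.Im w + complex.Im z * complex.Re w.
Proof. by case: z; case: w. Qed.

Lemma ReMreal z x : complex.Re (z * x%:C) = complex.Re z * x.
Proof. by rewrite ReMc /= mulr0 subr0. Qed.

Lemma ImMreal z x : complex.Im (z * x%:C) = complex.Im z * x.
Proof. by rewrite ImMc /= mulr0 add0r. Qed.

Lemma Re_sum (I : Type) (r : seq I) (P : pred I) (F : I -> R[i]) :
  complex.Re (\sum_(i <- r | P i) F i) = \sum_(i <- r | P i) complex.Re (F i).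
Proof. exact: (big_morph (@complex.Re R) ReDc). Qed.

Lemma Im_sum (I : Type) (r : seq I) (P : pred I) (F : I -> R[i]) :
  complex.Im (\sum_(i <- r | P i) F i) = \sum_(i <- r | P i) complex.Im (F i).
Proof. exact: (big_morph (@complex.Im R) ImDc). Qed.

Lemma complex_ReIm_ext z w :
  complex.Re z = complex.Re w -> complex.Im z = complex.Im w -> z = w.
Proof. by case: z => a b; case: w => c d /= -> ->. Qed.

Lemma Re_conjc z : complex.Re (z^*) = complex.Re z. Proof. by case: z. Qed.

Lemma Im_conjc z : complex.Im (z^*) = - complex.Im z. Proof. by case: z. Qed.

Lemma conjc_realE x : (x%:C)^* = x%:C :> R[i].
Proof. by rewrite /= oppr0. Qed.

Lemma conjcM z w : conjc (z * w) = conjc z * conjc w.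
Proof. exact: rmorphM. Qed.

Lemma conjc_sum (I : Type) (r : seq I) (F : I -> R[i]) :
  conjc (\sum_(i <- r) F i) = \sum_(i <- r) conjc (F i).
Proof. exact: (rmorph_sum (@conjc R)). Qed.

Lemma cexp0 : cexp 0 = 1 :> R[i].
Proof. by rewrite /cexp /= expR0 cos0 sin0 mul1r. Qed.

Lemma cexpD z w : cexp (z + w) = cexp z * cexp w.
Proof.
rewrite /cexp ReDc ImDc expRD cosD sinD.
by apply: complex_ReIm_ext; rewrite !(ReMc, ImMc) /=; ring.
Qed.

Lemma cexp_real x : cexp x%:C = (expR x)%:C.
Proof. by rewrite /cexp /= cos0 sin0 mulr1. Qed.

Lemma normc_cexp z : Normc.normc (cexp z) = expR (complex.Re z).
Proof.
rewrite Normc.normcM normc_real gtr0_norm ?expR_gt0//.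
by rewrite /Normc.normc cos2Dsin2 sqrtr1 mulr1.
Qed.

Lemma conjc_cexp z : (cexp z)^* = cexp (z^*).
Proof.
apply: complex_ReIm_ext; rewrite /cexp; case: z => a b /=.
  by rewrite !(mul0r, subr0) cosN.
by rewrite !(mul0r, addr0) sinN mulrN.
Qed.

End complex_exponential.

Section complex_vector_algebra.
Context (R : realType) (n : nat).
Implicit Types (z w u : Cn R n) (x y : Rn R n) (p : Rn R n * Rn R n).

Lemma cdotC z w : cdot z w = cdot w z.
Proof. by apply: eq_bigr => j _; rewrite mulrC. Qed.

Lemma cdotDl z w u : cdot (z + w) u = cdot z u + cdot w u.
Proof. by rewrite -big_split; apply: eq_bigr => j _; rewrite mxE mulrDl. Qed.

Lemma cdotDr z w u : cdot u (z + w) = cdot u z + cdot u w.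
Proof. by rewrite !(cdotC u) cdotDl. Qed.

Lemma cdotZl c z u : cdot (c *: z) u = c * cdot z u.
Proof. by rewrite mulr_sumr; apply: eq_bigr => j _; rewrite mxE mulrA. Qed.

Lemma cdotZr c z u : cdot u (c *: z) = c * cdot u z.
Proof. by rewrite !(cdotC u) cdotZl. Qed.

Lemma cdotNl z u : cdot (- z) u = - cdot z u.
Proof. by rewrite -scaleN1r cdotZl mulN1r. Qed.

Lemma cdotNr z u : cdot u (- z) = - cdot u z.
Proof. by rewrite !(cdotC u) cdotNl. Qed.

Lemma cdot0l u : cdot 0 u = 0.
Proof. by rewrite -(scale0r 0) cdotZl mul0r. Qed.

Lemma cdot0r u : cdot u 0 = 0.
Proof. by rewrite cdotC cdot0l. Qed.

Lemma conjvD z w : conjv (z + w) = conjv z + conjv w.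
Proof. exact: (raddfD (map_mx (@conjc R))). Qed.

Lemma conjvN z : conjv (- z) = - conjv z.
Proof. exact: (raddfN (map_mx (@conjc R))). Qed.

Lemma conjvK : involutive (@conjv R n).
Proof. by move=> z; apply/rowP => j; rewrite !mxE conjcK. Qed.

Lemma conjvZ (c : R[i]) z : conjv (c *: z) = c^* *: conjv z.
Proof. by apply/rowP => j; rewrite !mxE rmorphM. Qed.

Lemma conjv_real x : conjv (Rn_Cn x) = Rn_Cn x.
Proof. by apply/rowP => j; rewrite !mxE; exact: conjc_realE. Qed.

Lemma cdot_conj z w : (cdot z w)^* = cdot (conjv z) (conjv w).
Proof.
rewrite /cdot raddf_sum; apply: eq_bigr => j _.
by rewrite !mxE; exact: rmorphM.
Qed.

Definition rdot x y : R := \sum_j tnth x j * tnth y j.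

Lemma rdotC x y : rdot x y = rdot y x.
Proof. by apply: eq_bigr => j _; rewrite mulrC. Qed.

Lemma cdot_real x y : cdot (Rn_Cn x) (Rn_Cn y) = (rdot x y)%:C.
Proof.
by rewrite /rdot rmorph_sum; apply: eq_bigr => j _; rewrite !mxE rmorphM.
Qed.

Lemma sqnormE z : sqnorm z = \sum_j Normc.normc (z 0 j) ^+ 2.
Proof.
rewrite /sqnorm Re_sum; apply: eq_bigr => j _.
by rewrite mxE sqr_normc_ReIm; case: (z 0 j) => a b /=; ring.
Qed.

Lemma sqnorm_ge0 z : 0 <= sqnorm z.
Proof. by rewrite sqnormE; apply: sumr_ge0 => j _; rewrite sqr_ge0. Qed.

Lemma sqnormC z : (sqnorm z)%:C = cdot z (conjv z).
Proof.
apply: complex_ReIm_ext => //=; rewrite Im_sum big1// => j _.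
by rewrite mxE; case: (z 0 j) => a b /=; ring.
Qed.

Lemma Cn_ofE p : Cn_of p = Rn_Cn p.1 + 'i%C *: Rn_Cn p.2.
Proof. by []. Qed.

Lemma conjv_Cn_of p : conjv (Cn_of p) = Rn_Cn p.1 - 'i%C *: Rn_Cn p.2.
Proof.
rewrite Cn_ofE conjvD conjvZ !conjv_real; congr (_ + _).
by rewrite -scaleNr; congr (_ *: _); apply: complex_ReIm_ext => /=; rewrite ?oppr0.
Qed.

Lemma sqnorm_Cn_of p : sqnorm (Cn_of p) = rdot p.1 p.1 + rdot p.2 p.2.
Proof.
apply: (@complexI R); rewrite sqnormC conjv_Cn_of Cn_ofE.
rewrite cdotDl !cdotDr !(cdotNr, cdotZl, cdotZr) !cdot_real rmorphD/=.
rewrite (rdotC p.2 p.1).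
by apply: complex_ReIm_ext; rewrite !(ReMc, ImMc, ReDc, ImDc, ReNc, ImNc)/=; ring.
Qed.

Lemma sqnorm_real x : sqnorm (Rn_Cn x) = rdot x x.
Proof. by rewrite /sqnorm conjv_real cdot_real. Qed.

End complex_vector_algebra.

(** * Goursat's theorem on a rectangle *)

Section goursat.
Context (R : realType).
Local Notation mu := (@lebesgue_measure R).
Implicit Types (f g : R -> R) (a b c d : R).

Definition itg f a b : R := \int[mu]_(t in `[a, b]) f t.

Lemma continuous_itv_integrable f a b : continuous f ->
  mu.-integrable `[a, b] (EFin \o f).
Proof.
move=> cf; apply: continuous_compact_integrable; first exact: segment_compact.
exact: continuous_subspaceT.
Qed.

Lemma itg_split f a m b : continuous f -> a <= m -> m <= b ->
  itg f a b = itg f a m + itg f m b.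
Proof.
move=> cf am mb; rewrite /itg.
have := @Rintegral_itvB R f (BLeft a) (BRight b) m (continuous_itv_integrable a b cf).
rewrite !bnd_simp => /(_ am mb) /eqP; rewrite subr_eq addrC => /eqP ->.
rewrite Rintegral_itv_obnd_cbnd//.
apply: (@integrableS _ _ _ mu `[m, b]) => //; last exact: continuous_itv_integrable.
by apply: subset_itvr; rewrite bnd_simp.
Qed.

Lemma itgB f g a b : continuous f -> continuous g ->
  itg (fun t => f t - g t) a b = itg f a b - itg g a b.
Proof. by move=> cf cg; rewrite /itg RintegralB//; exact: continuous_itv_integrable. Qed.

Lemma itg_cst (k : R) a b : a <= b -> itg (fun=> k) a b = k * (b - a).
Proof.
move=> ab; rewrite /itg Rintegral_cst//=.
by rewrite lebesgue_measure_itv/= lte_fin; case: ltgtP ab => // ->; rewrite subrr.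
Qed.

Lemma itg_near_cst f (k M : R) a b : continuous f -> a <= b ->
  (forall t, a <= t <= b -> `|f t - k| <= M) ->
  `|itg f a b - k * (b - a)| <= M * (b - a).
Proof.
move=> cf ab fM; have ck : continuous (fun _ : R => k : R^o) by move=> ?; exact: cvg_cst.
have cM : continuous (fun _ : R => M : R^o) by move=> ?; exact: cvg_cst.
have cfk : continuous (fun t => f t - k) by move=> t; apply: cvgB; [exact: cf|exact: ck].
rewrite -itg_cst// -itgB//.
apply: le_trans (le_normr_Rintegral _ _) _ => //; first exact: continuous_itv_integrable.
rewrite -(@itg_cst M)//; apply: le_Rintegral => //.
- apply: continuous_itv_integrable => t.
  by apply: cvg_norm; exact: cfk.
- exact: continuous_itv_integrable.
Qed.

Variables U V : R -> R -> R.

(** Real form of complex differentiability of U + iV: the same [A] is the partial of [U] in s and of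
    [V] in t. Thus the 1-form V ds + U dt, the imaginary part of (U + iV)(ds + i dt), is closed in
    the pointwise sense. *)
Hypothesis UVd : forall s t, exists A B C, forall e, 0 < e -> exists2 d, 0 < d &
  forall s' t', `|s' - s| <= d -> `|t' - t| <= d ->
    `|U s' t' - U s t - A * (s' - s) - B * (t' - t)| <= e * (`|s' - s| + `|t' - t|) /\
    `|V s' t' - V s t - C * (s' - s) - A * (t' - t)| <= e * (`|s' - s| + `|t' - t|).

Lemma partial_continuous_U s : continuous (U s).
Proof.
move=> t; have [A [B [C H]]] := UVd s t; have [d d0 {}H] := H 1 ltr01.
apply/cvgrPdist_le => e e0; near=> t'.
have /H {H} : `|s - s| <= d by rewrite subrr normr0 ltW.
have td : `|t' - t| <= d by rewrite distrC; near: t'; exact: cvgr_dist_le.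
have te : `|t' - t| * (1 + `|B|) <= e.
  rewrite -ler_pdivlMr ?ltr_wpDr//; rewrite distrC; near: t'.
  by apply: cvgr_dist_le => //; rewrite divr_gt0// ltr_wpDr.
move=> /(_ _ td)[+ _]; rewrite subrr mulr0 subr0 normr0 add0r mul1r => H.
rewrite distrC; apply: le_trans te.
rewrite -(subrK (B * (t' - t)) (U s t' - U s t)).
apply: le_trans (ler_normD _ _) _.
by rewrite normrM (mulrC `|B|) [leRHS]mulrDr mulr1 lerD2r.
Unshelve. all: by end_near. Qed.

Lemma partial_continuous_V t : continuous (V ^~ t).
Proof.
move=> s; have [A [B [C H]]] := UVd s t; have [d d0 {}H] := H 1 ltr01.
apply/cvgrPdist_le => e e0; near=> s'.
have td : `|t - t| <= d by rewrite subrr normr0 ltW.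
have sd : `|s' - s| <= d by rewrite distrC; near: s'; exact: cvgr_dist_le.
have se : `|s' - s| * (1 + `|C|) <= e.
  rewrite -ler_pdivlMr ?ltr_wpDr//; rewrite distrC; near: s'.
  by apply: cvgr_dist_le => //; rewrite divr_gt0// ltr_wpDr.
have [_] := H _ _ sd td; rewrite subrr mulr0 subr0 normr0 addr0 mul1r => {}H.
rewrite distrC; apply: le_trans se.
rewrite -(subrK (C * (s' - s)) (V s' t - V s t)).
apply: le_trans (ler_normD _ _) _.
by rewrite normrM (mulrC `|C|) [leRHS]mulrDr mulr1 lerD2r.
Unshelve. all: by end_near. Qed.

(** The integral of V ds + U dt counterclockwise around the rectangle; inner edges cancel under
    subdivision. *)
Let I a b c d : R := itg (fun t => U b t - U a t) c d
                   - itg (fun s => V s d - V s c) a b.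

Let IE a b c d : I a b c d = itg (U b) c d - itg (U a) c d
  - (itg (V^~ d) a b - itg (V ^~ c) a b).
Proof.
rewrite /I !itgB//; [exact: partial_continuous_V..| |];
  exact: partial_continuous_U.
Qed.

Let I_split a m b c k d : a <= m -> m <= b -> c <= k -> k <= d ->
  I a b c d = I a m c k + I a m k d + I m b c k + I m b k d.
Proof.
move=> am mb ck kd; rewrite !IE.
rewrite !(@itg_split (U _) c k d) //; [|exact: partial_continuous_U..].
rewrite !(@itg_split (V ^~ _) a m b) //; [|exact: partial_continuous_V..].
ring.
Qed.

(** The affine parts of [U] and [V] contribute the same term [A * (b - a) * (d - c)] to the two
    integrals, and it drops out of their difference. The remaining error is of order e times the
    side lengths and is integrated along the sides, hence quadratic in the size. *)
Let I_local s t e : 0 < e -> exists2 del, 0 < del & forall a b c d,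
  a <= s <= b -> c <= t <= d -> b - a <= del -> d - c <= del ->
  `|I a b c d| <= e * (b - a + (d - c)) ^+ 2.
Proof.
move=> e0; have [A [B [C H]]] := UVd s t.
have [del del0 {}H] := H (e / 2) ltac:(by rewrite divr_gt0).
exists del => // a b c d /andP[as_ sb] /andP[ct td] ab cd.
have ab' : a <= b by exact: le_trans sb.
have cd' : c <= d by exact: le_trans td.
have bnd x y : a <= x <= b -> c <= y <= d ->
  `|U x y - U s t - A * (x - s) - B * (y - t)| <= e / 2 * (b - a + (d - c)) /\
  `|V x y - V s t - C * (x - s) - A * (y - t)| <= e / 2 * (b - a + (d - c)).
  move=> /andP[ax xb] /andP[cy yd].
  have xs : `|x - s| <= b - a by rewrite ler_norml; apply/andP; split; lra.
  have yt : `|y - t| <= d - c by rewrite ler_norml; apply/andP; split; lra.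
  have [] := H x y (le_trans xs ab) (le_trans yt cd).
  by split; (apply: le_trans; first eassumption);
    rewrite ler_pM2l ?divr_gt0// lerD.
have L1 : `|itg (fun t => U b t - U a t) c d - A * (b - a) * (d - c)| <=
    e * (b - a + (d - c)) * (d - c).
  apply: itg_near_cst => //.
    by move=> y; apply: cvgB; exact: partial_continuous_U.
  move=> y cyd; have [+ _] := bnd b y ltac:(by rewrite ab' lexx) cyd.
  have [+ _] := bnd a y ltac:(by rewrite ab' lexx) cyd.
  by rewrite !ler_norml => /andP[? ?] /andP[? ?]; apply/andP; split; lra.
have L2 : `|itg (fun s => V s d - V s c) a b - A * (d - c) * (b - a)| <=
    e * (b - a + (d - c)) * (b - a).
  apply: itg_near_cst => //.
    by move=> y; apply: cvgB; exact: partial_continuous_V.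
  move=> x axb; have [_] := bnd x d axb ltac:(by rewrite cd' lexx).
  have [_] := bnd x c axb ltac:(by rewrite cd' lexx).
  by rewrite !ler_norml => /andP[? ?] /andP[? ?]; apply/andP; split; lra.
rewrite /I; move: L1 L2; rewrite !ler_norml => /andP[? ?] /andP[? ?].
by apply/andP; split; lra.
Qed.

Let quarter a c h k : 0 <= h -> 0 <= k -> exists p : R * R,
  [/\ a <= p.1 <= a + h / 2, c <= p.2 <= c + k / 2 &
  `|I a (a + h) c (c + k)| / 4 <= `|I p.1 (p.1 + h / 2) p.2 (p.2 + k / 2)|].
Proof.
move=> h0 k0; have ah := @I_split a (a + h / 2) (a + h) c (c + k / 2) (c + k).
have {}ah := ah ltac:(lra) ltac:(lra) ltac:(lra) ltac:(lra).
apply: contrapT => N.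
have {}N p : a <= p.1 <= a + h / 2 -> c <= p.2 <= c + k / 2 ->
  `|I p.1 (p.1 + h / 2) p.2 (p.2 + k / 2)| < `|I a (a + h) c (c + k)| / 4.
  by move=> ? ?; rewrite ltNge; apply/negP => ?; apply: N; exists p.
have ha : a <= a <= a + h / 2 by apply/andP; split; lra.
have ha2 : a <= a + h / 2 <= a + h / 2 by apply/andP; split; lra.
have kc : c <= c <= c + k / 2 by apply/andP; split; lra.
have kc2 : c <= c + k / 2 <= c + k / 2 by apply/andP; split; lra.
have := N (a, c) ha kc; have := N (a, c + k / 2) ha kc2.
have := N (a + h / 2, c) ha2 kc; have := N (a + h / 2, c + k / 2) ha2 kc2.
rewrite /= -!addrA -!splitr => N1 N2 N3 N4.
have : `|I a (a + h) c (c + k)| < `|I a (a + h) c (c + k)|; last by rewrite ltxx.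
rewrite {1}ah.
apply: le_lt_trans (ler_normD _ _) _.
apply: le_lt_trans (lerD (ler_normD _ _) (lexx _)) _.
apply: le_lt_trans (lerD (lerD (ler_normD _ _) (lexx _)) (lexx _)) _.
lra.
Qed.

(** Among nested quarters, the j-th carries at least the fraction 4^{-j} of the boundary integral,
    while [I_local] at their common point bounds it by a small multiple of the squared size, which
    also scales like 4^{-j}. Differentiability at that limit point decides. *)
Theorem goursat a b c d : a <= b -> c <= d ->
  itg (fun t => U b t - U a t) c d = itg (fun s => V s d - V s c) a b.
Proof.
move=> ab cd; apply/eqP; rewrite -subr_eq0 -normr_eq0 -/(I a b c d).
pose h j : R := (b - a) / 2 ^+ j; pose k j : R := (d - c) / 2 ^+ j.
have h0 j : 0 <= h j by rewrite divr_ge0 ?exprn_ge0// subr_ge0.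
have k0 j : 0 <= k j by rewrite divr_ge0 ?exprn_ge0// subr_ge0.
have hS j : h j.+1 = h j / 2 by rewrite /h exprS invfM; ring.
have kS j : k j.+1 = k j / 2 by rewrite /k exprS invfM; ring.
pose nxt (jp : nat * (R * R)) := (jp.1.+1,
  projT1 (cid (quarter jp.2.1 jp.2.2 (h0 jp.1) (k0 jp.1)))).
pose P j := (iter j nxt (0%N, (a, c))).2.
have iter1 j : (iter j nxt (0%N, (a, c))).1 = j by elim: j => //= j ->.
have PS j : [/\ (P j).1 <= (P j.+1).1 <= (P j).1 + h j / 2,
   (P j).2 <= (P j.+1).2 <= (P j).2 + k j / 2 &
   `|I (P j).1 ((P j).1 + h j) (P j).2 ((P j).2 + k j)| / 4 <=
   `|I (P j.+1).1 ((P j.+1).1 + h j.+1) (P j.+1).2 ((P j.+1).2 + k j.+1)|].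
  have -> : P j.+1 = projT1 (cid (quarter (P j).1 (P j).2 (h0 j) (k0 j))).
    by rewrite /P iterS; move: (iter1 j); case: (iter j nxt _) => i p /= ->.
  by rewrite hS kS; case: cid.
have big j : `|I a b c d| / 4 ^+ j <=
   `|I (P j).1 ((P j).1 + h j) (P j).2 ((P j).2 + k j)|.
  elim: j => [|j IH].
    by rewrite /P /h /k /= expr0 !divr1 !(addrC _ (_ - _)) !subrK.
  have [_ _] := PS j; apply: le_trans.
  by rewrite exprSr invfM mulrA ler_pM2r ?invr_gt0.
have nested (x l : nat -> R) : (forall j, 0 <= l j) -> (forall j, l j.+1 = l j / 2) ->
    (forall j, x j <= x j.+1 <= x j + l j / 2) ->
    exists s, forall j, x j <= s <= x j + l j.
  move=> l0 lS xS.
  have mon i j : (i <= j)%N -> x i <= x j /\ x j + l j <= x i + l i.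
    elim: j => [|j IH]; first by rewrite leqn0 => /eqP ->.
    rewrite leq_eqVlt => /predU1P[->//|]; rewrite ltnS => /IH[? ?].
    by have /andP[? ?] := xS j; rewrite lS; split; lra.
  have ub j : ubound (range x) (x j + l j).
    move=> _ [i _ <-]; have [ij|ji] := leqP i j.
      by have [? ?] := mon _ _ ij; have := l0 j; lra.
    by have [? ?] := mon _ _ (ltnW ji); have := l0 i; lra.
  exists (sup (range x)) => j; apply/andP; split.
    by apply: ub_le_sup; [exists (x 0%N + l 0%N); exact: ub|exists j].
  by apply: ge_sup => //; exists (x 0%N), 0%N.
have [s sP] := nested (fun j => (P j).1) h h0 hS (fun j => let: And3 H _ _ := PS j in H).
have [t tP] := nested (fun j => (P j).2) k k0 kS (fun j => let: And3 _ H _ := PS j in H).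
rewrite eq_le normr_ge0 andbT.
apply/ler_addgt0Pl => e e0; rewrite addr0.
(* The summand 1 keeps [M] positive when the rectangle is degenerate. *)
pose M := (b - a + (d - c)) ^+ 2 + 1.
have M0 : 0 < M by rewrite ltr_wpDl// sqr_ge0.
have [del del0 loc] := I_local s t (e := e / M) ltac:(by rewrite divr_gt0).
have [j jd] : exists j : nat, (b - a + (d - c)) / 2 ^+ j <= del.
  have : (fun j : nat => (b - a + (d - c)) * (2^-1) ^+ j) @ \oo --> (0 : R).
    rewrite -(mulr0 (b - a + (d - c))); apply: cvgM; first exact: cvg_cst.
    by apply: cvg_expr; rewrite ger0_norm ?invr_ge0// invf_lt1 ?ltr1n.
  move=> /cvgrPdist_le /(_ _ del0)[j _ /(_ j (leqnn j))]; rewrite sub0r normrN => H.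
  by exists j; apply: le_trans H; rewrite exprVn ler_norm.
have ba0 : 0 <= b - a by rewrite subr_ge0.
have dc0 : 0 <= d - c by rewrite subr_ge0.
have hkE : h j + k j = (b - a + (d - c)) / 2 ^+ j by rewrite /h /k -mulrDl.
have := loc _ _ _ _ (sP j) (tP j).
rewrite !(addrC _ (h j)) !(addrC _ (k j)) !addrK.
have hk1 : h j <= del by have := k0 j; lra.
have hk2 : k j <= del by have := h0 j; lra.
rewrite hkE => /(_ hk1 hk2) {}loc.
have {big} := big j.
rewrite (addrC _ (h j)) (addrC _ (k j)) => /le_trans /(_ loc).
rewrite expr_div_n -exprM mulnC exprM (_ : 2 ^+ 2 = 4 :> R); last by ring.
rewrite mulrA ler_pM2r ?invr_gt0 ?exprn_gt0// => /le_trans; apply.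
by rewrite mulrAC ler_pdivrMr// ler_pM2l// /M lerDl.
Qed.

End goursat.

(** * Entire functions and the mean value on circles *)

Section holomorphic_scalar.
Context (K : numFieldType).
Implicit Types (g : K -> K) (z : K).

(** Over an abstract field, so as to serve [expR], [cos] and [sin] on [R] as well as functions on
    [R[i]]. *)
Lemma derive_expansion g z D : is_derive z (1 : K^o) (g : K^o -> K^o) D ->
  forall e, 0 < e -> exists2 d, 0 < d &
    forall h, `|h| <= d -> `|g (z + h) - g z - D * h| <= e * `|h|.
Proof.
move=> [/cvgP + DE] e; rewrite -/(derive _ _ _) DE => /cvgrPdist_le H /H.
rewrite /dnbhs near_withinE => /nbhs_ballP[d /= d0 {}H].
exists (d / 2); first by rewrite divr_gt0.
move=> h hd; have [->|h0] := eqVneq h 0.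
  by rewrite addr0 subrr mulr0 subr0 normr0 mulr0.
have := H h; rewrite /ball /= sub0r normrN => /(_ _ h0).
have hd' : `|h| < d by apply: le_lt_trans hd _; rewrite ltr_pdivrMr// ltr_pMr// ltr1n.
move=> /(_ hd'); rewrite /GRing.scale /= mulr1 => {}H.
rewrite -normrN opprB.
have -> : D * h - (g (z + h) - g z) = h * (D - h^-1 * (g (h + z) - g z)).
  by rewrite mulrBr mulrA divff// mul1r mulrC (addrC h).
by rewrite normrM mulrC ler_wpM2r.
Qed.

Lemma differentiable1P g z : differentiable (g : K^o -> K^o) z <->
  exists D, forall e, 0 < e -> exists2 d, 0 < d &
    forall h, `|h| <= d -> `|g (z + h) - g z - D * h| <= e * `|h|.
Proof.
split => [/derivable1_diffP zg | [D H]].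
  by exists ('D_1 (g : K^o -> K^o) z); apply: derive_expansion; exact: DeriveDef.
apply/derivable1_diffP/cvg_ex; exists D; apply/cvgrPdist_le => e /H[d d0 {}H].
rewrite /dnbhs near_withinE; near=> h => h0.
have /H {}H : `|h| <= d.
  near: h; apply/nbhs_ballP; exists d => //= y.
  by rewrite /ball /= sub0r normrN => /ltW.
rewrite /GRing.scale /= mulr1 -normrN opprB.
rewrite -(ler_pM2l (x := `|h|)) ?normr_gt0// -normrM.
rewrite mulrBr mulrA divff// mul1r mulrC (addrC h).
by rewrite mulrC (mulrC h D) (mulrC `|h|).
Unshelve. all: by end_near. Qed.

End holomorphic_scalar.

Definition holo (K : numFieldType) (g : K -> K) :=
  forall z, differentiable (g : K^o -> K^o) z.

Lemma holo_comp (K : numFieldType) (g1 g2 : K -> K) :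
  holo g1 -> holo g2 -> holo (g1 \o g2).
Proof.
by move=> h1 h2 z; exact: (@differentiable_comp _ K^o K^o K^o g2 g1 z (h2 z) (h1 _)).
Qed.

Section entire_functions.
Context (K : numFieldType) (n : nat).
Implicit Types (F G : 'rV[K]_n -> K) (g : K -> K).

Lemma entire_cst (c : K) : entire (fun _ : 'rV[K]_n => c).
Proof. by move=> z; exact: differentiable_cst. Qed.

Lemma entireM F G : entire F -> entire G -> entire (fun z => F z * G z).
Proof. by move=> dF dG z; exact: (differentiableM (dF z) (dG z)). Qed.

Lemma entireX2 F : entire F -> entire (fun z => F z ^+ 2).
Proof. by move=> dF; exact: (entireM dF dF). Qed.

Lemma entire_sum m (F : 'I_m -> 'rV[K]_n -> K) :
  (forall i, entire (F i)) -> entire (fun z => \sum_(i < m) F i z).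
Proof.
move=> dF z; rewrite (_ : (fun _ => _) = (\sum_(i < m) F i : 'rV[K]_n -> K^o)).
  by apply: differentiable_sum => i; exact: dF.
by apply/funext => w; rewrite fct_sumE.
Qed.

Lemma entire_lin (c : 'I_n -> K) : entire (fun z : 'rV[K]_n => \sum_j c j * z 0 j).
Proof.
apply: entire_sum => j; apply: entireM; first exact: entire_cst.
by move=> z; exact: differentiable_coord.
Qed.

Lemma entire_scalar_comp g F : holo g ->
  entire F -> entire (g \o F).
Proof.
move=> dg dF z.
exact: (@differentiable_comp _ 'rV[K]_n K^o K^o F g z (dF z) (dg (F z))).
Qed.

Lemma differentiable_affine (v z : 'rV[K]_n) (s : K) :
  differentiable (fun w : 'rV[K]_n => v + s *: w : 'rV[K]_n) z.
Proof.
apply: differentiableD; first exact: differentiable_cst.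
by apply: differentiableZ.
Qed.

Lemma entire_affine F (v : 'rV[K]_n) (s : K) : entire F ->
  entire (fun z => F (v + s *: z)).
Proof.
move=> dF z; apply: (@differentiable_comp _ 'rV[K]_n 'rV[K]_n K^o
  (fun w => v + s *: w) F); last exact: dF.
exact: differentiable_affine.
Qed.

Lemma holo_line F (v u : 'rV[K]_n) : entire F ->
  holo (fun s : K => F (v + s *: u)).
Proof.
move=> dF s; apply: (@differentiable_comp _ K^o 'rV[K]_n K^o
  (fun s => v + s *: u) F); last exact: dF.
apply: differentiableD; first exact: differentiable_cst.
exact: differentiableZl.
Qed.

End entire_functions.

Section complex_holomorphic.
Context (R : realType).
Implicit Types (g : R[i] -> R[i]) (z h : R[i]).

Lemma holoP g : holo g <-> forall z, exists D, forall e : R, 0 < e ->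
  exists2 d : R, 0 < d & forall h, Normc.normc h <= d ->
    Normc.normc (g (z + h) - g z - D * h) <= e * Normc.normc h.
Proof.
split=> gP z; [have /differentiable1P[D H] := gP z | apply/differentiable1P;
  have [D H] := gP z]; exists D => e e0.
  have [|[d d'] d0 {}H] := H e%:C; first by rewrite ltcR.
  (* A positive element of [R[i]] has imaginary part 0, so the radius is a real number. *)
  move: d0; rewrite ltcE /= => /andP[/eqP d'0 d0]; rewrite {}d'0 in H.
  exists d => // h hd; have := H h.
  by rewrite !normr_complexE -rmorphM/= !lecR; exact.
move: e0 H; case: e => e e'; rewrite ltcE /= => /andP[/eqP -> e0] H.
have [d d0 {}H] := H e e0; exists d%:C; first by rewrite ltcR.
by move=> h; rewrite complexr0 !normr_complexE -rmorphM/= !lecR; exact: H.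
Qed.

Let expR_at0 : forall e : R, 0 < e -> exists2 d : R, 0 < d &
  forall x, `|x| <= d -> `|expR x - 1 - x| <= e * `|x|.
Proof.
move=> e /(derive_expansion (is_derive_expR (0 : R)))[d d0 H]; exists d => // x /H.
by rewrite add0r expR0 mul1r.
Qed.

Let cos_at0 : forall e : R, 0 < e -> exists2 d : R, 0 < d &
  forall x, `|x| <= d -> `|cos x - 1| <= e * `|x|.
Proof.
move=> e /(derive_expansion (is_derive_cos (0 : R)))[d d0 H]; exists d => // x /H.
by rewrite add0r cos0 sin0 oppr0 mul0r subr0.
Qed.

Let sin_at0 : forall e : R, 0 < e -> exists2 d : R, 0 < d &
  forall x, `|x| <= d -> `|sin x - x| <= e * `|x|.
Proof.
move=> e /(derive_expansion (is_derive_sin (0 : R)))[d d0 H]; exists d => // x /H.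
by rewrite add0r cos0 sin0 subr0 mul1r.
Qed.

Lemma cexp_at0 (e : R) : 0 < e -> exists2 d : R, 0 < d & forall h,
  Normc.normc h <= d -> Normc.normc (cexp h - 1 - h) <= e * Normc.normc h.
Proof.
move=> e0; wlog e1 : e e0 / e <= 1.
  move=> H; have m0 : 0 < Num.min e 1 by rewrite lt_min e0 ltr01.
  have [|d d0 {}H] := H _ m0; first by rewrite ge_min lexx orbT.
  exists d => // h /H /le_trans; apply; apply: ler_wpM2r; first exact: normc_ge0.
  by rewrite ge_min lexx.
(* Real and imaginary parts each collect at most four errors (e/8)|h|, which add up to e|h|. The
   bound [e / 8] built into [d] also controls the quadratic term [(expR a - 1) * b]. *)
have e8 : 0 < e / 8 by rewrite divr_gt0.
have [d1 d10 H1] := expR_at0 e8; have [d2 d20 H2] := cos_at0 e8.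
have [d3 d30 H3] := sin_at0 e8.
pose d := Num.min (Num.min d1 d2) (Num.min d3 (e / 8)).
have d0 : 0 < d by rewrite !lt_min d10 d20 d30 e8.
exists d => // h hd.
have ha : `|complex.Re h| <= d by exact: le_trans (normr_Re_le _) hd.
have hb : `|complex.Im h| <= d by exact: le_trans (normr_Im_le _) hd.
have na := normr_Re_le h; have nb := normr_Im_le h.
apply: le_trans (normc_le_ReIm _) _.
move: ha hb; rewrite /d !le_min => /andP[/andP[/H1 a1 a2] /andP[a3 a4]].
move=> /andP[/andP[b1 /H2 b2] /andP[/H3 b3 b4]].
rewrite /cexp !(ReDc, ImDc, ReNc, ImNc, ReMc, ImMc)/=.
set a := complex.Re h in na a1 a2 a3 a4 *; set b := complex.Im h in nb b1 b2 b3 b4 *.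
have c1 : `|cos b| <= 1 by rewrite ler_norml cos_geN1 cos_le1.
have a41 : `|a| <= 1 / 8 by apply: le_trans a4 _; rewrite ler_wpM2r.
have ea : `|expR a - 1| <= 2 * `|a|.
  rewrite -(subrK a (expR a - 1)); apply: le_trans (ler_normD _ _) _.
  apply: le_trans (lerD a1 (lexx _)) _.
  have := normr_ge0 a; nra.
have ea2 : `|expR a| <= 2.
  rewrite -(subrK 1 (expR a)); apply: le_trans (ler_normD _ _) _.
  by rewrite normr1; lra.
have n0 := normc_ge0 h.
have L1 : `|expR a * cos b - 0 * sin b - 1 - a| <= 4 * (e / 8) * Normc.normc h.
  have -> : expR a * cos b - 0 * sin b - 1 - a =
    cos b * (expR a - 1 - a) + (1 + a) * (cos b - 1) by ring.
  apply: le_trans (ler_normD _ _) _; rewrite !normrM.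
  have h1 : `|cos b| * `|expR a - 1 - a| <= e / 8 * `|a|.
    by rewrite -[leRHS]mul1r ler_pM.
  have h2 : `|1 + a| * `|cos b - 1| <= 2 * (e / 8 * `|b|).
    rewrite ler_pM//; apply: le_trans (ler_normD _ _) _.
    by rewrite normr1; lra.
  by have := normr_ge0 a; have := normr_ge0 b; nra.
have L2 : `|expR a * sin b + 0 * cos b + - 0 - b| <= 4 * (e / 8) * Normc.normc h.
  have -> : expR a * sin b + 0 * cos b + - 0 - b =
    expR a * (sin b - b) + (expR a - 1) * b by ring.
  apply: le_trans (ler_normD _ _) _; rewrite !normrM.
  have h1 : `|expR a| * `|sin b - b| <= 2 * (e / 8 * `|b|) by rewrite ler_pM.
  have h2 : `|expR a - 1| * `|b| <= 2 * (e / 8) * `|b|.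
    by rewrite ler_wpM2r//; lra.
  by have := normr_ge0 a; have := normr_ge0 b; nra.
by move: L1 L2; rewrite oppr0 !addr0 => L1 L2; lra.
Qed.

Lemma holo_cexp : holo (@cexp R).
Proof.
apply/holoP => z; exists (cexp z) => e e0.
have c0 : 0 < expR (complex.Re z) by exact: expR_gt0.
have [|d d0 H] := @cexp_at0 (e / expR (complex.Re z)); first by rewrite divr_gt0.
exists d => // h /H {}H.
rewrite cexpD (_ : _ - _ - _ = cexp z * (cexp h - 1 - h)); last by ring.
by rewrite Normc.normcM normc_cexp mulrC -ler_pdivlMr// mulrAC.
Qed.

Lemma entire_cexp n (F : 'rV[R[i]]_n -> R[i]) : entire F ->
  entire (fun z : 'rV[R[i]]_n => cexp (F z)).
Proof. by move=> dF; exact: (entire_scalar_comp holo_cexp dF). Qed.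

Lemma entire_cdot n (c : 'rV[R[i]]_n) : entire (fun z : 'rV[R[i]]_n => cdot c z).
Proof. exact: (@entire_lin R[i] n (fun j => c 0 j)). Qed.

End complex_holomorphic.

Section circle_mean.
Context (R : realType).
Implicit Types (g : R[i] -> R[i]).

Lemma holo_eps_continuous g (z : R[i]) : holo g -> forall e : R, 0 < e ->
  exists2 d : R, 0 < d & forall h, Normc.normc h <= d -> Normc.normc (g (z + h) - g z) <= e.
Proof.
move=> /holoP/(_ z)[D H] e e0; have [d d0 {}H] := H 1 ltr01.
pose M := 1 + Normc.normc D.
have M0 : 0 < M by rewrite ltr_wpDr// normc_ge0.
exists (Num.min d (e / M)); first by rewrite lt_min d0 divr_gt0.
move=> h; rewrite le_min => /andP[/H {}H]; rewrite ler_pdivlMr// => he.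
rewrite -(subrK (D * h) (g (z + h) - g z)).
apply: le_trans (le_normcD _ _) _; rewrite Normc.normcM.
by move: he H; rewrite /M mulrDr; nra.
Qed.

Lemma polar_cauchy_riemann G : holo G -> forall s t : R,
  exists A B C, forall e, 0 < e -> exists2 d, 0 < d &
  forall s' t' : R, `|s' - s| <= d -> `|t' - t| <= d ->
    `|complex.Re (G (s' +i* t')) - complex.Re (G (s +i* t))
      - A * (s' - s) - B * (t' - t)| <= e * (`|s' - s| + `|t' - t|) /\
    `|complex.Im (G (s' +i* t')) - complex.Im (G (s +i* t))
      - C * (s' - s) - A * (t' - t)| <= e * (`|s' - s| + `|t' - t|).
Proof.
move=> hG s t; have [D H] := (holoP G).1 hG (s +i* t).
exists (complex.Re D), (- complex.Im D), (complex.Im D) => e e0.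
have [d d0 {}H] := H e e0; exists (d / 2); first by rewrite divr_gt0.
move=> s' t' sd td; pose h := (s' - s) +i* (t' - t).
have hn : Normc.normc h <= `|s' - s| + `|t' - t| by exact: normc_le_ReIm.
have {}H := H h ltac:(lra).
have {}H : Normc.normc (G (s +i* t + h) - G (s +i* t) - D * h) <=
    e * (`|s' - s| + `|t' - t|) by apply: le_trans H _; rewrite ler_pM2l.
have E : s +i* t + h = s' +i* t' by apply: complex_ReIm_ext => /=; ring.
rewrite {}E in H; split; (apply: le_trans H).
  apply: le_trans _ (normr_Re_le _); rewrite !(ReDc, ReNc, ReMc, ImDc, ImNc) /=.
  by rewrite le_eqVlt; apply/orP; left; apply/eqP; congr `|_|; ring.
apply: le_trans _ (normr_Im_le _); rewrite !(ReDc, ReNc, ImMc, ImDc, ImNc) /=.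
by rewrite le_eqVlt; apply/orP; left; apply/eqP; congr `|_|; ring.
Qed.

Let polarE g (t : R) : g (cos t +i* sin t) = (g \o @cexp R) (0 +i* t).
Proof. by rewrite /= /cexp /= expR0 mul1r. Qed.

Lemma circle_continuous_Re g : holo g ->
  continuous (fun t : R => complex.Re (g (cos t +i* sin t))).
Proof.
move=> hg; have hG := holo_comp hg (@holo_cexp R).
rewrite (_ : (fun t => _) = fun t => complex.Re ((g \o @cexp R) (0 +i* t))).
  exact: (partial_continuous_U (polar_cauchy_riemann hG)).
by apply/funext => t; rewrite polarE.
Qed.

(** The integral over the circle of radius e^s does not depend on s, and by continuity at 0 it
    approaches 2 pi g(0) as the radius shrinks. *)
Lemma circle_mean_Re g : holo g ->
  itg (fun t => complex.Re (g (cos t +i* sin t))) 0 (2 * pi)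
  = complex.Re (g 0) * (2 * pi).
Proof.
move=> hg; pose G := g \o (@cexp R).
have hG : holo G by apply: holo_comp => //; exact: holo_cexp.
pose U (s t : R) := complex.Re (G (s +i* t)).
pose V (s t : R) := complex.Im (G (s +i* t)).
have UVd := polar_cauchy_riemann hG.
have pi2 : 0 <= 2 * pi :> R by rewrite mulr_ge0// pi_ge0.
have shift s : s <= 0 -> itg (U 0) 0 (2 * pi) = itg (U s) 0 (2 * pi).
  move=> s0; apply/eqP; rewrite -subr_eq0 -itgB; last 2 first.
  - exact: (@partial_continuous_U _ U V UVd).
  - exact: (@partial_continuous_U _ U V UVd).
  rewrite (@goursat _ U V UVd)//; apply/eqP.
  (* [cexp] has period 2 pi i, so the two horizontal edges cancel. *)
  rewrite (_ : (fun s => _) = fun=> 0) ?itg_cst ?mul0r//.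
  apply/funext => r; rewrite /V /G /= /cexp /= (_ : 2 * pi = 0 + 2 * pi)//; last by rewrite add0r.
  rewrite cosD sinD.
  have -> : cos (2 * pi) = 1 :> R by rewrite mulrC mulr_natr cos2pi.
  have -> : sin (2 * pi) = 0 :> R by rewrite mulrC mulr_natr sin2pi.
  by rewrite !(mulr1, mulr0, subr0, addr0, add0r) subrr.
rewrite -(_ : U 0 = fun t => complex.Re (g (cos t +i* sin t))); last first.
  by apply/funext => t; rewrite polarE.
apply/eqP; rewrite -subr_eq0 -normr_eq0 eq_le normr_ge0 andbT.
apply/ler_addgt0Pl => e e0; rewrite addr0.
have pi20 : 0 < 2 * pi :> R by rewrite mulr_gt0// pi_gt0.
have [|d d0 H] := @holo_eps_continuous g 0 hg (e / (2 * pi)); first by rewrite divr_gt0.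
(* The radius e^s has to stay below [d], for continuity at 0, and below 1, for [shift]. *)
pose s := Num.min 0 (ln d).
have s0 : s <= 0 by rewrite ge_min lexx.
have sd : expR s <= d.
  by rewrite -[leRHS](@lnK R d) ?posrE// ler_expR ge_min lexx orbT.
rewrite (shift _ s0); have -> : e = e / (2 * pi) * (2 * pi - 0).
  by rewrite subr0 divfK// gt_eqF.
rewrite -[X in complex.Re (g 0) * X]subr0; apply: itg_near_cst => //.
  exact: (@partial_continuous_U _ U V UVd).
move=> t _; have := H (cexp (s +i* t)).
rewrite normc_cexp => /(_ sd); apply: le_trans.
by rewrite add0r; apply: le_trans _ (normr_Re_le _); rewrite ReDc ReNc.
Qed.

Lemma holoZ (c : R[i]) g : holo g -> holo (fun z => c * g z).
Proof.
move=> hg; apply: (holo_comp (g1 := fun z => c * z)) => //.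
Qed.

Lemma circle_mean_Im g : holo g ->
  itg (fun t => complex.Im (g (cos t +i* sin t))) 0 (2 * pi)
  = complex.Im (g 0) * (2 * pi).
Proof.
move=> hg; have := circle_mean_Re (holoZ (- 'i%C) hg).
have E z : complex.Re (- 'i%C * g z) = complex.Im (g z).
  by rewrite ReMc /=; ring.
by rewrite E => <-; congr itg; apply/funext => t; rewrite E.
Qed.

Lemma circle_continuous_Im g : holo g ->
  continuous (fun t : R => complex.Im (g (cos t +i* sin t))).
Proof.
move=> hg.
rewrite (_ : (fun t => _) = fun t => complex.Re (- 'i%C * g (cos t +i* sin t))).
  exact: (circle_continuous_Re (holoZ (- 'i%C) hg)).
by apply/funext => t; rewrite ReMc /=; ring.
Qed.

End circle_mean.

(** * Measurability of entire functions *)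

Section coordinate_continuity.
Context d (T : measurableType d) (R : realType) (I : finType).
Variables (c : I -> T -> R) (h : T -> R).
Hypothesis mc : forall i, measurable_fun [set: T] (c i).
(** Continuity is phrased through coordinates because they link the two structures in play: the
    sigma-algebra of [Rn R n] is generated by them, while continuity of an entire function refers to
    the topology of row vectors. *)
Hypothesis hc : forall p (e : R), 0 < e -> exists2 del : R, 0 < del &
  forall q, (forall i, `|c i p - c i q| < del) -> `|h p - h q| < e.

Let box (k : {ffun I -> rat} * rat) : set T :=
  [set q | forall i, `|ratr (k.1 i) - c i q| < ratr k.2].

Let measurable_box k : measurable (box k).
Proof.
rewrite (_ : box k = \bigcap_(i in [set: I]) [set q | `|ratr (k.1 i) - c i q| < ratr k.2]).
  apply: fin_bigcap_measurable => // i _; rewrite -[X in measurable X]setTI.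
  have mf : measurable_fun [set: T] (fun q => `|ratr (k.1 i) - c i q|).
    by apply: measurableT_comp => //; exact: measurable_funB.
  have := mf measurableT `]-oo, ratr k.2[%classic (measurable_itv _).
  by congr (measurable (_ `&` _)); apply/seteqP; split => q /=; rewrite in_itv.
by apply/seteqP; split => q /= H; [move=> i _; exact: H|move=> i; exact: H].
Qed.

(* the superlevel sets of [h] are unions of the countably many rational boxes
   that they contain *)
Lemma measurable_coordinate_continuous : measurable_fun [set: T] h.
Proof.
move=> mT; apply: (measurability _ (RGenOInfty.measurableE R)) => //.
move=> _ [_ [a ->] <-]; rewrite setTI.
rewrite (_ : _ @^-1` _ = \bigcup_(k in [set k | box k `<=` [set q | a < h q]]) box k).
  rewrite bigcup_mkcond; apply: countable_bigcupT_measurable; first exact: countableP.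
  by move=> k; case: ifP => // _; exact: measurable_box.
apply/seteqP; split => [p /=|p [k kH pk]]; last first.
  by rewrite /= in_itv/= andbT; exact: kH.
rewrite in_itv/= andbT => ap.
have [del del0 H] := hc p (e := h p - a) ltac:(by rewrite subr_gt0).
(* With e below [del / 2], every point of a box of radius e whose centre is e-close to p lies within
   [del] of p in each coordinate. *)
have [/= e /itvP e0d] : exists2 e : rat, ratr e \in `]0, (del / 2)[ & true.
  by have [|q q0] := @rat_in_itvoo R 0 (del / 2); [rewrite divr_gt0|exists q].
have e0 : 0 < ratr e :> R by rewrite e0d.
have ed : ratr e < del / 2 by rewrite e0d.
have q i : exists q : rat, `|ratr q - c i p| < ratr e.
  have [|q] := @rat_in_itvoo R (c i p - ratr e) (c i p + ratr e).
    by rewrite ltrD2l gtrN.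
  by rewrite in_itv /= => /andP[? ?]; exists q; rewrite ltr_norml; apply/andP; split; lra.
pose f := [ffun i => projT1 (cid (q i))].
have pf i : `|ratr (f i) - c i p| < ratr e by rewrite ffunE; case: cid.
exists (f, e) => //= r rf /=.
have := H r; rewrite ltr_norml => H'.
suff /H' /andP[_] : forall i, `|c i p - c i r| < del by lra.
move=> i; have := pf i; have := rf i => /=.
by rewrite !ltr_norml => /andP[? ?] /andP[? ?]; apply/andP; split; lra.
Qed.

End coordinate_continuity.

Lemma entire_coordinate_continuous (K : numFieldType) n (F : 'rV[K]_n -> K) :
  entire F -> forall (z : 'rV[K]_n) (e : K), 0 < e -> exists2 del : K, 0 < del &
  forall w : 'rV[K]_n, (forall j, `|z 0 j - w 0 j| < del) -> `|F z - F w| < e.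
Proof.
move=> dF z e e0; have /cvgrPdist_lt/(_ e e0) := differentiable_continuous (dF z).
move=> /nbhs_ballP[del /= del0 H]; exists del => // w zw.
by apply: H; split => // i j; rewrite ord1; exact: zw.
Qed.

Section measurable_entire.
Context (R : realType) (n : nat).
Implicit Types (F : Cn R n -> R[i]) (p q : Rn R n * Rn R n).

Let coord (i : 'I_n + 'I_n) (p : Rn R n * Rn R n) : R :=
  match i with inl j => tnth p.1 j | inr j => tnth p.2 j end.

Let measurable_coord i : measurable_fun setT (coord i).
Proof.
case: i => j /=.
  exact: (measurableT_comp (measurable_tnth j) measurable_fst).
exact: (measurableT_comp (measurable_tnth j) measurable_snd).
Qed.

Lemma Cn_of_coord p j : Cn_of p 0 j = tnth p.1 j +i* tnth p.2 j.
Proof. by rewrite !mxE; apply: complex_ReIm_ext => /=; ring. Qed.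

Let entire_Cn_of F : entire F -> forall p (e : R), 0 < e ->
  exists2 del : R, 0 < del & forall q, (forall i, `|coord i p - coord i q| < del) ->
  Normc.normc (F (Cn_of p) - F (Cn_of q)) < e.
Proof.
move=> dF p e e0.
have [|[d d'] d0 H] := entire_coordinate_continuous dF (Cn_of p) (e := e%:C).
  by rewrite ltcR.
move: d0 H; rewrite ltcE /= => /andP[/eqP -> d0] H.
exists (d / 2); first by rewrite divr_gt0.
move=> q pq; have := H (Cn_of q); rewrite normr_complexE ltcR; apply => j.
rewrite normr_complexE complexr0 ltcR !Cn_of_coord.
apply: le_lt_trans (normc_le_ReIm _) _ => /=.
by have := pq (inl j); have := pq (inr j) => /=; lra.
Qed.

Lemma measurable_Re_entire F : entire F ->
  measurable_fun [set: Rn R n * Rn R n] (fun p => complex.Re (F (Cn_of p))).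
Proof.
move=> dF; apply: (measurable_coordinate_continuous measurable_coord) => p e e0.
have [del del0 H] := entire_Cn_of dF p e0; exists del => // q /H.
by apply: le_lt_trans; rewrite -ReNc -ReDc; exact: normr_Re_le.
Qed.

Lemma measurable_Im_entire F : entire F ->
  measurable_fun [set: Rn R n * Rn R n] (fun p => complex.Im (F (Cn_of p))).
Proof.
move=> dF; apply: (measurable_coordinate_continuous measurable_coord) => p e e0.
have [del del0 H] := entire_Cn_of dF p e0; exists del => // q /H.
by apply: le_lt_trans; rewrite -ImNc -ImDc; exact: normr_Im_le.
Qed.

End measurable_entire.

(** * Lebesgue measure on R^n and C^n *)

Section change_of_variables.
Context d1 d2 (T1 : measurableType d1) (T2 : measurableType d2) (R : realType).
Variables (mu : {measure set T1 -> \bar R}) (nu : {measure set T2 -> \bar R}).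

(* [c] is the inverse of the constant Jacobian of [S] *)
Definition change_var (S : T1 -> T2) (c : R) := [/\ measurable_fun setT S, 0 < c &
  forall f : T2 -> \bar R, measurable_fun setT f -> (forall x, 0 <= f x)%E ->
    (\int[mu]_x f (S x) = c%:E * \int[nu]_x f x)%E].

Variables (S : T1 -> T2) (c : R).
Hypothesis Sc : change_var S c.

Lemma change_var_integrable (f : T2 -> R) : nu.-integrable setT (EFin \o f) ->
  mu.-integrable setT (EFin \o (fun x => f (S x))).
Proof.
have [mS c0 HS] := Sc => /integrableP[mf fi]; apply/integrableP; split.
  exact: (measurableT_comp mf mS).
rewrite (HS (abse \o (EFin \o f))).
- by apply: lte_mul_pinfty => //; rewrite lee_fin ltW.
- exact: measurableT_comp.
- by move=> x; exact: abse_ge0.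
Qed.

Lemma change_var_Rintegral (f : T2 -> R) : nu.-integrable setT (EFin \o f) ->
  \int[mu]_x f (S x) = c * \int[nu]_x f x.
Proof.
have [mS c0 HS] := Sc => fi; have mf := measurable_int _ fi.
rewrite /Rintegral -[X in _ = X * _]/(fine c%:E) -fineM//; last exact: integrable_fin_num.
congr fine; rewrite integralE [in RHS]integralE.
rewrite (_ : ((fun x => (f (S x))%:E)^\+)%E = (EFin \o f)^\+%E \o S); last exact: funepos_comp.
rewrite (_ : ((fun x => (f (S x))%:E)^\-)%E = (EFin \o f)^\-%E \o S); last exact: funeneg_comp.
rewrite (HS _ (measurable_funepos mf))// (HS _ (measurable_funeneg mf))// [RHS]muleBr//.
apply: fin_num_adde_defl; rewrite fin_numN.
exact: integrable_neg_fin_num.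
Qed.

End change_of_variables.

Lemma change_var_comp d1 d2 d3 (T1 : measurableType d1) (T2 : measurableType d2)
  (T3 : measurableType d3) (R : realType) (m1 : {measure set T1 -> \bar R})
  (m2 : {measure set T2 -> \bar R}) (m3 : {measure set T3 -> \bar R}) S1 c1 S2 c2 :
  change_var m1 m2 S1 c1 -> change_var m2 m3 S2 c2 ->
  change_var m1 m3 (S2 \o S1) (c1 * c2).
Proof.
move=> [mS1 c10 H1] [mS2 c20 H2]; split; first exact: measurableT_comp.
  exact: mulr_gt0.
move=> f mf f0; rewrite (H1 (f \o S2)) ?H2 ?EFinM ?muleA//.
  exact: (measurableT_comp mf mS2).
by move=> x; exact: f0.
Qed.

Section affine_line.
Context (R : realType).
Variables (a c : R).

Definition affine1 (x : measurableTypeR R) : measurableTypeR R := a + c * x.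

Lemma measurable_affine1 : measurable_fun [set: _] affine1.
Proof. by apply: measurable_funD => //; exact: measurable_funM. Qed.

Hypothesis c0 : c != 0.

Let mu := @lebesgue_measure R.

Let affine_measure : {measure set (measurableTypeR R) -> \bar R}.
Proof.
refine (mscale (NngNum (normr_ge0 c)) (pushforward mu affine1)).
exact: measurable_affine1.
Defined.

Let affine_measureE A : measurable A -> mu A = affine_measure A.
Proof.
apply: lebesgue_measure_unique => _ [[u v] /= _ <-].
rewrite /affine_measure /mscale /= /pushforward.
have [cp|cn] : 0 < c \/ c < 0 by move: c0; rewrite neq_lt => /orP[]; [right|left].
- have -> : affine1 @^-1` `]u, v] = `](u - a) / c, (v - a) / c]%classic.
    apply/seteqP; split => x /=; rewrite !in_itv/= /affine1 ltr_pdivrMr// ler_pdivlMr//;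
      by move=> /andP[? ?]; apply/andP; split; lra.
  rewrite /mu !lebesgue_measure_itv/= !lte_fin.
  rewrite ltr_pM2r ?invr_gt0// ltrD2r; case: ifP => _; last by rewrite mule0.
  rewrite -!EFinB -EFinM gtr0_norm//; congr EFin; field.
  by rewrite gt_eqF.
- have -> : affine1 @^-1` `]u, v] = `[(v - a) / c, (u - a) / c[%classic.
    apply/seteqP; split => x /=; rewrite !in_itv/= /affine1 ltr_ndivlMr// ler_ndivrMr//;
      by move=> /andP[? ?]; apply/andP; split; lra.
  rewrite /mu !lebesgue_measure_itv/= !lte_fin.
  rewrite ltr_nM2r ?invr_lt0// ltrD2r; case: ifP => _; last by rewrite mule0.
  rewrite -!EFinB -EFinM ltr0_norm//; congr EFin; field.
  by rewrite lt_eqF.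
Qed.

Lemma change_var_affine1 : change_var mu mu affine1 `|c|^-1.
Proof.
have nc0 : 0 < `|c| by rewrite normr_gt0.
split; [exact: measurable_affine1|by rewrite invr_gt0|move=> f mf f0].
have -> : (\int[mu]_x f x = \int[affine_measure]_x f x)%E.
  by apply: eq_measure_integral => A mA _; exact: affine_measureE.
rewrite ge0_integral_mscale//= ge0_integral_pushforward//; last exact: measurable_affine1.
by rewrite muleA -EFinM mulVf ?gt_eqF// mul1e.
Qed.

End affine_line.

Section Rn_integration.
Context (R : realType).
Implicit Types (n : nat) (a c : R).

Definition affinet n (a : Rn R n) (c : R) (x : Rn R n) : Rn R n :=
  [tuple tnth a i + c * tnth x i | i < n].

Lemma tnth_affinet n (a : Rn R n) c x i : tnth (affinet a c x) i = tnth a i + c * tnth x i.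
Proof. by rewrite tnth_mktuple. Qed.

Lemma measurable_fun_affinet d (T : measurableType d) n (f g : T -> Rn R n) (h : T -> R) :
  measurable_fun setT f -> measurable_fun setT h -> measurable_fun setT g ->
  measurable_fun setT (fun x => affinet (f x) (h x) (g x)).
Proof.
move=> mf mh mg; apply/measurable_fun_tnthP => i.
rewrite (_ : _ \o _ = fun x => tnth (f x) i + h x * tnth (g x) i).
  apply: measurable_funD; first exact: (measurableT_comp (measurable_tnth i)).
  by apply: measurable_funM => //; exact: (measurableT_comp (measurable_tnth i)).
by apply/funext => x /=; rewrite tnth_affinet.
Qed.

Lemma measurable_fun_rdot d (T : measurableType d) n (f g : T -> Rn R n) :
  measurable_fun setT f -> measurable_fun setT g ->
  measurable_fun setT (fun x => rdot (f x) (g x)).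
Proof.
move=> mf mg; rewrite /rdot; apply: measurable_sum => i.
by apply: measurable_funM; exact: (measurableT_comp (measurable_tnth i)).
Qed.

Lemma integral_RnS n (f : Rn R n.+1 -> \bar R) : measurable_fun setT f ->
  (forall x, 0 <= f x)%E ->
  (\int[lebesgue_Rn R n.+1]_x f x = \int[@lebesgue_measure R]_x
     \int[lebesgue_Rn R n]_t f (tuple_cons (x, t)))%E.
Proof.
move=> mf f0; transitivity
  (\int[pushforward (@lebesgue_measure R \x lebesgue_Rn R n)%E (@tuple_cons R n)]_x f x)%E => //.
rewrite ge0_integral_pushforward//= fubini_tonelli1//.
by apply: measurableT_comp => //; exact: measurable_tuple_cons.
Qed.

Lemma change_var_affinet n (a : Rn R n) c : c != 0 ->
  change_var (lebesgue_Rn R n) (lebesgue_Rn R n) (affinet a c) (`|c| ^- n).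
Proof.
move=> c0; split; first exact: measurable_fun_affinet.
  by rewrite invr_gt0 exprn_gt0// normr_gt0.
elim: n a => [|n IH] a f mf f0.
  rewrite expr0 invr1 mul1e; apply: eq_integral => x _.
  by congr f; apply: eq_from_tnth => -[].
have maff : measurable_fun setT (affinet a c) by exact: measurable_fun_affinet.
rewrite !integral_RnS//; last exact: measurableT_comp.
pose g (x : measurableTypeR R) := (\int[lebesgue_Rn R n]_t f (tuple_cons (x, t)))%E.
have mft : measurable_fun setT (fun p => f (tuple_cons p)).
  by apply: measurableT_comp => //; exact: measurable_tuple_cons.
have mg : measurable_fun setT g.
  exact: (measurable_fun_fubini_tonelli_F (fun p => f (tuple_cons p))).
have g0 x : (0 <= g x)%E by apply: integral_ge0 => t _.
have [_ ci0 H1] := change_var_affine1 (thead a) c0.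
transitivity (\int[@lebesgue_measure R]_x ((`|c| ^- n)%:E * g (affine1 (thead a) c x)))%E.
  apply: eq_integral => x _.
  have mfx y : measurable_fun setT (fun t => f (tuple_cons (y, t))).
    by apply: (measurableT_comp mft); exact: measurable_pair1.
  rewrite /g -(IH [tuple of behead a] _ (mfx _) (fun t => f0 _)).
  apply: eq_integral => t _; congr f; apply: eq_from_tnth => i.
  rewrite tnth_affinet; case: (unliftP ord0 i) => [j|] ->.
    by rewrite !tnthS /= tnth_affinet [in LHS](tuple_eta a) tnthS.
  by rewrite !tnth0 /affine1 -(tnth0 (thead a) [tuple of behead a]) -tuple_eta.
rewrite ge0_integralZl//; last first.
  by apply: (measurableT_comp mg); exact: measurable_affine1.
by rewrite H1// muleA -EFinM -invfM exprSr.
Qed.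

Lemma change_var_translate n (a : Rn R n) :
  change_var (lebesgue_Rn R n) (lebesgue_Rn R n) (affinet a 1) 1.
Proof.
by have := change_var_affinet a (oner_neq0 R); rewrite normr1 expr1n invr1.
Qed.

End Rn_integration.

Section change_of_variables_product.
Context d1 d2 (T1 : measurableType d1) (T2 : measurableType d2) (R : realType).
Variables (m1 : {sigma_finite_measure set T1 -> \bar R})
  (m2 : {sigma_finite_measure set T2 -> \bar R}).

(** Tonelli, fibre by fibre. The map on one factor may depend on the other as long as the Jacobian
    does not; this is what makes shears measure preserving. *)
Lemma change_var_fst (S : T2 -> T1 -> T1) (c : R) :
  measurable_fun setT (fun p : T1 * T2 => S p.2 p.1) -> 0 < c ->
  (forall y, change_var m1 m1 (S y) c) ->
  change_var (m1 \x m2)%E (m1 \x m2)%E (fun p => (S p.2 p.1, p.2)) c.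
Proof.
move=> mS c0 HS; have mS' : measurable_fun setT (fun p : T1 * T2 => (S p.2 p.1, p.2)).
  exact: measurable_fun_pair.
split => // f mf f0.
rewrite !fubini_tonelli2//; last exact: (measurableT_comp mf mS').
rewrite -ge0_integralZl//; last 3 first.
- exact: measurable_fun_fubini_tonelli_G.
- by move=> y _; exact: integral_ge0.
- by rewrite lee_fin ltW.
apply: eq_integral => y _; have [_ _ H] := HS y.
by rewrite /fubini_G /= (H (fun x => f (x, y)))//; exact: measurable_fun_pair1.
Qed.

Lemma change_var_snd (S : T1 -> T2 -> T2) (c : R) :
  measurable_fun setT (fun p : T1 * T2 => S p.1 p.2) -> 0 < c ->
  (forall x, change_var m2 m2 (S x) c) ->
  change_var (m1 \x m2)%E (m1 \x m2)%E (fun p => (p.1, S p.1 p.2)) c.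
Proof.
move=> mS c0 HS; have mS' : measurable_fun setT (fun p : T1 * T2 => (p.1, S p.1 p.2)).
  exact: measurable_fun_pair.
split => // f mf f0.
rewrite !fubini_tonelli1//; last exact: (measurableT_comp mf mS').
rewrite -ge0_integralZl//; last 3 first.
- exact: measurable_fun_fubini_tonelli_F.
- by move=> y _; exact: integral_ge0.
- by rewrite lee_fin ltW.
apply: eq_integral => x _; have [_ _ H] := HS x.
by rewrite /fubini_F /= (H (fun y => f (x, y)))//; exact: measurable_fun_pair2.
Qed.

(* Translations, reflections and rotations of C^n *)
End change_of_variables_product.

Section Cn_change_of_variables.
Context (R : realType) (n : nat).
Implicit Types (p q : Rn R n * Rn R n) (x y : Rn R n) (c s t : R).
Local Notation nu := (lebesgue_Cn R n).

Definition tuple0 : Rn R n := [tuple 0 | _ < n].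

Lemma tnth_tuple0 i : tnth tuple0 i = 0. Proof. by rewrite tnth_mktuple. Qed.

Let measurable_proj1 : measurable_fun setT (fun p : Rn R n * Rn R n => p.1).
Proof. exact: measurable_fst. Qed.

Let measurable_proj2 : measurable_fun setT (fun p : Rn R n * Rn R n => p.2).
Proof. exact: measurable_snd. Qed.

Let affinetC x t y : affinet x t y = affinet (affinet tuple0 t y) 1 x.
Proof.
by apply: eq_from_tnth => i; rewrite !tnth_affinet tnth_tuple0 add0r mul1r addrC.
Qed.

Let change_var_shear1 t : change_var nu nu (fun p => (affinet p.1 t p.2, p.2)) 1.
Proof.
apply: (@change_var_fst _ _ _ _ R (lebesgue_Rn R n) (lebesgue_Rn R n)
  (fun y x => affinet x t y)) => //.
  exact: measurable_fun_affinet.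
move=> y; rewrite (_ : (fun x => _) = affinet (affinet tuple0 t y) 1).
  exact: change_var_translate.
by apply/funext => x; exact: affinetC.
Qed.

Let change_var_shear2 t : change_var nu nu (fun p => (p.1, affinet p.2 t p.1)) 1.
Proof.
apply: (@change_var_snd _ _ _ _ R (lebesgue_Rn R n) (lebesgue_Rn R n)
  (fun x y => affinet y t x)) => //.
  exact: measurable_fun_affinet.
move=> y; rewrite (_ : (fun x => _) = affinet (affinet tuple0 t y) 1).
  exact: change_var_translate.
by apply/funext => x; exact: affinetC.
Qed.

Lemma change_var_Cn_affine (a b : Rn R n) c1 c2 : c1 != 0 -> c2 != 0 ->
  change_var nu nu (fun p => (affinet a c1 p.1, affinet b c2 p.2))
    (`|c1| ^- n * `|c2| ^- n).
Proof.
move=> c10 c20.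
have pos c : c != 0 -> 0 < `|c| ^- n by move=> ?; rewrite invr_gt0 exprn_gt0// normr_gt0.
have h1 := @change_var_fst _ _ _ _ R (lebesgue_Rn R n) (lebesgue_Rn R n)
  (fun _ => affinet a c1) _ _ (pos _ c10) (fun _ => change_var_affinet a c10).
have h2 := @change_var_snd _ _ _ _ R (lebesgue_Rn R n) (lebesgue_Rn R n)
  (fun _ => affinet b c2) _ _ (pos _ c20) (fun _ => change_var_affinet b c20).
exact: (change_var_comp 
  (h1 (measurable_fun_affinet (measurable_cst _) (measurable_cst _) measurable_proj1))
  (h2 (measurable_fun_affinet (measurable_cst _) (measurable_cst _) measurable_proj2))).
Qed.

Definition rot c s p : Rn R n * Rn R n :=
  (affinet (affinet tuple0 c p.1) (- s) p.2, affinet (affinet tuple0 s p.1) c p.2).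

Lemma Rn_Cn_affinet x t y : Rn_Cn (affinet x t y) = Rn_Cn x + t%:C *: Rn_Cn y.
Proof.
apply/rowP => j; rewrite !mxE tnth_affinet.
by apply: complex_ReIm_ext => /=; ring.
Qed.

Lemma Rn_Cn0 : Rn_Cn tuple0 = 0.
Proof. by apply/rowP => j; rewrite !mxE tnth_tuple0. Qed.

Lemma Cn_of_rot c s p : Cn_of (rot c s p) = (c +i* s) *: Cn_of p.
Proof.
apply/rowP => j; rewrite [RHS]mxE !Cn_of_coord !tnth_affinet tnth_tuple0.
by apply: complex_ReIm_ext => /=; ring.
Qed.

(* a rotation is a product of three shears, except for the half turn *)
Lemma change_var_rot c s : c ^+ 2 + s ^+ 2 = 1 -> change_var nu nu (rot c s) 1.
Proof.
move=> cs; have [c1|c1] := eqVneq c (-1).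
  have s0 : s = 0.
    by apply/eqP; rewrite -sqrf_eq0; move: cs; rewrite c1 => cs; apply/eqP; lra.
  have := change_var_Cn_affine tuple0 tuple0 (c1 := -1) (c2 := -1).
  rewrite normrN normr1 expr1n invr1 mulr1 oppr_eq0 oner_eq0 => /(_ isT isT).
  congr change_var; apply/funext => p; rewrite /rot c1 s0; congr pair;
  by apply: eq_from_tnth => i; rewrite !tnth_affinet !tnth_tuple0; ring.
have c1' : 1 + c != 0 by rewrite addrC addr_eq0.
(* With c = cos theta and s = sin theta this is tan(theta/2), up to sign the slope of the two outer
   shears. *)
pose t := s / (1 + c).
have h := change_var_comp (change_var_comp (change_var_shear1 (- t)) (change_var_shear2 s))
  (change_var_shear1 (- t)).
rewrite !mulr1 in h; move: h; congr change_var; apply/funext => p.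
have ts : t * s = 1 - c.
  rewrite /t mulrAC -expr2; apply: (mulIf c1'); rewrite divfK//.
  by rewrite -(addrK (c ^+ 2) (s ^+ 2)) (addrC (s ^+ 2)) cs; ring.
have tc : t * (1 + c) = s by rewrite /t divfK.
rewrite /rot /=; congr pair; apply: eq_from_tnth => i;
  rewrite !tnth_affinet !tnth_tuple0; set x := tnth p.1 i; set y := tnth p.2 i.
- have -> : x + - t * y + - t * (y + s * (x + - t * y)) =
    x - t * s * x - (t * (1 + (1 - t * s))) * y by ring.
  by rewrite ts (_ : 1 - (1 - c) = c) ?tc; ring.
- have -> : y + s * (x + - t * y) = s * x + (1 - t * s) * y by ring.
  by rewrite ts; ring.
Qed.

End Cn_change_of_variables.

Lemma ge0_integralZl_EFin d (T : measurableType d) (R : realType)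
  (mu : {measure set T -> \bar R}) (k : R) (f : T -> R) : 0 <= k ->
  measurable_fun setT f -> (forall x, 0 <= f x) ->
  (\int[mu]_x (k * f x)%:E = k%:E * \int[mu]_x (f x)%:E)%E.
Proof.
move=> k0 mf f0; under eq_integral do rewrite EFinM.
rewrite ge0_integralZl//; first exact/measurable_EFinP.
by move=> x _; rewrite lee_fin.
Qed.

Lemma measurable_fun_gauss d (T : measurableType d) (R : realType) n (a : R)
  (f : T -> Rn R n) : measurable_fun setT f ->
  measurable_fun setT (fun x => expR (- (a * rdot (f x) (f x)))).
Proof.
move=> mf; apply: measurableT_comp => //; apply: measurableT_comp => //.
by apply: measurable_funM => //; exact: measurable_fun_rdot.
Qed.

(** * Gaussian integrals on R^n and C^n *)

Section gaussian.
Context (R : realType).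
Implicit Types (n : nat) (a : R).

Lemma gauss1 a : 0 < a ->
  (\int[@lebesgue_measure R]_x (expR (- (a * x ^+ 2)))%:E = (Num.sqrt (pi / a))%:E)%E.
Proof.
move=> a0; have sa : 0 < Num.sqrt a by rewrite sqrtr_gt0.
have sa0 : Num.sqrt a != 0 by rewrite gt_eqF.
have [_ _ H] := change_var_affine1 0 sa0.
have {}H := H (EFin \o gauss_fun) _ _; rewrite integralT_gauss in H.
transitivity (\int[@lebesgue_measure R]_x (EFin \o gauss_fun) (affine1 0 (Num.sqrt a) x))%E.
  apply: eq_integral => x _; rewrite /= /gauss_fun /affine1 add0r exprMn.
  by rewrite sqr_sqrtr// ltW.
rewrite H.
- by rewrite gtr0_norm// -EFinM mulrC sqrtrM ?pi_ge0// sqrtrV// ltW.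
- by apply/measurable_EFinP; exact: measurable_gauss_fun.
- by move=> x; rewrite lee_fin gauss_fun_ge0.
Qed.

Lemma rdot_cons n (x : R) (t : Rn R n) :
  rdot (tuple_cons (x, t)) (tuple_cons (x, t)) = x ^+ 2 + rdot t t.
Proof.
rewrite /rdot big_ord_recl !tnth0 expr2; congr (_ + _).
by apply: eq_bigr => i _; rewrite !tnthS.
Qed.

Lemma measurable_gauss a n : measurable_fun setT (fun x : Rn R n => expR (- (a * rdot x x))).
Proof.
apply: measurableT_comp => //; apply: measurableT_comp => //.
by apply: measurable_funM => //; exact: measurable_fun_rdot.
Qed.

Lemma integral_gauss_Rn a n : 0 < a ->
  (\int[lebesgue_Rn R n]_x (expR (- (a * rdot x x)))%:E = (Num.sqrt (pi / a) ^+ n)%:E)%E.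
Proof.
move=> a0; elim: n => [|n IH].
  rewrite integral_dirac//= ?diracT ?mul1e /rdot ?big_ord0 ?mulr0 ?oppr0 ?expR0 ?expr0//.
  by apply/measurable_EFinP; exact: measurable_gauss.
rewrite integral_RnS; last 2 first.
- by apply/measurable_EFinP; exact: measurable_gauss.
- by move=> x; rewrite lee_fin expR_ge0.
transitivity (\int[@lebesgue_measure R]_x (Num.sqrt (pi / a) ^+ n * expR (- (a * x ^+ 2)))%:E)%E.
  apply: eq_integral => x _; rewrite EFinM -IH muleC -ge0_integralZl_EFin ?expR_ge0//.
    by apply: eq_integral => t _; rewrite rdot_cons -expRD mulrDr opprD.
  exact: measurable_gauss.
rewrite ge0_integralZl_EFin ?exprn_ge0 ?sqrtr_ge0//.
  by rewrite gauss1// -EFinM exprSr.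
do 2 apply: measurableT_comp => //.
by apply: measurable_funM => //; exact: measurable_funX.
Qed.

Definition gaussC n a (p : Rn R n * Rn R n) : R :=
  expR (- (a * (rdot p.1 p.1 + rdot p.2 p.2))).

Lemma gaussCE n a (p : Rn R n * Rn R n) : gaussC a p = expR (- (a * sqnorm (Cn_of p))).
Proof. by rewrite /gaussC sqnorm_Cn_of. Qed.

Lemma gaussC_ge0 n a (p : Rn R n * Rn R n) : 0 <= gaussC a p.
Proof. exact: expR_ge0. Qed.

Lemma measurable_gaussC n a : measurable_fun setT (@gaussC n a).
Proof.
apply: measurableT_comp => //; apply: measurableT_comp => //.
apply: measurable_funM => //; apply: measurable_funD; exact: measurable_fun_rdot.
Qed.

Lemma integral_gaussC n a : 0 < a ->
  (\int[lebesgue_Cn R n]_p (gaussC a p)%:E = ((pi / a) ^+ n)%:E)%E.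
Proof.
move=> a0; have mg := @measurable_gaussC n a.
rewrite /lebesgue_Cn fubini_tonelli1//; last 2 first.
- exact/measurable_EFinP.
- by move=> p; rewrite lee_fin gaussC_ge0.
transitivity (\int[lebesgue_Rn R n]_x (Num.sqrt (pi / a) ^+ n * expR (- (a * rdot x x)))%:E)%E.
  apply: eq_integral => x _; rewrite EFinM -(integral_gauss_Rn n a0) muleC.
  rewrite -ge0_integralZl_EFin ?expR_ge0//; last exact: measurable_gauss.
  by apply: eq_integral => y _; rewrite -expRD /gaussC mulrDr opprD.
rewrite ge0_integralZl_EFin ?exprn_ge0 ?sqrtr_ge0//; last exact: measurable_gauss.
by rewrite integral_gauss_Rn// -EFinM -exprMn -expr2 sqr_sqrtr// divr_ge0 ?pi_ge0// ltW.
Qed.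

Lemma integrable_gaussC n a : 0 < a ->
  (lebesgue_Cn R n).-integrable setT (EFin \o @gaussC n a).
Proof.
move=> a0; apply/integrableP; split.
  by apply/measurable_EFinP; exact: measurable_gaussC.
rewrite (eq_integral (EFin \o @gaussC n a)).
  by rewrite /comp integral_gaussC// ltry.
by move=> p _; rewrite /= ger0_norm// gaussC_ge0.
Qed.

Lemma integrable_gauss_Rn n a : 0 < a ->
  (lebesgue_Rn R n).-integrable setT (EFin \o (fun x => expR (- (a * rdot x x)))).
Proof.
move=> a0; apply/integrableP; split.
  by apply/measurable_EFinP; exact: measurable_gauss.
rewrite (eq_integral (EFin \o (fun x => expR (- (a * rdot x x))))).
  by rewrite /comp integral_gauss_Rn// ltry.
by move=> p _; rewrite /= ger0_norm// expR_ge0.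
Qed.

End gaussian.

(** * The Gaussian mean value formula *)

Lemma sigma_finite_lebesgue_Cn (R : realType) (n : nat) :
  sigma_finite setT (lebesgue_Cn R n).
Proof.
have /sigma_finiteP[F [TF ndF Foo]] := sigma_finiteT (lebesgue_Rn R n).
exists (fun k => F k `*` F k).
  rewrite -setXTT TF predeqE => -[x y]; split.
    move=> [/= [k _ Fkx] [l _ Fly]]; exists (maxn k l) => //; split.
    - by move: x Fkx; exact/subsetPset/ndF/leq_maxl.
    - by move: y Fly; exact/subsetPset/ndF/leq_maxr.
  by move=> [k _ []/= ? ?]; split; exists k.
move=> k; have [mF Fk] := Foo k; split; first exact: measurableX.
have -> : lebesgue_Cn R n (F k `*` F k) = (lebesgue_Rn R n (F k) * lebesgue_Rn R n (F k))%E.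
  exact: product_measure1E.
by rewrite lte_mul_pinfty// ge0_fin_numE.
Qed.

(** [lebesgue_Cn] is packed as a plain measure; Fubini on the product of the circle with C^n, and of
    R^n with C^n, takes sigma-finite factors. *)
Definition lebesgue_Cn_sfinite (R : realType) (n : nat) :
    {sigma_finite_measure set (Rn R n * Rn R n)%type -> \bar R} :=
  HB.pack_for (SigmaFiniteMeasure.type _ _) (lebesgue_Rn R n \x lebesgue_Rn R n)%E
    (Measure_isSigmaFinite.Build _ _ _ (lebesgue_Rn R n \x lebesgue_Rn R n)%E
      (@sigma_finite_lebesgue_Cn R n)).

Section gaussian_mean_value.
Context (R : realType) (n : nat).
Local Notation leb := (@lebesgue_measure R).
Local Notation nu := (lebesgue_Cn_sfinite R n).
Implicit Types (p : Rn R n * Rn R n).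

Lemma measurable_fun_rot d (T : measurableType d) (c s : T -> R)
  (f : T -> Rn R n * Rn R n) : measurable_fun setT c -> measurable_fun setT s ->
  measurable_fun setT f -> measurable_fun setT (fun x => rot (c x) (s x) (f x)).
Proof.
move=> mc ms mf.
have mf1 : measurable_fun setT (fun x => (f x).1) by exact: (measurableT_comp measurable_fst).
have mf2 : measurable_fun setT (fun x => (f x).2) by exact: (measurableT_comp measurable_snd).
apply: measurable_fun_pair; apply: measurable_fun_affinet => //.
- exact: measurable_fun_affinet.
- exact: measurableT_comp.
- exact: measurable_fun_affinet.
Qed.

Lemma gaussC_rot (a c s : R) p : c ^+ 2 + s ^+ 2 = 1 -> gaussC a (rot c s p) = gaussC a p.
Proof.
move=> cs; rewrite !gaussCE; congr (expR (- (_ * _))).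
rewrite Cn_of_rot !sqnormE; apply: eq_bigr => j _.
by rewrite !mxE Normc.normcM exprMn [X in X * _]sqr_normc_ReIm/= cs mul1r.
Qed.

Lemma integral_indic_mul (D : set R) (f : R -> R) : measurable D ->
  (\int[leb]_t (\1_D t * f t)%:E = \int[leb]_(t in D) (f t)%:E)%E.
Proof.
move=> mD; rewrite [RHS]integral_mkcond; apply: eq_integral => t _.
by rewrite patchE indicE; case: ifP => _; rewrite ?mul1r ?mul0r.
Qed.

Variables (h : Rn R n * Rn R n -> R) (h0 a : R).
Hypothesis a0 : 0 < a.
Hypothesis mh : measurable_fun setT h.
Hypothesis ih : nu.-integrable setT (EFin \o (fun p => h p * gaussC a p)).
Hypothesis ch : forall p, continuous (fun t : R => h (rot (cos t) (sin t) p)).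
Hypothesis circ : forall p,
  itg (fun t => h (rot (cos t) (sin t) p)) 0 (2 * pi) = h0 * (2 * pi).

Let D : set R := `[0, 2 * pi]%classic.
(** The two iterated integrals of [k] are compared. The Gaussian is written unrotated, so that
    integration over the angle acts on [h] alone; by invariance it may equally be read as rotated,
    and then integration over C^n is a change of variables. *)
Let k (z : measurableTypeR R * (Rn R n * Rn R n)) : R :=
  \1_D z.1 * (h (rot (cos z.1) (sin z.1) z.2) * gaussC a z.2).

Let mD : measurable D. Proof. exact: measurable_itv. Qed.

Let mk : measurable_fun setT k.
Proof.
have mrot : measurable_fun setT
    (fun z : measurableTypeR R * (Rn R n * Rn R n) => rot (cos z.1) (sin z.1) z.2).
  have mcos : measurable_fun [set: R] (@cos R).
    by apply: continuous_measurable_fun; exact: continuous_cos.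
  have msin : measurable_fun [set: R] (@sin R).
    by apply: continuous_measurable_fun; exact: continuous_sin.
  apply: measurable_fun_rot => //.
    exact: (measurableT_comp mcos measurable_fst).
  exact: (measurableT_comp msin measurable_fst).
apply: measurable_funM; first by apply: measurableT_comp => //.
apply: measurable_funM; first exact: measurableT_comp.
by apply: measurableT_comp => //; exact: measurable_gaussC.
Qed.

Let krot t p : \1_D t * (h (rot (cos t) (sin t) p) * gaussC a p) =
  \1_D t * (h (rot (cos t) (sin t) p) * gaussC a (rot (cos t) (sin t) p)).
Proof. by rewrite gaussC_rot// cos2Dsin2. Qed.

Let I := \int[nu]_p (h p * gaussC a p).

Let D2pi : (leb D = (2 * pi)%:E)%E.
Proof.
by rewrite lebesgue_measure_itv/= lte_fin mulr_gt0 ?pi_gt0// oppr0 addr0.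
Qed.

(** For every angle the rotated integrand has the same L^1 norm, so the double integral of the
    modulus is 2 pi times that norm. *)
Let ik : (leb \x nu)%E.-integrable setT (EFin \o k).
Proof.
have mEk : measurable_fun setT (EFin \o k) by exact/measurable_EFinP.
apply: (integrable12ltyP leb nu mEk).2.
pose N := (\int[nu]_p `|(h p * gaussC a p)%:E|)%E.
have Nfin : (N < +oo)%E by case/integrableP : ih.
have N0 : (0 <= N)%E by exact: integral_ge0.
have NE : N = (fine N)%:E by rewrite fineK// ge0_fin_numE.
have mhg : measurable_fun setT (fun p => h p * gaussC a p).
  by apply: measurable_funM => //; exact: measurable_gaussC.
under eq_integral => t _.
  under eq_integral => p _.
    rewrite /= /k /= krot normrM ger0_norm; last by rewrite indicE.
    over.
  rewrite /= ge0_integralZl_EFin; last 3 first.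
  - by rewrite indicE.
  - apply: measurableT_comp => //.
    by apply: (measurableT_comp mhg); exact: measurable_fun_rot.
  - by [].
  have [_ _ H] := change_var_rot n (cos2Dsin2 t).
  rewrite (H (fun p => `|(h p * gaussC a p)%:E|)%E) ?mul1e; last 2 first.
  - by apply: measurableT_comp => //; exact/measurable_EFinP.
  - by move=> p; exact: abse_ge0.
  rewrite -/N NE -EFinM mulrC.
  over.
rewrite /= ge0_integralZl_EFin//.
- have -> : (\int[leb]_t (\1_D t)%:E = (2 * pi)%:E)%E.
    by rewrite integral_indic// setIT; exact: D2pi.
  by rewrite -EFinM ltry.
- exact: fine_ge0.
Qed.

Lemma gaussian_mean_real : I = h0 * (pi / a) ^+ n.
Proof.
have := @Fubini _ _ _ _ _ leb nu (EFin \o k) ik.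
have mhg : measurable_fun setT (fun p => h p * gaussC a p).
  by apply: measurable_funM => //; exact: measurable_gaussC.
have inner t : (\int[nu]_p (EFin \o k) (t, p) = (\1_D t * I)%:E)%E.
  under eq_integral => p _ do rewrite /= /k /= krot EFinM.
  have cv := change_var_rot n (cos2Dsin2 t).
  have irot := change_var_integrable cv ih.
  rewrite integralZl// EFinM; congr (_ * _)%E.
  have E := change_var_Rintegral cv ih; rewrite mul1r in E.
  rewrite (_ : I = \int[lebesgue_Cn R n]_p
    (h (rot (cos t) (sin t) p) * gaussC a (rot (cos t) (sin t) p))); last by rewrite E.
  by rewrite /Rintegral fineK//; exact: integrable_fin_num.
under eq_integral do rewrite inner.
have inner2 p : (\int[leb]_t (EFin \o k) (t, p) = (h0 * (2 * pi) * gaussC a p)%:E)%E.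
  rewrite /= /k /= integral_indic_mul//.
  under eq_integral => t _ do rewrite mulrC EFinM.
  have ihp : leb.-integrable D (EFin \o (fun t => h (rot (cos t) (sin t) p))).
    exact: continuous_itv_integrable.
  rewrite integralZl// mulrC EFinM; congr (_ * _)%E.
  rewrite -(circ p) /itg /Rintegral fineK//; exact: integrable_fin_num.
under [in RHS]eq_integral do rewrite inner2.
have -> : (\int[leb]_t (\1_D t * I)%:E = (I * (2 * pi))%:E)%E.
  by rewrite integral_indic_mul// integral_cst// EFinM; congr (_ * _)%E; exact: D2pi.
under [in RHS]eq_integral do rewrite EFinM.
rewrite integralZl//; last exact: integrable_gaussC.
rewrite (integral_gaussC n a0) -EFinM => -[E].
have pi20 : 2 * pi != 0 :> R by rewrite mulf_neq0 ?gt_eqF ?pi_gt0.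
by apply: (mulIf pi20); rewrite E; ring.
Qed.

End gaussian_mean_value.

(** * Integrals of complex-valued functions *)

Section real_integrable.
Context d (T : measurableType d) (R : realType) (mu : {measure set T -> \bar R}).
Implicit Types f g : T -> R.

Lemma integrableZl_EFin (k : R) f : mu.-integrable setT (EFin \o f) ->
  mu.-integrable setT (EFin \o (fun x => k * f x)).
Proof. by move=> fi; exact: (integrableZl measurableT k fi). Qed.

Lemma integrableD_EFin f g : mu.-integrable setT (EFin \o f) ->
  mu.-integrable setT (EFin \o g) -> mu.-integrable setT (EFin \o (fun x => f x + g x)).
Proof. by move=> fi gi; exact: (integrableD measurableT fi gi). Qed.

Lemma integrableB_EFin f g : mu.-integrable setT (EFin \o f) ->
  mu.-integrable setT (EFin \o g) -> mu.-integrable setT (EFin \o (fun x => f x - g x)).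
Proof. by move=> fi gi; exact: (integrableB measurableT fi gi). Qed.

End real_integrable.

Section complex_integral.
Context d (T : measurableType d) (R : realType) (mu : {measure set T -> \bar R}).
Implicit Types (f g : T -> R[i]) (c : R[i]).

Definition cintegrable f :=
  mu.-integrable setT (EFin \o (fun x => complex.Re (f x))) /\
  mu.-integrable setT (EFin \o (fun x => complex.Im (f x))).

Definition cmeasurable f :=
  measurable_fun setT (fun x => complex.Re (f x)) /\
  measurable_fun setT (fun x => complex.Im (f x)).

Lemma cintegrable_measurable f : cintegrable f -> cmeasurable f.
Proof. by move=> [/measurable_int/measurable_EFinP ? /measurable_int/measurable_EFinP ?]. Qed.

Lemma cmeasurableM f g : cmeasurable f -> cmeasurable g ->
  cmeasurable (fun x => f x * g x).
Proof.
move=> [f1 f2] [g1 g2]; split.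
  under eq_fun do rewrite ReMc.
  by apply: measurable_funB; exact: measurable_funM.
under eq_fun do rewrite ImMc.
by apply: measurable_funD; exact: measurable_funM.
Qed.

Lemma cmeasurableD f g : cmeasurable f -> cmeasurable g ->
  cmeasurable (fun x => f x + g x).
Proof.
move=> [f1 f2] [g1 g2]; split.
  by under eq_fun do rewrite ReDc; exact: measurable_funD.
by under eq_fun do rewrite ImDc; exact: measurable_funD.
Qed.

Lemma cmeasurable_cst c : cmeasurable (fun=> c).
Proof. by split; exact: measurable_cst. Qed.

Lemma cmeasurable_sum (I : Type) (r : seq I) (F : I -> T -> R[i]) :
  (forall i, cmeasurable (F i)) -> cmeasurable (fun x => \sum_(i <- r) F i x).
Proof.
move=> mF; elim: r => [|i r IH].
  by under eq_fun do rewrite big_nil; exact: cmeasurable_cst.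
by under eq_fun do rewrite big_cons; exact: cmeasurableD.
Qed.

Lemma cmeasurable_conj f : cmeasurable f -> cmeasurable (fun x => (f x)^*).
Proof.
move=> [f1 f2]; split; first by under eq_fun do rewrite Re_conjc.
by under eq_fun do rewrite Im_conjc; exact: measurableT_comp.
Qed.

Lemma cmeasurable_real (h : T -> R) : measurable_fun setT h ->
  cmeasurable (fun x => (h x)%:C).
Proof. by move=> mh; split => //=; exact: measurable_cst. Qed.

Lemma cmeasurable_cexp f : cmeasurable f -> cmeasurable (fun x => cexp (f x)).
Proof.
move=> [f1 f2]; apply: cmeasurableM.
  by apply: cmeasurable_real; exact: measurableT_comp.
split => /=.
  apply: measurableT_comp => //.
  by apply: continuous_measurable_fun; exact: continuous_cos.
apply: measurableT_comp => //.
by apply: continuous_measurable_fun; exact: continuous_sin.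
Qed.

Lemma measurable_normc f : cmeasurable f ->
  measurable_fun setT (fun x => Normc.normc (f x)).
Proof.
move=> [f1 f2].
rewrite (_ : (fun x => _) =
    fun x => Num.sqrt (complex.Re (f x) ^+ 2 + complex.Im (f x) ^+ 2)).
  apply: measurableT_comp; first exact: (continuous_measurable_fun (@sqrt_continuous R)).
  by apply: measurable_funD; exact: measurable_funX.
by apply/funext => x; rewrite -sqr_normc_ReIm sqrtr_sqr ger0_norm// normc_ge0.
Qed.

Lemma cintegrable_le f (h : T -> R) : cmeasurable f ->
  mu.-integrable setT (EFin \o h) -> (forall x, Normc.normc (f x) <= h x) ->
  cintegrable f.
Proof.
move=> [f1 f2] ih fh; split; (apply: le_integrable ih => //;
  [exact/measurable_EFinP|move=> x _; rewrite /= lee_fin]);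
  apply: le_trans (le_trans _ (fh x)) (ler_norm _);
  [exact: normr_Re_le|exact: normr_Im_le].
Qed.

Lemma integrable_normc f : cintegrable f ->
  mu.-integrable setT (EFin \o (fun x => Normc.normc (f x))).
Proof.
move=> fi; have [i1 i2] := fi.
apply: (@le_integrable _ _ _ mu setT measurableT _
  (EFin \o (fun x => `|complex.Re (f x)| + `|complex.Im (f x)|))) => //.
- apply/measurable_EFinP; apply: measurable_normc; exact: cintegrable_measurable.
- move=> x _ /=; rewrite lee_fin [leRHS]ger0_norm ?addr_ge0// [leLHS]ger0_norm ?normc_ge0//.
  exact: normc_le_ReIm.
- exact: (integrableD measurableT (integrable_norm i1) (integrable_norm i2)).
Qed.

Lemma cintegrableP f (h : T -> R) : cmeasurable f -> (forall x, Normc.normc (f x) = h x) ->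
  (\int[mu]_x (h x)%:E < +oo)%E -> cintegrable f.
Proof.
move=> mf fh hoo; apply: (@cintegrable_le _ h) => // [|x]; last by rewrite fh.
have h0 x : 0 <= h x by rewrite -fh normc_ge0.
apply/integrableP; split.
  apply/measurable_EFinP; rewrite (_ : h = fun x => Normc.normc (f x)).
    exact: measurable_normc.
  by apply/funext => x; rewrite fh.
by under eq_integral do rewrite /= ger0_norm//.
Qed.

Lemma cintegrableD f g : cintegrable f -> cintegrable g ->
  cintegrable (fun x => f x + g x).
Proof.
move=> [f1 f2] [g1 g2]; split.
  by under [X in EFin \o X]eq_fun do rewrite ReDc; exact: integrableD_EFin.
by under [X in EFin \o X]eq_fun do rewrite ImDc; exact: integrableD_EFin.
Qed.

Lemma cintegrableZ c f : cintegrable f -> cintegrable (fun x => c * f x).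
Proof.
move=> [f1 f2]; split.
  under [X in EFin \o X]eq_fun do rewrite ReMc.
  by apply: integrableB_EFin; exact: integrableZl_EFin.
under [X in EFin \o X]eq_fun do rewrite ImMc.
by apply: integrableD_EFin; exact: integrableZl_EFin.
Qed.

Lemma cintegralD f g : cintegrable f -> cintegrable g ->
  cintegral mu (fun x => f x + g x) = cintegral mu f + cintegral mu g.
Proof.
move=> [f1 f2] [g1 g2]; apply: complex_ReIm_ext; rewrite ?ReDc ?ImDc /=.
  by under eq_Rintegral do rewrite ReDc; rewrite RintegralD.
by under eq_Rintegral do rewrite ImDc; rewrite RintegralD.
Qed.

Lemma cintegralZ c f : cintegrable f ->
  cintegral mu (fun x => c * f x) = c * cintegral mu f.
Proof.
move=> [f1 f2]; apply: complex_ReIm_ext; rewrite ?ReMc ?ImMc /=.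
  under eq_Rintegral do rewrite ReMc.
  rewrite RintegralB ?RintegralZl//; exact: integrableZl_EFin.
under eq_Rintegral do rewrite ImMc.
rewrite RintegralD ?RintegralZl//; exact: integrableZl_EFin.
Qed.

Lemma cintegral0 : cintegral mu (fun=> 0 : R[i]) = 0.
Proof.
by apply: complex_ReIm_ext => /=; rewrite /Rintegral integral0_eq.
Qed.

Lemma cintegrable_sum (I : Type) (r : seq I) (F : I -> T -> R[i]) :
  (forall i, cintegrable (F i)) -> cintegrable (fun x => \sum_(i <- r) F i x).
Proof.
move=> iF; elim: r => [|i r IH].
  by under eq_fun do rewrite big_nil; split; exact: integrable0.
by under eq_fun do rewrite big_cons; exact: cintegrableD.
Qed.

Lemma cintegral_sum (I : Type) (r : seq I) (F : I -> T -> R[i]) :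
  (forall i, cintegrable (F i)) ->
  cintegral mu (fun x => \sum_(i <- r) F i x) = \sum_(i <- r) cintegral mu (F i).
Proof.
move=> iF; elim: r => [|i r IH].
  by under eq_fun do rewrite big_nil; rewrite big_nil cintegral0.
under eq_fun do rewrite big_cons.
by rewrite cintegralD// ?big_cons ?IH//; exact: cintegrable_sum.
Qed.

(** Real and imaginary parts are estimated separately, whence the factor 2; it passes into the
    constants of the pointwise bound and of the symbol. *)
Lemma normc_cintegral_le f (M : R) : cintegrable f ->
  \int[mu]_x Normc.normc (f x) <= M -> Normc.normc (cintegral mu f) <= 2 * M.
Proof.
move=> fi fM; have [i1 i2] := fi; have inf := integrable_normc fi.
apply: le_trans (normc_le_ReIm _) _; rewrite mulr_natl mulr2n /=.
apply: lerD; apply: le_trans fM;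
  (apply: le_trans (le_normr_Rintegral _ _) _ => //;
   apply: le_Rintegral => //; [exact: integrable_norm|move=> x _]).
- exact: normr_Re_le.
- exact: normr_Im_le.
Qed.

End complex_integral.

Lemma change_var_cintegral d1 d2 (T1 : measurableType d1) (T2 : measurableType d2)
  (R : realType) (mu : {measure set T1 -> \bar R}) (nu : {measure set T2 -> \bar R})
  (S : T1 -> T2) (c : R) (f : T2 -> R[i]) : change_var mu nu S c ->
  cintegrable nu f -> cintegral mu (fun x => f (S x)) = c%:C * cintegral nu f.
Proof.
move=> cv [f1 f2]; apply: complex_ReIm_ext; rewrite mulrC ?ReMreal ?ImMreal /= mulrC.
  exact: (change_var_Rintegral cv f1).
exact: (change_var_Rintegral cv f2).
Qed.

Lemma change_var_cintegrable d1 d2 (T1 : measurableType d1) (T2 : measurableType d2)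
  (R : realType) (mu : {measure set T1 -> \bar R}) (nu : {measure set T2 -> \bar R})
  (S : T1 -> T2) (c : R) (f : T2 -> R[i]) : change_var mu nu S c ->
  cintegrable nu f -> cintegrable mu (fun x => f (S x)).
Proof.
by move=> cv [f1 f2]; split; [exact: (change_var_integrable cv f1)|
  exact: (change_var_integrable cv f2)].
Qed.

Section entire_gaussian_mean_value.
Context (R : realType) (n : nat).
Local Notation nu := (lebesgue_Cn R n).

Lemma cmeasurable_entire (F : Cn R n -> R[i]) : entire F ->
  cmeasurable (fun p : Rn R n * Rn R n => F (Cn_of p)).
Proof. by move=> dF; split; [exact: measurable_Re_entire|exact: measurable_Im_entire]. Qed.

Theorem gaussian_mean_value (K : Cn R n -> R[i]) (a : R) : 0 < a -> entire K ->
  cintegrable nu (fun p => K (Cn_of p) * (gaussC a p)%:C) ->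
  cintegral nu (fun p => K (Cn_of p) * (gaussC a p)%:C) = ((pi / a) ^+ n)%:C * K 0.
Proof.
move=> a0 dK [i1 i2]; have [m1 m2] := cmeasurable_entire dK.
have E (p : Rn R n * Rn R n) (t : R) : K (Cn_of (rot (cos t) (sin t) p)) =
    K (0 + (cos t +i* sin t) *: Cn_of p) by rewrite Cn_of_rot add0r.
have K0 (p : Rn R n * Rn R n) : K 0 = K (0 + 0 *: Cn_of p) by rewrite scale0r addr0.
have hl (p : Rn R n * Rn R n) := holo_line 0 (Cn_of p) dK.
have i1' : nu.-integrable setT
    (EFin \o (fun p => complex.Re (K (Cn_of p)) * gaussC a p)).
  by move: i1; rewrite /comp; under eq_fun do rewrite ReMreal.
have i2' : nu.-integrable setT
    (EFin \o (fun p => complex.Im (K (Cn_of p)) * gaussC a p)).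
  by move: i2; rewrite /comp; under eq_fun do rewrite ImMreal.
apply: complex_ReIm_ext; rewrite mulrC ?ReMreal ?ImMreal /=.
- under eq_Rintegral do rewrite ReMreal.
  apply: (gaussian_mean_real a0 m1 i1').
    by move=> p; under eq_fun do rewrite E; exact: (circle_continuous_Re (hl p)).
  by move=> p; under eq_fun do rewrite E; rewrite (circle_mean_Re (hl p)) -K0.
- under eq_Rintegral do rewrite ImMreal.
  apply: (gaussian_mean_real a0 m2 i2').
    by move=> p; under eq_fun do rewrite E; exact: (circle_continuous_Im (hl p)).
  by move=> p; under eq_fun do rewrite E; rewrite (circle_mean_Im (hl p)) -K0.
Qed.

End entire_gaussian_mean_value.

(** * The operator on exponentials *)

Section Cn_coordinates.
Context (R : realType) (n : nat).
Implicit Types (z w u a b : Cn R n) (p : Rn R n * Rn R n).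
Local Notation nu := (lebesgue_Cn R n).

Definition Cn_coord z : Rn R n * Rn R n :=
  ([tuple complex.Re (z 0 j) | j < n], [tuple complex.Im (z 0 j) | j < n]).

Lemma Cn_coordK : cancel Cn_coord (@Cn_of R n).
Proof.
move=> z; apply/rowP => j; rewrite Cn_of_coord !tnth_mktuple.
by case: (z 0 j).
Qed.

(** The map is used only through its effect on [Cn_of], hence the existential form here and in the
    next two lemmas. *)
Lemma change_var_Cn_translate z : exists S, change_var nu nu S 1 /\
  forall p, Cn_of (S p) = z + Cn_of p.
Proof.
pose q := Cn_coord z; exists (fun p => (affinet q.1 1 p.1, affinet q.2 1 p.2)); split.
  have := change_var_Cn_affine q.1 q.2 (oner_neq0 R) (oner_neq0 R).
  by rewrite normr1 expr1n invr1 mulr1.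
move=> p; rewrite -[in RHS](Cn_coordK z) !Cn_ofE /= !Rn_Cn_affinet !scale1r -/q scalerDr.
by rewrite addrACA.
Qed.

Lemma change_var_Cn_reflect z : exists S, change_var nu nu S 1 /\
  forall p, Cn_of (S p) = z - Cn_of p.
Proof.
pose q := Cn_coord z; exists (fun p => (affinet q.1 (-1) p.1, affinet q.2 (-1) p.2)); split.
  have := change_var_Cn_affine q.1 q.2 (c1 := -1) (c2 := -1).
  by rewrite normrN normr1 expr1n invr1 mulr1 oppr_eq0 oner_eq0; apply.
move=> p; rewrite -[in RHS](Cn_coordK z) !Cn_ofE /= !Rn_Cn_affinet rmorphN rmorph1.
by rewrite !scaleN1r -/q scalerBr opprD addrACA.
Qed.

Lemma change_var_Cn_conj z : exists S, change_var nu nu S 1 /\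
  forall p, Cn_of (S p) = z + conjv (Cn_of p).
Proof.
pose q := Cn_coord z; exists (fun p => (affinet q.1 1 p.1, affinet q.2 (-1) p.2)); split.
  have := change_var_Cn_affine q.1 q.2 (c1 := 1) (c2 := -1).
  by rewrite normrN normr1 expr1n invr1 mulr1 oppr_eq0 oner_eq0; apply.
move=> p; rewrite -[in RHS](Cn_coordK z) conjv_Cn_of !Cn_ofE /= !Rn_Cn_affinet.
by rewrite rmorphN rmorph1 scaleN1r scale1r -/q scalerBr addrACA.
Qed.

(** The inequality uv <= 2u^2 + v^2/8, from (4u - v)^2 >= 0. The small coefficient of |w|^2 lets a
    Gaussian absorb a linear exponent. *)
Lemma Re_cdot_le z w : complex.Re (cdot z w) <= 2 * sqnorm z + sqnorm w / 8.
Proof.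
rewrite Re_sum !sqnormE mulr_sumr mulr_suml -big_split; apply: ler_sum => j _ /=.
apply: le_trans (le_trans (ler_norm _) (normr_Re_le _)) _; rewrite Normc.normcM.
have := sqr_ge0 (4 * Normc.normc (z 0 j) - Normc.normc (w 0 j)).
by rewrite sqrrB exprMn -mulr_natr; lra.
Qed.

Lemma sqnormD z w : sqnorm (z + w) = sqnorm z + sqnorm w + 2 * complex.Re (cdot z (conjv w)).
Proof.
rewrite !sqnormE Re_sum mulr_sumr -!big_split; apply: eq_bigr => j _ /=.
rewrite !mxE !sqr_normc_ReIm; case: (z 0 j) => a b; case: (w 0 j) => c d /=.
ring.
Qed.

Lemma sqnormN z : sqnorm (- z) = sqnorm z.
Proof. by rewrite !sqnormE; apply: eq_bigr => j _; rewrite mxE normcN. Qed.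

Lemma sqnorm_conj z : sqnorm (conjv z) = sqnorm z.
Proof. by rewrite !sqnormE; apply: eq_bigr => j _; rewrite mxE normc_conj. Qed.

Lemma gaussC_cexp (t : R) p :
  (gaussC t p)%:C = cexp (- (t%:C * cdot (Cn_of p) (conjv (Cn_of p)))).
Proof. by rewrite gaussCE -cexp_real rmorphN rmorphM/= sqnormC. Qed.

Lemma w0_gaussC p : w0 (Cn_of p) = (2 * pi) ^- n * gaussC 2^-1 p.
Proof. by rewrite /w0 gaussCE mulrC (mulrC (sqnorm _)) mulrC. Qed.

End Cn_coordinates.

Section S_op_exponential.
Context (R : realType) (n : nat).
Implicit Types (z w u a b : Cn R n) (p : Rn R n * Rn R n) (phi F : Cn R n -> R[i]).
Local Notation nu := (lebesgue_Cn R n).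

Definition kexp a w : R[i] := cexp (cdot w (conjv a) / 2).

Lemma pi2_gt0 : 0 < 2 * pi :> R.
Proof. by rewrite mulr_gt0// pi_gt0. Qed.

Lemma pi2n_gt0 : 0 < (2 * pi) ^+ n :> R.
Proof. by rewrite exprn_gt0// pi2_gt0. Qed.

Lemma fock_sqnormE F : entire F -> fock_sqnorm F =
  (((2 * pi) ^- n)%:E *
    \int[nu]_p (Normc.normc (F (Cn_of p)) ^+ 2 * gaussC 2^-1 p)%:E)%E.
Proof.
move=> dF; rewrite /fock_sqnorm -ge0_integralZl_EFin.
- by apply: eq_integral => p _; rewrite w0_gaussC; congr EFin; ring.
- by rewrite invr_ge0 ltW// pi2n_gt0.
- apply: measurable_funM; last exact: measurable_gaussC.
  by apply: measurable_funX; apply: measurable_normc; exact: cmeasurable_entire.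
- by move=> p; rewrite mulr_ge0 ?gaussC_ge0 ?sqr_ge0.
Qed.

Lemma fock_integrable F : fock F -> nu.-integrable setT
  (EFin \o (fun p => Normc.normc (F (Cn_of p)) ^+ 2 * gaussC 2^-1 p)).
Proof.
move=> [dF]; rewrite fock_sqnormE// => Foo; apply/integrableP; split.
  apply/measurable_EFinP/measurable_funM; last exact: measurable_gaussC.
  by apply: measurable_funX; apply: measurable_normc; exact: cmeasurable_entire.
rewrite (eq_integral (fun p => (Normc.normc (F (Cn_of p)) ^+ 2 * gaussC 2^-1 p)%:E)).
  move: Foo; rewrite !ltey; apply: contra => /eqP ->.
  by rewrite gt0_muley// lte_fin invr_gt0 pi2n_gt0.
by move=> p _; rewrite /= ger0_norm// mulr_ge0 ?gaussC_ge0 ?sqr_ge0.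
Qed.

Lemma fock_cst c : fock (fun _ : Cn R n => c).
Proof.
have dc : entire (fun _ : Cn R n => c) by exact: entire_cst.
split => //; rewrite fock_sqnormE// ge0_integralZl_EFin ?sqr_ge0//.
- rewrite integral_gaussC ?invr_gt0// -!EFinM ltry//.
- exact: measurable_gaussC.
- exact: gaussC_ge0.
Qed.

(** Membership in the Fock space is an L^2 bound, so the integrand is split as (f A) B, where f is
    the modulus of phi at z - w, A^2 is the Fock weight centred at z and B^2 is dominated by a
    Gaussian; then xy <= x^2 + y^2. *)
Lemma cintegrable_fock_gauss phi z b : fock phi -> cintegrable nu (fun p =>
  phi (z - Cn_of p) * cexp (cdot b (Cn_of p)) * (gaussC 2^-1 p)%:C).
Proof.
move=> fphi; have [dphi _] := fphi.
have [S [cS SE]] := change_var_Cn_reflect z.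
(* From |z - w|^2 <= 5|z|^2 + (5/4)|w|^2 and 2 Re(b . w) <= 4|b|^2 + |w|^2/4, the exponent of B^2 is
   at most (5/2)|z|^2 + 4|b|^2 - |w|^2/8. [C] is a round majorant of the constant part, and 1/8 is
   the rate of the Gaussian. *)
pose C := 5 * sqnorm z + 8 * sqnorm b.
have i1 := change_var_integrable cS (fock_integrable fphi).
have q0 : 0 < 8^-1 :> R by rewrite invr_gt0.
have i2 := integrableZl_EFin (expR C) (integrable_gaussC n q0).
have -> : (fun p => phi (z - Cn_of p) * cexp (cdot b (Cn_of p)) * (gaussC 2^-1 p)%:C) =
  (fun p => phi (Cn_of (S p)) * cexp (cdot b (Cn_of p)) * (gaussC 2^-1 p)%:C).
  by apply/funext => p; rewrite SE.
apply: cintegrable_le (integrableD_EFin i1 i2) _.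
  apply: cmeasurableM; last by apply: cmeasurable_real; exact: measurable_gaussC.
  apply: cmeasurableM; last first.
    by apply: cmeasurable_cexp; apply: cmeasurable_entire; exact: entire_cdot.
  have [mS _ _] := cS; have [m1 m2] := cmeasurable_entire dphi.
  by split; [exact: (measurableT_comp m1 mS)|exact: (measurableT_comp m2 mS)].
move=> p; rewrite normcMreal ?gaussC_ge0// Normc.normcM normc_cexp.
set f := Normc.normc _; rewrite !gaussCE SE.
have f0 : 0 <= f by exact: normc_ge0.
set s := sqnorm (Cn_of p); set t := sqnorm (z - Cn_of p).
have tE : t <= 5 * sqnorm z + s + s / 4.
  rewrite /t sqnormD sqnormN conjvN cdotNr ReNc -/s.
  have := Re_cdot_le (- z) (conjv (Cn_of p)); rewrite cdotNl ReNc sqnormN sqnorm_conj -/s.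
  by move=> ?; lra.
pose A := expR (- (2^-1 * t) / 2); pose B := expR (t / 4 + complex.Re (cdot b (Cn_of p)) - s / 2).
have -> : expR (- (2^-1 * t)) = A ^+ 2 by rewrite expr2 -expRD; congr expR; field.
have -> : f * expR (complex.Re (cdot b (Cn_of p))) * expR (- (2^-1 * s)) = f * A * B.
  by rewrite -!mulrA -!expRD; congr (_ * expR _); field.
have AB : f * A * B <= f ^+ 2 * A ^+ 2 + B ^+ 2.
  have := sqr_ge0 (f * A - B); have := sqr_ge0 (f * A); have := sqr_ge0 B.
  by rewrite sqrrB exprMn -mulr_natr; lra.
apply: le_trans AB _; rewrite lerD2l -expRD expr2 -expRD ler_expR /C.
have := Re_cdot_le b (Cn_of p); rewrite -/s => ?.
by have := sqnorm_ge0 z; have := sqnorm_ge0 b; lra.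
Qed.

Definition S_integrand phi a z p : R[i] := let w := Cn_of p in
  kexp a w * phi (z - conjv w) * cexp (cdot z (conjv w) / 2) * (w0 w)%:C.

(** The factor phi(z - conj w) is entire in conj w. In the variable v = conj w - conj a the
    integrand becomes, up to the constant [c0], the entire function [K] of v times e^{-|v|^2/2}, and
    the Gaussian mean is [K 0]. The exponent (z - a) . v / 2 in [K] is what completing the square
    leaves. *)
Lemma S_kernel phi a z : fock phi -> cintegrable nu (S_integrand phi a z) /\
  cintegral nu (S_integrand phi a z) = phi (z - conjv a) * cexp (cdot z (conjv a) / 2).
Proof.
move=> fphi; have [dphi _] := fphi.
have [S [cS SE]] := change_var_Cn_conj (- conjv a).
pose K v := phi (z - conjv a - v) * cexp (cdot (2^-1 *: (z - a)) v).
pose c0 : R[i] := ((2 * pi) ^- n)%:C * cexp (cdot z (conjv a) / 2).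
have iK : cintegrable nu (fun p => K (Cn_of p) * (gaussC 2^-1 p)%:C).
  exact: cintegrable_fock_gauss.
have dK : entire K.
  apply: entireM; last by apply: entire_cexp; exact: entire_cdot.
  rewrite (_ : (fun v => _) = fun v : 'rV[R[i]]_n => phi (z - conjv a + (-1) *: v)).
    exact: (entire_affine (z - conjv a) (-1) dphi).
  by apply/funext => v; rewrite scaleN1r.
have E : S_integrand phi a z = fun p => c0 * (K (Cn_of (S p)) * (gaussC 2^-1 (S p))%:C).
  apply/funext => p; rewrite /S_integrand /K SE /= w0_gaussC rmorphM /= !gaussC_cexp SE.
  move: (Cn_of p) => w.
  rewrite (_ : z - conjv a - (- conjv a + conjv w) = z - conjv w); last first.
    by rewrite opprD opprK addrA subrK.
  set P := phi _; rewrite /c0 /kexp.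
  transitivity (((2 * pi) ^- n)%:C * P * (cexp (cdot w (conjv a) / 2) *
    cexp (cdot z (conjv w) / 2) * cexp (- ((2^-1)%:C * cdot w (conjv w))))).
    ring.
  transitivity (((2 * pi) ^- n)%:C * P * (cexp (cdot z (conjv a) / 2) *
    cexp (cdot (2^-1 *: (z - a)) (- conjv a + conjv w)) *
    cexp (- ((2^-1)%:C * cdot (- conjv a + conjv w) (conjv (- conjv a + conjv w)))))); last first.
    ring.
  congr (_ * _); rewrite -!cexpD; congr cexp.
  rewrite (conjvD (- conjv a)) conjvN !conjvK cdotZl !(cdotDl, cdotDr, cdotNl, cdotNr).
  rewrite (cdotC (conjv a) a) (cdotC (conjv a) w) (cdotC (conjv w) a) (cdotC (conjv w) w).
  rewrite (_ : (2^-1)%:C = 2^-1 :> R[i]); last by rewrite fmorphV rmorphD rmorph1.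
  by field.
have iKS := change_var_cintegrable cS iK.
split; first by rewrite E; exact: cintegrableZ.
rewrite E cintegralZ// (change_var_cintegral cS iK) gaussian_mean_value ?invr_gt0//.
have c01 : ((2 * pi) ^- n)%:C * ((pi / 2^-1) ^+ n)%:C = 1 :> R[i].
  by rewrite -rmorphM/= invrK (mulrC pi) mulVf// gt_eqF// pi2n_gt0.
rewrite /K subr0 cdot0r cexp0 mulr1 rmorph1 mul1r /c0.
transitivity (phi (z - conjv a) * cexp (cdot z (conjv a) / 2) *
  (((2 * pi) ^- n)%:C * ((pi / 2^-1) ^+ n)%:C)); first by ring.
by rewrite c01 mulr1.
Qed.

Lemma S_op_span phi k (c : 'I_k -> R[i]) (a : 'I_k -> Cn R n) z : fock phi ->
  S_op phi (fun w => \sum_(i < k) c i * cexp (cdot w (conjv (a i)) / 2)) z =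
  \sum_(i < k) c i * (phi (z - conjv (a i)) * cexp (cdot z (conjv (a i)) / 2)).
Proof.
move=> fphi; rewrite /S_op.
rewrite (_ : (fun p => _) = fun p => \sum_(i < k) c i * S_integrand phi (a i) z p); last first.
  apply/funext => p; rewrite /S_integrand /kexp.
  move: (cexp (cdot z (conjv (Cn_of p)) / 2)) => A.
  by rewrite !mulr_suml; apply: eq_bigr => i _; rewrite !mulrA.
rewrite cintegral_sum.
  by apply: eq_bigr => i _; have [H1 H2] := S_kernel (a i) z fphi; rewrite cintegralZ// H2.
by move=> i; apply: cintegrableZ; have [] := S_kernel (a i) z fphi.
Qed.

End S_op_exponential.

(** * Necessity *)

Section necessity.
Context (R : realType) (n : nat).
Implicit Types (z w u a b : Cn R n) (p : Rn R n * Rn R n) (phi F : Cn R n -> R[i]).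
Local Notation nu := (lebesgue_Cn R n).

Lemma entire_kexp a : entire (kexp a).
Proof.
rewrite (_ : kexp a = fun w : Cn R n => cexp (cdot (2^-1 *: conjv a) w)).
  by apply: entire_cexp; exact: entire_cdot.
by apply/funext => w; rewrite /kexp cdotZl (cdotC (conjv a)) mulrC.
Qed.

Lemma entire_translate F b : entire F -> entire (fun z : Cn R n => F (z + b)).
Proof.
move=> dF; rewrite (_ : (fun z => _) = fun z : 'rV[R[i]]_n => F (b + 1 *: z)).
  exact: entire_affine.
by apply/funext => z; rewrite scale1r addrC.
Qed.

Lemma measurable_sqnormc_gauss F (t : R) : entire F ->
  measurable_fun setT (fun p => Normc.normc (F (Cn_of p)) ^+ 2 * gaussC t p).
Proof.
move=> dF; apply: measurable_funM; last exact: measurable_gaussC.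
by apply: measurable_funX; apply: measurable_normc; exact: cmeasurable_entire.
Qed.

(** Completing the square: the modulus squared of k_a times e^{-|w|^2/2} is e^{|a|^2/2} times the
    Gaussian centred at a. *)
Lemma fock_sqnorm_kexp a : fock_sqnorm (kexp a) = (expR (sqnorm a / 2))%:E.
Proof.
have c0 : 0 <= (2 * pi) ^- n :> R by rewrite invr_ge0 ltW// pi2n_gt0.
rewrite fock_sqnormE; last exact: entire_kexp.
have [S [[mS _ HS] SE]] := change_var_Cn_translate (- a).
transitivity (((2 * pi) ^- n)%:E *
  \int[nu]_p (expR (sqnorm a / 2) * gaussC 2^-1 (S p))%:E)%E.
  congr (_ * _)%E; apply: eq_integral => p _; congr EFin.
  rewrite /kexp normc_cexp !gaussCE SE sqnormD sqnormN cdotNl ReNc expr2 -!expRD.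
  congr expR; rewrite (_ : cdot _ _ / 2 = cdot (Cn_of p) (conjv a) * (2^-1)%:C); last first.
    by rewrite fmorphV rmorphD rmorph1.
  rewrite ReMreal (_ : complex.Re (cdot a _) = complex.Re (cdot (Cn_of p) (conjv a))).
    by field.
  by rewrite -Re_conjc cdot_conj conjvK cdotC.
rewrite ge0_integralZl_EFin ?expR_ge0//; last 2 first.
- exact: (measurableT_comp (measurable_gaussC _) mS).
- by move=> p; exact: gaussC_ge0.
rewrite (HS (fun p => (gaussC 2^-1 p)%:E)); last 2 first.
- by apply/measurable_EFinP; exact: measurable_gaussC.
- by move=> p; rewrite lee_fin gaussC_ge0.
rewrite mul1e integral_gaussC ?invr_gt0// -!EFinM; congr EFin.
by rewrite invrK (mulrC pi) mulrCA mulVf ?mulr1// gt_eqF// pi2n_gt0.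
Qed.

Lemma fock_kexp a : fock (kexp a).
Proof. by split; [exact: entire_kexp|rewrite fock_sqnorm_kexp ltry]. Qed.

Lemma exp_span_kexp a : exp_span (kexp a).
Proof.
exists 1%N, (fun=> 1), (fun=> a); apply/funext => w.
by rewrite big_ord1 mul1r.
Qed.

Lemma S_op_kexp phi a z : fock phi ->
  S_op phi (kexp a) z = phi (z - conjv a) * kexp a z.
Proof.
move=> fphi; rewrite [in LHS](_ : kexp a = fun w =>
    \sum_(i < 1) 1 * cexp (cdot w (conjv a) / 2)); last first.
  by apply/funext => w; rewrite big_ord1 mul1r.
by rewrite (S_op_span (fun=> 1) (fun=> a))// big_ord1 [LHS]mul1r.
Qed.

Lemma fock_norm_le (F G : Cn R n -> R[i]) (C : R) :
  fock F -> fock G -> fock_norm F <= C * fock_norm G ->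
  (fock_sqnorm F <= (C ^+ 2)%:E * fock_sqnorm G)%E.
Proof.
have fin (H : Cn R n -> R[i]) : fock H -> exists2 r : R, 0 <= r & fock_sqnorm H = r%:E.
  move=> [_ Hoo]; have H0 : (0 <= fock_sqnorm H)%E.
    by apply: integral_ge0 => p _; rewrite lee_fin mulr_ge0 ?sqr_ge0// w0_gaussC
      mulr_ge0 ?gaussC_ge0// invr_ge0 ltW// pi2n_gt0.
  exists (fine (fock_sqnorm H)); first exact: fine_ge0.
  by rewrite fineK// ge0_fin_numE.
move=> /fin[f f0 fE] /fin[g g0 gE]; rewrite /fock_norm fE gE /= => fg.
rewrite -EFinM lee_fin -(sqr_sqrtr f0) -(sqr_sqrtr g0) -exprMn.
(* [C] carries no sign; the quantity squared is [C * fock_norm G], nonnegative because it dominates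
   a norm. *)
by rewrite ler_pXn2r// nnegrE; [exact: sqrtr_ge0|exact: le_trans fg].
Qed.

Definition slice_sqnorm phi (a : Rn R n) : \bar R :=
  (\int[nu]_p (Normc.normc (phi (Cn_of p + 'i%C *: Rn_Cn a)) ^+ 2
     * expR (- (sqnorm (Cn_of p) / 2)))%:E)%E.

Lemma gaussC_half p : expR (- (sqnorm (Cn_of p) / 2)) = gaussC 2^-1 p.
Proof. by rewrite gaussCE mulrC. Qed.

Lemma slice_sqnorm_le phi : fock phi -> S_bounded phi ->
  exists M : R, forall a : Rn R n, (slice_sqnorm phi a <= M%:E)%E.
Proof.
move=> fphi [C HC]; exists ((2 * pi) ^+ n * C ^+ 2) => a.
have [dphi _] := fphi.
(* The point B is ia/2. Since conj B = -B, the image of k_B is phi(z + B) k_B(z); the weight times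
   |k_B|^2 is a Gaussian centred at B, and recentring it by the translation z + B moves the argument
   of phi to z + 2B = z + ia. The factors e^{|B|^2/2} on the two sides cancel, so the bound is
   uniform in a. *)
have [B conjB BB] : exists2 B : Cn R n, conjv B = - B & B + B = 'i%C *: Rn_Cn a.
  exists (('i%C / 2) *: Rn_Cn a); last by rewrite -scalerDl; congr (_ *: _); field.
  rewrite conjvZ conjv_real -scaleNr; congr (_ *: _).
  rewrite rmorphM fmorphV rmorphD rmorph1 -mulNr; congr (_ / _).
  by apply: complex_ReIm_ext => /=; rewrite ?oppr0.
have [fS] := HC _ (exp_span_kexp B).
move=> /(fock_norm_le fS (fock_kexp B)).
have SE : S_op phi (kexp B) = fun z => phi (z + B) * kexp B z.
  by apply/funext => z; rewrite S_op_kexp// conjB opprK.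
rewrite fock_sqnorm_kexp fock_sqnormE; last by case: fS.
rewrite SE.
have [S [[mS _ HS] SBE]] := change_var_Cn_translate B.
pose G p := Normc.normc (phi (Cn_of p + B) * kexp B (Cn_of p)) ^+ 2 * gaussC 2^-1 p.
have mG : measurable_fun setT G.
  apply: (measurable_sqnormc_gauss (F := fun z => phi (z + B) * kexp B z)).
  by apply: entireM; [exact: entire_translate|exact: entire_kexp].
have G0 p : 0 <= G p by rewrite mulr_ge0 ?gaussC_ge0 ?sqr_ge0.
have := HS (EFin \o G); rewrite mul1e => <-; last 2 first.
- exact/measurable_EFinP.
- by move=> p; rewrite lee_fin.
have -> : (\int[nu]_p (EFin \o G) (S p) = (expR (sqnorm B / 2))%:E * slice_sqnorm phi a)%E.
  rewrite /slice_sqnorm -ge0_integralZl_EFin ?expR_ge0//; last 2 first.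
  - under eq_fun do rewrite gaussC_half.
    exact: (measurable_sqnormc_gauss 2^-1 (entire_translate ('i%C *: Rn_Cn a) dphi)).
  - by move=> p; rewrite mulr_ge0 ?expR_ge0 ?sqr_ge0.
  apply: eq_integral => p _; rewrite /= /G SBE -BB; congr EFin.
  rewrite (addrC B) -addrA Normc.normcM exprMn [RHS]mulrCA -mulrA; congr (_ * _).
  rewrite /kexp normc_cexp gaussCE SBE expr2 -!expRD; congr expR.
  rewrite (_ : cdot _ _ / 2 = cdot (Cn_of p + B) (conjv B) * (2^-1)%:C); last first.
    by rewrite fmorphV rmorphD rmorph1.
  rewrite ReMreal (addrC B) sqnormD conjB cdotDl ReDc.
  rewrite (_ : complex.Re (cdot B (- B)) = sqnorm B); last by rewrite -conjB.
  by field.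
rewrite muleA -EFinM => H.
have k0 : 0 < (2 * pi) ^- n * expR (sqnorm B / 2).
  by rewrite mulr_gt0 ?expR_gt0// invr_gt0 pi2n_gt0.
rewrite -(@lee_pmul2l _ ((2 * pi) ^- n * expR (sqnorm B / 2))%:E)// ?lte_fin//.
apply: le_trans H _; rewrite -!EFinM lee_fin le_eqVlt; apply/orP; left; apply/eqP.
by rewrite mulrACA mulVf ?gt_eqF ?pi2n_gt0// mul1r mulrC.
Qed.

(** The mean value formula is applied to the square of phi, which is entire, so an L^2 bound gives a
    pointwise one at once. The factor e^{-X . u} moves the centre of the Gaussian: as X is real, |u
    + X|^2 = |u|^2 + 2 Re(X . u) + |X|^2. *)
Lemma slice_sqnorm_pointwise phi (M : R) : fock phi ->
  (forall a : Rn R n, (slice_sqnorm phi a <= M%:E)%E) -> forall x y : Rn R n,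
  Normc.normc (phi (Rn_Cn x + 'i%C *: Rn_Cn y)) ^+ 2
    <= 2 * (expR (sqnorm (Rn_Cn x) / 2) * M) / (2 * pi) ^+ n.
Proof.
move=> [dphi _] HM x y; set X := Rn_Cn x; set Y := 'i%C *: Rn_Cn y.
pose K u := phi (u + (X + Y)) ^+ 2 * cexp (cdot (- X) u).
have dK : entire K.
  apply: entireM; last by apply: entire_cexp; exact: entire_cdot.
  by apply: entireX2; exact: entire_translate.
have [S [cS SE]] := change_var_Cn_translate X.
pose H p := Normc.normc (phi (Cn_of p + Y)) ^+ 2 * gaussC 2^-1 p.
have H0 p : 0 <= H p by rewrite mulr_ge0 ?gaussC_ge0 ?sqr_ge0.
have mH : measurable_fun setT H.
  exact: (measurable_sqnormc_gauss 2^-1 (entire_translate Y dphi)).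
have HME : (\int[nu]_p (H p)%:E <= M%:E)%E.
  apply: le_trans (HM y); rewrite le_eqVlt; apply/orP; left; apply/eqP.
  by apply: eq_integral => p _; rewrite gaussC_half.
have iH : nu.-integrable setT (EFin \o H).
  apply/integrableP; split; first exact/measurable_EFinP.
  rewrite (eq_integral (fun p => (H p)%:E)); first exact: le_lt_trans HME (ltry _).
  by move=> p _; rewrite /= ger0_norm.
have KE p : Normc.normc (K (Cn_of p) * (gaussC 2^-1 p)%:C) =
    expR (sqnorm X / 2) * H (S p).
  rewrite normcMreal ?gaussC_ge0// Normc.normcM normcX2 normc_cexp /H SE.
  rewrite addrA (addrC X) -mulrA [RHS]mulrCA; congr (_ * _).
  rewrite !gaussCE SE -!expRD; congr expR; rewrite (sqnormD X (Cn_of p)).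
  rewrite (_ : complex.Re (cdot X (conjv (Cn_of p))) = complex.Re (cdot X (Cn_of p))); last first.
    by rewrite -Re_conjc cdot_conj conjvK (conjv_real x).
  by rewrite cdotNl ReNc; field.
have iKS := integrableZl_EFin (expR (sqnorm X / 2)) (change_var_integrable cS iH).
have mK : cmeasurable (fun p => K (Cn_of p) * (gaussC 2^-1 p)%:C).
  apply: cmeasurableM; first exact: cmeasurable_entire.
  by apply: cmeasurable_real; exact: measurable_gaussC.
have iK : cintegrable nu (fun p => K (Cn_of p) * (gaussC 2^-1 p)%:C).
  by apply: cintegrable_le mK iKS _ => p; rewrite KE.
have h0 : 0 < 2^-1 :> R by rewrite invr_gt0.
have := gaussian_mean_value h0 dK iK.
rewrite invrK (mulrC pi) => GK.
have := normc_cintegral_le iK (lexx _).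
rewrite GK [Z in Normc.normc Z]mulrC normcMreal; last exact: ltW (pi2n_gt0 R n).
have -> : K 0 = phi (X + Y) ^+ 2 by rewrite /K add0r cdot0r cexp0 mulr1.
rewrite normcX2 -ler_pdivlMr ?pi2n_gt0//.
move=> /le_trans; apply; rewrite ler_pM2r ?invr_gt0 ?pi2n_gt0// ler_pM2l//.
under eq_Rintegral do rewrite KE.
rewrite RintegralZl//; last exact: (change_var_integrable cS iH).
rewrite ler_pM2l ?expR_gt0// (change_var_Rintegral cS iH) mul1r.
rewrite -lee_fin /Rintegral fineK//; exact: integrable_fin_num.
Qed.

End necessity.

(** * The symbol as a Gauss-Bargmann preimage *)

Section complex_fubini.
Context d1 d2 (T1 : measurableType d1) (T2 : measurableType d2) (R : realType).
Variables (m1 : {sigma_finite_measure set T1 -> \bar R})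
  (m2 : {sigma_finite_measure set T2 -> \bar R}).

Lemma measurable_Rintegral_fst (g : T1 * T2 -> R) : measurable_fun setT g ->
  measurable_fun setT (fun y => \int[m1]_x g (x, y)).
Proof.
move=> mg; have mEg : measurable_fun setT (EFin \o g) by exact/measurable_EFinP.
rewrite /Rintegral; apply: (measurableT_comp (f := @fine R)); first exact: fine_measurable.
under eq_fun do rewrite integralE.
apply: emeasurable_funB.
  rewrite (_ : (fun y => _) = fubini_G m1 (EFin \o g)^\+%E).
    by apply: measurable_fun_fubini_tonelli_G => //; exact: measurable_funepos.
  by apply/funext => y; apply: eq_integral => x _; rewrite !unlock.
rewrite (_ : (fun y => _) = fubini_G m1 (EFin \o g)^\-%E).
  by apply: measurable_fun_fubini_tonelli_G => //; exact: measurable_funeneg.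
by apply/funext => y; apply: eq_integral => x _; rewrite !unlock.
Qed.

Lemma cmeasurable_cintegral_fst (f : T1 * T2 -> R[i]) : cmeasurable f ->
  cmeasurable (fun y => cintegral m1 (fun x => f (x, y))).
Proof.
move=> [f1 f2]; split; first exact: (measurable_Rintegral_fst f1).
exact: (measurable_Rintegral_fst f2).
Qed.

(** The real-valued integral reads a divergent slice as 0; with every slice integrable the inner
    integrals agree with the extended ones at each point. *)
Let Rintegral21 (g : T1 * T2 -> R) : (m1 \x m2)%E.-integrable setT (EFin \o g) ->
  (forall y, m1.-integrable setT (EFin \o (fun x => g (x, y)))) ->
  \int[m2]_y \int[m1]_x g (x, y) = \int[(m1 \x m2)%E]_p g p.
Proof.
move=> ig igy; rewrite {1 3}/Rintegral -integral21_prod_meas1//; congr fine.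
apply: eq_integral => y _.
rewrite /Rintegral fineK //; exact: (integrable_fin_num _ (igy y)).
Qed.

Lemma cintegral21 (f : T1 * T2 -> R[i]) : cintegrable (m1 \x m2)%E f ->
  (forall y, cintegrable m1 (fun x => f (x, y))) ->
  cintegral m2 (fun y => cintegral m1 (fun x => f (x, y))) = cintegral (m1 \x m2)%E f.
Proof.
move=> [i1 i2] ify; apply: complex_ReIm_ext => /=.
  by apply: Rintegral21 => // y; have [] := ify y.
by apply: Rintegral21 => // y; have [] := ify y.
Qed.

End complex_fubini.

Section symbol.
Context (R : realType) (n : nat).
Implicit Types (z w u a b : Cn R n) (p : Rn R n * Rn R n) (x y : Rn R n).
Local Notation mu := (lebesgue_Rn R n).
Local Notation nu := (lebesgue_Cn R n).

Variables (phi : Cn R n -> R[i]) (M : R).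
Hypothesis dphi : entire phi.
Hypothesis HM : forall y, (\int[mu]_x
  (Normc.normc (phi (Rn_Cn x + 'i%C *: Rn_Cn y)) * expR (- (sqnorm (Rn_Cn x) / 4)))%:E
  <= M%:E)%E.

Let f p : R[i] := phi (Cn_of p) * (expR (- (4^-1 * rdot p.1 p.1)))%:C.

Let mf : cmeasurable f.
Proof.
apply: cmeasurableM; first exact: cmeasurable_entire.
apply: cmeasurable_real; apply: measurableT_comp => //; apply: measurableT_comp => //.
by apply: measurable_funM => //; exact: measurable_fun_rdot.
Qed.

Let f_norm p : Normc.normc (f p) =
  Normc.normc (phi (Cn_of p)) * expR (- (4^-1 * rdot p.1 p.1)).
Proof. by rewrite /f normcMreal// expR_ge0. Qed.

Let f_int y : (\int[mu]_x (Normc.normc (f (x, y)))%:E <= M%:E)%E.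
Proof.
apply: le_trans (HM y); rewrite le_eqVlt; apply/orP; left; apply/eqP.
by apply: eq_integral => x _; rewrite f_norm sqnorm_real /= mulrC (mulrC _ 4^-1) mulrC.
Qed.

Let mfy y : cmeasurable (fun x => f (x, y)).
Proof.
have [f1 f2] := mf; split; [exact: (measurable_fun_pair1 y f1)|exact: (measurable_fun_pair1 y f2)].
Qed.

Let fy_integrable y : cintegrable mu (fun x => f (x, y)).
Proof.
apply: (@cintegrableP _ _ _ mu (fun x => f (x, y)) _ (mfy y)) => //.
exact: le_lt_trans (f_int y) (ltry _).
Qed.

Let m0 y : R[i] := ((2 * pi) ^- n)%:C * cintegral mu (fun x => f (x, y)).

Definition symbol (xi : Rn R n) : R[i] :=
  ((2 * pi) ^- n)%:C * cintegral mu (fun x =>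
    phi (Rn_Cn x + 'i%C *: Rn_Cn (affinet (tuple0 R n) (- 2) xi)) *
    (expR (- (4^-1 * rdot x x)))%:C).

Let symbolE xi : symbol xi = m0 (affinet (tuple0 R n) (- 2) xi).
Proof. by []. Qed.

Let cm0 : cmeasurable m0.
Proof.
apply: cmeasurableM; first exact: cmeasurable_cst.
exact: (cmeasurable_cintegral_fst mu mf).
Qed.

Lemma cmeasurable_symbol : cmeasurable symbol.
Proof.
have [m1 m2] := cm0.
have maff : measurable_fun setT (affinet (tuple0 R n) (- 2)).
  exact: measurable_fun_affinet.
split; [exact: (measurableT_comp m1 maff)|exact: (measurableT_comp m2 maff)].
Qed.

Let B := (2 * pi) ^- n * (2 * M).

Let m0_le y : Normc.normc (m0 y) <= B.
Proof.
rewrite /m0 Normc.normcM normc_real ger0_norm; last first.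
  by rewrite invr_ge0 ltW// pi2n_gt0.
rewrite /B ler_pM2l ?invr_gt0 ?pi2n_gt0//.
apply: normc_cintegral_le (fy_integrable y) _.
rewrite -lee_fin /Rintegral fineK; first exact: f_int.
exact: (integrable_fin_num _ (integrable_normc (fy_integrable y))).
Qed.

Lemma symbol_le xi : Normc.normc (symbol xi) <= B.
Proof. exact: m0_le. Qed.

Lemma Linfty_symbol : Linfty symbol.
Proof.
have [m1 m2] := cmeasurable_symbol; split => //.
rewrite /finite_norm unlock; case: ifP => _; last exact: ltry.
apply: le_lt_trans (ltry B).
apply: (@ess_sup_ler _ _ _ mu (fun x => `|Normc.normc (symbol x)|)) => x.
by rewrite lee_fin ger0_norm; [exact: symbol_le|exact: normc_ge0].
Qed.

Let e4 : (4^-1)%:C = 4^-1 :> R[i].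
Proof. by rewrite fmorphV rmorph_nat. Qed.

Let iIm p : 'i%C *: Rn_Cn p.2 = 2^-1 *: (Cn_of p - conjv (Cn_of p)).
Proof.
rewrite conjv_Cn_of Cn_ofE opprB; move: ('i%C *: Rn_Cn p.2) => Y.
by apply/rowP => j; rewrite !mxE; field.
Qed.

Section transform.
Variable z : Cn R n.

(** In the variable y = -2 xi, [ker] is e^{i z . xi} and [g4] is e^{-|xi|^2}. The two quarter
    Gaussians, in x from [f] and in y from [g4], then form e^{-|w|^2/4} on C^n in [F]. *)
Let ker y : R[i] := cexp (cdot (- ('i%C / 2) *: z) (Rn_Cn y)).
Let g4 y : R := expR (- (4^-1 * rdot y y)).
Let F p : R[i] := f p * (ker p.2 * (g4 p.2)%:C).

Let c8 := expR (2 * sqnorm (- ('i%C / 2) *: z)).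

Let ker_le y : Normc.normc (ker y * (g4 y)%:C) <= c8 * expR (- (8^-1 * rdot y y)).
Proof.
rewrite normcMreal ?expR_ge0// normc_cexp -!expRD ler_expR.
by have := Re_cdot_le (- ('i%C / 2) *: z) (Rn_Cn y); rewrite sqnorm_real; lra.
Qed.

Let mker : cmeasurable (fun y => ker y * (g4 y)%:C).
Proof.
apply: cmeasurableM; last by apply: cmeasurable_real; exact: measurable_gauss.
apply: cmeasurable_cexp; rewrite /cdot; apply: cmeasurable_sum => j.
apply: cmeasurableM; first exact: cmeasurable_cst.
under eq_fun do rewrite mxE.
by apply: cmeasurable_real; exact: measurable_tnth.
Qed.

Let mF : cmeasurable F.
Proof.
apply: cmeasurableM => //; have [k1 k2] := mker.
split; [exact: (measurableT_comp k1 measurable_snd)|exact: (measurableT_comp k2 measurable_snd)].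
Qed.

Let M0 : 0 <= M.
Proof.
rewrite -lee_fin; apply: le_trans (f_int (tuple0 R n)).
by apply: integral_ge0 => x _; rewrite lee_fin normc_ge0.
Qed.

(** Tonelli with x integrated first: the hypothesis bounds the x-integral uniformly in y, and the
    rest is Gaussian in y. *)
Let iF : cintegrable nu F.
Proof.
apply: (cintegrableP mF (h := fun p => Normc.normc (F p))) => //.
have mnF : measurable_fun setT (fun p => (Normc.normc (F p))%:E).
  by apply/measurable_EFinP; exact: measurable_normc.
rewrite /lebesgue_Cn fubini_tonelli2//; last first.
  by move=> p; rewrite lee_fin normc_ge0.
have i8 : (0 < 8^-1 :> R) by rewrite invr_gt0.
apply: (@le_lt_trans _ _ (\int[mu]_y ((M * c8) * expR (- (8^-1 * rdot y y)))%:E)%E).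
  apply: ge0_le_integral => //.
  - by move=> y _; apply: integral_ge0 => x _; rewrite lee_fin normc_ge0.
  - apply: measurable_fun_fubini_tonelli_G => //.
    by move=> p; rewrite lee_fin normc_ge0.
  - by apply/measurable_EFinP/measurable_funM => //; exact: measurable_gauss.
  - move=> y _; rewrite /fubini_G /F.
    under eq_integral => x _ do rewrite /= Normc.normcM mulrC.
    rewrite ge0_integralZl_EFin ?normc_ge0//; last 2 first.
    + by apply: measurable_normc; exact: mfy.
    + by move=> x; exact: normc_ge0.
    apply: (@le_trans _ _ ((Normc.normc (ker y * (g4 y)%:C))%:E * M%:E)%E).
      by apply: lee_wpmul2l; [rewrite lee_fin; exact: normc_ge0|exact: f_int].
    by rewrite -EFinM lee_fin mulrC -mulrA ler_wpM2l.
rewrite ge0_integralZl_EFin ?integral_gauss_Rn -?EFinM ?ltry//.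
  by rewrite mulr_ge0 ?expR_ge0.
exact: measurable_gauss.
Qed.

(** Writing iy as (w - conj w)/2 and w = u + z, every term in conj u cancels except the one in
    |u|^2. What remains is the entire function [K] of u times e^{-|u|^2/4}, with [K 0] equal to
    phi(z). *)
Let F_entire : cexp (cdot z z / 4) * cintegral nu F = ((4 * pi) ^+ n)%:C * phi z.
Proof.
pose K u := phi (u + z) * cexp (cdot (- (4^-1 *: (z + conjv z))) u).
have dK : entire K.
  apply: entireM; last by apply: entire_cexp; exact: entire_cdot.
  exact: entire_translate.
have [S [cS SE]] := change_var_Cn_translate z.
have E : (fun p => K (Cn_of p) * (gaussC 4^-1 p)%:C) =
    fun p => cexp (cdot z z / 4) * F (S p).
  apply/funext => p; rewrite /F /f /ker /K SE (addrC (Cn_of p) z) -mulrA.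
  have -> : forall P k1 : R[i], P * (expR (- (4^-1 * rdot (S p).1 (S p).1)))%:C *
      (k1 * (g4 (S p).2)%:C) = P * (k1 * (gaussC 4^-1 (S p))%:C).
    move=> P k1; rewrite (_ : gaussC _ _ = expR (- (4^-1 * rdot (S p).1 (S p).1)) * g4 (S p).2).
      by rewrite rmorphM /=; ring.
    by rewrite /g4 -expRD /gaussC mulrDr opprD.
  rewrite [RHS]mulrCA; congr (_ * _).
  rewrite gaussC_cexp.
  rewrite gaussC_cexp SE -!cexpD; congr cexp.
  rewrite (_ : cdot (- ('i%C / 2) *: z) _ = - 2^-1 * cdot z ('i%C *: Rn_Cn (S p).2)); last first.
    by rewrite cdotZl cdotZr; field.
  rewrite iIm SE; move: (Cn_of p) => w.
  rewrite e4 cdotZr !conjvD.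
  rewrite cdotNl cdotZl opprD !(cdotDl, cdotDr, cdotNl, cdotNr).
  rewrite (cdotC (conjv z) w).
  by field.
have iK : cintegrable nu (fun p => K (Cn_of p) * (gaussC 4^-1 p)%:C).
  by rewrite E; apply: cintegrableZ; exact: change_var_cintegrable cS iF.
have q0 : 0 < 4^-1 :> R by rewrite invr_gt0.
have := gaussian_mean_value q0 dK iK.
rewrite E cintegralZ; last exact: change_var_cintegrable cS iF.
rewrite (change_var_cintegral cS iF) rmorph1 mul1r => ->.
by rewrite invrK (mulrC pi) /K add0r cdot0r cexp0 mulr1.
Qed.

Let H y : R[i] := m0 y * (ker y * (g4 y)%:C).

Let iH : cintegrable mu H.
Proof.
have i8 : (0 < 8^-1 :> R) by rewrite invr_gt0.
have iB := integrableZl_EFin (B * c8) (integrable_gauss_Rn n i8).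
apply: (cintegrable_le (cmeasurableM cm0 mker) iB) => y.
by rewrite Normc.normcM -(mulrA B); apply: ler_pM;
  [exact: normc_ge0|exact: normc_ge0|exact: m0_le|exact: ker_le].
Qed.

Let HE y : H y = ((2 * pi) ^- n)%:C * cintegral mu (fun x => F (x, y)).
Proof.
rewrite /H /m0 -mulrA; congr (_ * _).
by rewrite [LHS]mulrC -cintegralZ//; congr cintegral; apply/funext => x; rewrite [LHS]mulrC.
Qed.

Let int_H : cintegral mu H = ((2 * pi) ^- n)%:C * cintegral nu F.
Proof.
have iFy y : cintegrable mu (fun x => F (x, y)).
  have := cintegrableZ (ker y * (g4 y)%:C) (fy_integrable y).
  by congr cintegrable; apply/funext => x; rewrite mulrC.
have iF' : cintegrable mu (fun y => cintegral mu (fun x => F (x, y))).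
  have := cintegrableZ ((2 * pi) ^+ n)%:C iH.
  congr cintegrable; apply/funext => y; rewrite HE mulrA -rmorphM /= mulfV ?rmorph1 ?mul1r//.
  by rewrite gt_eqF// pi2n_gt0.
transitivity (cintegral mu (fun y => ((2 * pi) ^- n)%:C * cintegral mu (fun x => F (x, y)))).
  by congr cintegral; apply/funext => y; exact: HE.
by rewrite cintegralZ// (cintegral21 iF iFy).
Qed.

Lemma gauss_bargmann_symbolE : gauss_bargmann symbol z = phi z.
Proof.
have n20 : (-2 : R) != 0 by rewrite oppr_eq0 pnatr_eq0.
have cv := change_var_affinet (tuple0 R n) n20.
rewrite /gauss_bargmann.
transitivity (cexp (cdot z z / 4) *
  cintegral mu (fun xi => H (affinet (tuple0 R n) (- 2) xi))).
  congr (_ * _); congr cintegral; apply/funext => xi.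
  rewrite symbolE /H -mulrA; congr (_ * (_ * _)).
    rewrite /ker Rn_Cn_affinet Rn_Cn0 add0r cdotZl cdotZr; congr cexp.
    by rewrite rmorphN rmorph_nat; field.
  rewrite /g4 -!sqnorm_real; congr (expR _)%:C; congr (- _).
  apply: (@complexI R); rewrite rmorphM /= !sqnormC !conjv_real e4.
  rewrite !Rn_Cn_affinet Rn_Cn0 !add0r cdotZl cdotZr rmorphN rmorph_nat.
  by field.
rewrite (change_var_cintegral cv iH) int_H.
(* The Jacobian 2^{-n} of xi to -2 xi, the normalisation (2 pi)^{-n} of the symbol and the Gaussian
   mass (4 pi)^n multiply to 1. *)
transitivity (((`|-2| ^- n) * (2 * pi) ^- n)%:C * (cexp (cdot z z / 4) * cintegral nu F)).
  by rewrite [in RHS]rmorphM /=; ring.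
rewrite F_entire mulrA -rmorphM /= normrN ger0_norm//.
rewrite -invfM -exprMn (_ : 2 * (2 * pi) = 4 * pi); last by ring.
have p4 : 0 < (4 * pi) ^+ n :> R by rewrite exprn_gt0// mulr_gt0// pi_gt0.
by rewrite mulVf ?gt_eqF// rmorph1 mul1r.
Qed.

End transform.

Lemma gauss_bargmann_symbol : gauss_bargmann symbol = phi.
Proof. by apply/funext => z; exact: gauss_bargmann_symbolE. Qed.

End symbol.

(** * Fourier transform and Plancherel inequality *)

Section product_integrals.
Context d1 d2 (T1 : measurableType d1) (T2 : measurableType d2) (R : realType).
Variables (m1 : {sigma_finite_measure set T1 -> \bar R})
  (m2 : {sigma_finite_measure set T2 -> \bar R}).

Lemma integrable_prodM (f : T1 -> R) (g : T2 -> R) :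
  m1.-integrable setT (EFin \o f) -> m2.-integrable setT (EFin \o g) ->
  (m1 \x m2)%E.-integrable setT (EFin \o (fun p => f p.1 * g p.2)).
Proof.
move=> fi gi; have /measurable_EFinP mf := measurable_int _ fi.
have /measurable_EFinP mg := measurable_int _ gi.
have mfg : measurable_fun setT (EFin \o (fun p : T1 * T2 => f p.1 * g p.2)).
  apply/measurable_EFinP; apply: measurable_funM.
    exact: (measurableT_comp mf measurable_fst).
  exact: (measurableT_comp mg measurable_snd).
apply: (integrable12ltyP m1 m2 mfg).2.
have /integrableP[_ goo] := gi; have /integrableP[_ foo] := fi.
set G := (\int[m2]_y _)%E in goo.
have G0 : (0 <= G)%E by exact: integral_ge0.
have GE : G = (fine G)%:E by rewrite fineK// ge0_fin_numE.
rewrite (eq_integral (fun x => (fine G * `|f x|)%:E)); last first.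
  move=> x _; under eq_integral do rewrite /= normrM.
  rewrite ge0_integralZl_EFin//; last exact: measurableT_comp.
  by rewrite EFinM -GE muleC.
rewrite ge0_integralZl_EFin//; [|exact: fine_ge0|exact: measurableT_comp].
by rewrite lte_mul_pinfty// lee_fin fine_ge0.
Qed.

Let Rintegral12 (g : T1 * T2 -> R) : (m1 \x m2)%E.-integrable setT (EFin \o g) ->
  (forall x, m2.-integrable setT (EFin \o (fun y => g (x, y)))) ->
  \int[m1]_x \int[m2]_y g (x, y) = \int[(m1 \x m2)%E]_p g p.
Proof.
move=> ig igx; rewrite {1 3}/Rintegral -integral12_prod_meas1//; congr fine.
apply: eq_integral => x _.
rewrite /Rintegral fineK //; exact: (integrable_fin_num _ (igx x)).
Qed.

Lemma cintegral12 (f : T1 * T2 -> R[i]) : cintegrable (m1 \x m2)%E f ->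
  (forall x, cintegrable m2 (fun y => f (x, y))) ->
  cintegral m1 (fun x => cintegral m2 (fun y => f (x, y))) = cintegral (m1 \x m2)%E f.
Proof.
move=> [i1 i2] ify; apply: complex_ReIm_ext => /=.
  by apply: Rintegral12 => // x; have [] := ify x.
by apply: Rintegral12 => // x; have [] := ify x.
Qed.

Lemma cmeasurable_fst (f : T1 -> R[i]) : cmeasurable f ->
  cmeasurable (fun p : T1 * T2 => f p.1).
Proof.
by move=> [f1 f2]; split; [exact: (measurableT_comp f1 measurable_fst)|
  exact: (measurableT_comp f2 measurable_fst)].
Qed.

Lemma cmeasurable_snd (f : T2 -> R[i]) : cmeasurable f ->
  cmeasurable (fun p : T1 * T2 => f p.2).
Proof.
by move=> [f1 f2]; split; [exact: (measurableT_comp f1 measurable_snd)|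
  exact: (measurableT_comp f2 measurable_snd)].
Qed.

Lemma cintegrable_prodM (f : T1 -> R[i]) (g : T2 -> R[i]) :
  cintegrable m1 f -> cintegrable m2 g ->
  cintegrable (m1 \x m2)%E (fun p => f p.1 * g p.2).
Proof.
move=> fi gi; apply: (cintegrable_le _
    (integrable_prodM (integrable_normc fi) (integrable_normc gi))) => [|p].
  exact: (cmeasurableM (cmeasurable_fst (cintegrable_measurable fi))
    (cmeasurable_snd (cintegrable_measurable gi))).
by rewrite Normc.normcM.
Qed.

Lemma cintegral_prodM (f : T1 -> R[i]) (g : T2 -> R[i]) :
  cintegrable m1 f -> cintegrable m2 g ->
  cintegral (m1 \x m2)%E (fun p => f p.1 * g p.2) = cintegral m1 f * cintegral m2 g.
Proof.
move=> fi gi.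
rewrite -(cintegral12 (cintegrable_prodM fi gi) (fun x => cintegrableZ (f x) gi)).
transitivity (cintegral m1 (fun x => cintegral m2 g * f x)).
  congr cintegral; apply/funext => x.
  by rewrite [RHS]mulrC -(cintegralZ (f x) gi).
by rewrite cintegralZ// mulrC.
Qed.

End product_integrals.

Lemma cintegrable_conj d (T : measurableType d) (R : realType)
  (m : {measure set T -> \bar R}) (f : T -> R[i]) : cintegrable m f ->
  cintegrable m (fun x => (f x)^*).
Proof.
move=> fi; have [i1 i2] := fi; apply: (cintegrable_le _ (integrable_normc fi)) => [|x].
  exact: (cmeasurable_conj (cintegrable_measurable fi)).
by rewrite normc_conj.
Qed.

Lemma cintegral_conj d (T : measurableType d) (R : realType)
  (m : {measure set T -> \bar R}) (f : T -> R[i]) : cintegrable m f ->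
  cintegral m (fun x => (f x)^*) = (cintegral m f)^*.
Proof.
move=> [i1 i2]; apply: complex_ReIm_ext; rewrite ?Re_conjc ?Im_conjc /=.
  by under eq_Rintegral do rewrite Re_conjc.
under eq_Rintegral do rewrite Im_conjc -mulN1r.
by rewrite RintegralZl// mulN1r.
Qed.

Lemma cintegral_real d (T : measurableType d) (R : realType)
  (m : {measure set T -> \bar R}) (f : T -> R) :
  cintegral m (fun x => (f x)%:C) = (\int[m]_x f x)%:C.
Proof. by apply: complex_ReIm_ext => //=; rewrite /Rintegral integral0_eq. Qed.

Lemma cintegrable_real d (T : measurableType d) (R : realType)
  (m : {measure set T -> \bar R}) (f : T -> R) : m.-integrable setT (EFin \o f) ->
  cintegrable m (fun x => (f x)%:C).
Proof. by move=> fi; split => //=; exact: integrable0. Qed.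

Section gaussian_fourier.
Context (R : realType) (n : nat).
Local Notation mu := (lebesgue_Rn R n).
Local Notation nu := (lebesgue_Cn R n).
Implicit Types (x y c : Rn R n) (a : R).

Lemma rdot_affinetl x (t : R) y c :
  rdot (affinet x t y) c = rdot x c + t * rdot y c.
Proof.
rewrite /rdot mulr_sumr -big_split; apply: eq_bigr => j _.
by rewrite tnth_affinet mulrDl mulrA.
Qed.

Lemma rdot_affinetr x (t : R) y c :
  rdot c (affinet x t y) = rdot c x + t * rdot c y.
Proof. by rewrite rdotC rdot_affinetl !(rdotC _ c). Qed.

Lemma rdot0l c : rdot (tuple0 R n) c = 0.
Proof. by rewrite /rdot big1// => j _; rewrite tnth_tuple0 mul0r. Qed.

Lemma rdot0r c : rdot c (tuple0 R n) = 0.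
Proof. by rewrite rdotC rdot0l. Qed.

Definition fchar c x : R[i] := cexp ('i%C * (rdot c x)%:C).

Lemma normc_fchar c x : Normc.normc (fchar c x) = 1.
Proof. by rewrite /fchar normc_cexp ReMc /= mul0r mulr0 subrr expR0. Qed.

Lemma cmeasurable_fchar d (T : measurableType d) (f g : T -> Rn R n) :
  measurable_fun setT f -> measurable_fun setT g ->
  cmeasurable (fun p => fchar (f p) (g p)).
Proof.
move=> mf mg; apply: cmeasurable_cexp; apply: cmeasurableM; first exact: cmeasurable_cst.
by apply: cmeasurable_real; exact: measurable_fun_rdot.
Qed.

Lemma cintegrable_fchar_gauss c a : 0 < a ->
  cintegrable mu (fun y => fchar c y * (expR (- (a * rdot y y)))%:C).
Proof.
move=> a0; apply: (cintegrable_le _ (integrable_gauss_Rn n a0)) => [|y].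
  apply: cmeasurableM; first exact: cmeasurable_fchar.
  by apply: cmeasurable_real; exact: measurable_gauss.
by rewrite normcMreal ?expR_ge0// normc_fchar mul1r.
Qed.

Let exp_gauss_shift c a x : 0 < a -> expR (rdot c x) * expR (- (a * rdot x x)) =
  expR ((4 * a)^-1 * rdot c c) * (fun x => expR (- (a * rdot x x)))
    (affinet (affinet (tuple0 R n) (- (2 * a)^-1) c) 1 x).
Proof.
move=> a0; rewrite /= -!expRD; congr expR.
rewrite !(rdot_affinetl, rdot_affinetr) !rdot0l !rdot0r (rdotC x c).
by field; rewrite gt_eqF.
Qed.

Lemma integrable_exp_gauss c a : 0 < a ->
  mu.-integrable setT (EFin \o (fun x => expR (rdot c x) * expR (- (a * rdot x x)))).
Proof.
move=> a0; under [X in EFin \o X]eq_fun do rewrite exp_gauss_shift//.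
apply: integrableZl_EFin.
exact: (change_var_integrable (change_var_translate _) (integrable_gauss_Rn n a0)).
Qed.

Lemma Rintegral_gauss_Rn a : 0 < a ->
  \int[mu]_x expR (- (a * rdot x x)) = Num.sqrt (pi / a) ^+ n.
Proof. by move=> a0; rewrite /Rintegral integral_gauss_Rn. Qed.

Lemma Rintegral_exp_gauss c a : 0 < a ->
  \int[mu]_x (expR (rdot c x) * expR (- (a * rdot x x))) =
  expR ((4 * a)^-1 * rdot c c) * Num.sqrt (pi / a) ^+ n.
Proof.
move=> a0; under eq_Rintegral do rewrite exp_gauss_shift//.
have ig := integrable_gauss_Rn n a0.
rewrite RintegralZl//; last exact: (change_var_integrable (change_var_translate _) ig).
by rewrite (change_var_Rintegral (change_var_translate _) ig) mul1r Rintegral_gauss_Rn.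
Qed.

(* By Fubini, the Gaussian mean of the entire function [exp (c . u)] is the
   Laplace transform times the Fourier transform of the real Gaussian. *)
Lemma fourier_gauss c a : 0 < a ->
  cintegral mu (fun y => fchar c y * (expR (- (a * rdot y y)))%:C) =
  (Num.sqrt (pi / a) ^+ n * expR (- ((4 * a)^-1 * rdot c c)))%:C.
Proof.
move=> a0.
pose K (u : Cn R n) := cexp (cdot (Rn_Cn c) u).
have dK : entire K by apply: entire_cexp; exact: entire_cdot.
pose A x : R[i] := (expR (rdot c x) * expR (- (a * rdot x x)))%:C.
pose B y := fchar c y * (expR (- (a * rdot y y)))%:C.
have iA : cintegrable mu A by apply: cintegrable_real; exact: integrable_exp_gauss.
have iB : cintegrable mu B by exact: cintegrable_fchar_gauss.
have KE : (fun p => K (Cn_of p) * (gaussC a p)%:C) = fun p => A p.1 * B p.2.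
  apply/funext => p; rewrite /K /A /B Cn_ofE cdotDr cdotZr !cdot_real cexpD cexp_real.
  rewrite /gaussC mulrDr opprD expRD !rmorphM /= /fchar.
  ring.
have := gaussian_mean_value a0 dK.
rewrite KE => /(_ (cintegrable_prodM iA iB)).
have -> : cintegral nu (fun p => A p.1 * B p.2) = cintegral mu A * cintegral mu B.
  exact: cintegral_prodM.
rewrite /A cintegral_real Rintegral_exp_gauss// /K cdot0r cexp0 mulr1 => AB.
set e := expR _ in AB; set g := Num.sqrt _ in AB *.
have e0 : 0 < e by exact: expR_gt0.
have g0 : 0 < g by rewrite sqrtr_gt0 divr_gt0// pi_gt0.
(* The Laplace transform of the Gaussian is positive, so it can be divided out of the product of the
   two transforms. *)
have eg0 : (e * g ^+ n)%:C != 0 :> R[i].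
  by rewrite fmorph_eq0 gt_eqF// mulr_gt0// exprn_gt0.
apply: (mulfI eg0); rewrite AB -rmorphM /=; congr (_%:C).
rewrite expRN -/e -[pi / a](@sqr_sqrtr R) ?divr_ge0 ?pi_ge0 ?ltW// -/g.
rewrite -exprM mulnC exprM expr2.
by field; rewrite gt_eqF.
Qed.

End gaussian_fourier.

Section plancherel.
Context (R : realType) (n : nat).
Local Notation mu := (lebesgue_Rn R n).
Local Notation nu := (lebesgue_Cn_sfinite R n).
Implicit Types (x y xi eta : Rn R n) (q : Rn R n * Rn R n).

(** Monotone convergence along the rates a = 1/(j+1), which removes the cutoff in Plancherel's
    inequality. *)
Lemma integral_le_gauss_cutoff (f : Rn R n -> R) (L : \bar R) :
  measurable_fun setT f -> (forall x, 0 <= f x) ->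
  (forall a : R, 0 < a -> (\int[mu]_x (f x * expR (- (a * rdot x x)))%:E <= L)%E) ->
  (\int[mu]_x (f x)%:E <= L)%E.
Proof.
move=> mf f0 H.
pose g (j : nat) x : \bar R := (f x * expR (- (j.+1%:R^-1 * rdot x x)))%:E.
have rd0 x : 0 <= rdot x x by rewrite -sqnorm_real; exact: sqnorm_ge0.
have mg j : measurable_fun setT (g j).
  by apply/measurable_EFinP; apply: measurable_funM => //; exact: measurable_gauss.
have g0 j x : setT x -> (0 <= g j x)%E by rewrite lee_fin mulr_ge0 ?expR_ge0.
have nd x : setT x -> nondecreasing_seq (g ^~ x).
  move=> _ i j ij; rewrite lee_fin ler_wpM2l// ler_expR lerN2 ler_wpM2r//.
  by rewrite lef_pV2 ?posrE// ler_nat.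
have gf x : (f x)%:E = limn (g ^~ x).
  apply/esym/cvg_lim => //; apply: cvg_EFin; first by near=> j.
  rewrite /g /comp /=.
  have : (fun j : nat => f x * expR (- (j.+1%:R^-1 * rdot x x))) @ \oo -->
      f x * expR (- (0 * rdot x x)).
    apply: cvgM; first exact: cvg_cst.
    apply: continuous_cvg; first exact: continuous_expR.
    apply: cvgN; apply: cvgM; last exact: cvg_cst.
    exact: cvg_harmonic.
  by rewrite mul0r oppr0 expR0 mulr1.
under eq_integral do rewrite gf.
rewrite monotone_convergence//; apply: lime_le.
  apply: ereal_nondecreasing_is_cvgn => i j ij.
  by apply: ge0_le_integral => // x xT; [exact: (g0 i x xT)|exact: (nd x xT i j ij)].
by near=> j; apply: H; rewrite invr_gt0.
Unshelve. all: by end_near. Qed.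

Variable k : Rn R n -> R[i].
Hypothesis ik : cintegrable mu k.

Definition hat x : R[i] := cintegral mu (fun xi => k xi * fchar x xi).

Let mk : cmeasurable k. Proof. exact: (cintegrable_measurable ik). Qed.

Let ikf x : cintegrable mu (fun xi => k xi * fchar x xi).
Proof.
apply: (cintegrable_le _ (integrable_normc ik)) => [|xi].
  by apply: cmeasurableM => //; exact: cmeasurable_fchar.
by rewrite Normc.normcM normc_fchar mulr1.
Qed.

Let diff q : Rn R n := affinet q.1 (-1) q.2.

Let measurable_diff : measurable_fun setT diff.
Proof. exact: measurable_fun_affinet. Qed.

Let fchar_diff x xi eta : fchar x xi * conjc (fchar x eta) = fchar (diff (xi, eta)) x.
Proof.
rewrite /fchar conjc_cexp -cexpD /diff /= rdot_affinetl !(rdotC _ x).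
by congr cexp; apply: complex_ReIm_ext => /=; ring.
Qed.

Let K q : R[i] := k q.1 * conjc (k q.2).

Let iK : cintegrable nu K.
Proof. exact: (cintegrable_prodM ik (cintegrable_conj ik)). Qed.

Let hat_sqr x : (Normc.normc (hat x) ^+ 2)%:C =
  cintegral nu (fun q => K q * fchar (diff q) x).
Proof.
have -> : (Normc.normc (hat x) ^+ 2)%:C = hat x * conjc (hat x) :> R[i].
  rewrite sqr_normc_ReIm; case: (hat x) => u v.
  by apply: complex_ReIm_ext => /=; ring.
rewrite /hat -cintegral_conj//.
have <- := cintegral_prodM (ikf x) (cintegrable_conj (ikf x)).
congr cintegral; apply/funext => q.
by rewrite -[diff q]/(diff (q.1, q.2)) -fchar_diff rmorphM /K /=; ring.
Qed.

Section cutoff.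
Variable a : R.
Hypothesis a0 : 0 < a.

Let gs x := expR (- (a * rdot x x)).
Let b : R := (4 * a)^-1.
Let b0 : 0 < b. Proof. by rewrite invr_gt0 mulr_gt0. Qed.
(** The Fourier transform of the cutoff [gs] at xi - eta: a positive symmetric kernel whose integral
    in either variable is (2 pi)^n, whatever a is. *)
Let W q : R := Num.sqrt (pi / a) ^+ n * expR (- (b * rdot (diff q) (diff q))).

Let W0 q : 0 <= W q. Proof. by rewrite mulr_ge0 ?exprn_ge0 ?sqrtr_ge0 ?expR_ge0. Qed.

Let mW : measurable_fun setT W.
Proof.
by apply: measurable_funM => //; exact: measurable_fun_gauss.
Qed.

Let diff_sym xi eta : rdot (diff (xi, eta)) (diff (xi, eta)) =
  rdot (diff (eta, xi)) (diff (eta, xi)).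
Proof.
by rewrite /diff /= !(rdot_affinetl, rdot_affinetr) (rdotC eta xi); ring.
Qed.

Let int_W xi : (\int[mu]_eta (W (xi, eta))%:E = ((2 * pi) ^+ n)%:E)%E.
Proof.
have n10 : (-1 : R) != 0 by rewrite oppr_eq0 oner_eq0.
have [_ _ H] := change_var_affinet xi n10.
rewrite /W ge0_integralZl_EFin ?exprn_ge0 ?sqrtr_ge0//; last first.
  by apply: measurable_fun_gauss; exact: (measurable_fun_pair2 xi measurable_diff).
rewrite (H (fun x => (expR (- (b * rdot x x)))%:E)); last 2 first.
- by apply/measurable_EFinP; exact: measurable_gauss.
- by move=> x; rewrite lee_fin expR_ge0.
rewrite normrN normr1 expr1n invr1 mul1e integral_gauss_Rn// -EFinM -exprMn.
congr ((_ ^+ _)%:E); rewrite -sqrtrM ?divr_ge0 ?pi_ge0 ?ltW// /b invrK.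
rewrite (_ : pi / a * (pi * (4 * a)) = (2 * pi) ^+ 2).
  by rewrite sqrtr_sqr ger0_norm// ltW// pi2_gt0.
by field; rewrite gt_eqF.
Qed.

Let N : \bar R := (\int[mu]_xi (Normc.normc (k xi) ^+ 2)%:E)%E.

Let N0 : (0 <= N)%E.
Proof. by apply: integral_ge0 => x _; rewrite lee_fin sqr_ge0. Qed.

Let mk2 : measurable_fun setT (fun xi => Normc.normc (k xi) ^+ 2).
Proof. by apply: measurable_funX; exact: measurable_normc. Qed.

Let int_W1 : (\int[nu]_q (Normc.normc (k q.1) ^+ 2 * W q)%:E = ((2 * pi) ^+ n)%:E * N)%E.
Proof.
have m1 : measurable_fun setT (fun q => (Normc.normc (k q.1) ^+ 2 * W q)%:E).
  apply/measurable_EFinP; apply: measurable_funM => //.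
  exact: (measurableT_comp mk2 measurable_fst).
have f0 q : (0 <= (Normc.normc (k q.1) ^+ 2 * W q)%:E)%E by rewrite lee_fin mulr_ge0 ?sqr_ge0.
rewrite [LHS](fubini_tonelli1 (m1 := mu) (m2 := mu) _ m1 f0).
rewrite -ge0_integralZl_EFin ?ltW ?pi2n_gt0//; last by move=> x; exact: sqr_ge0.
apply: eq_integral => xi _; rewrite /fubini_F /= ge0_integralZl_EFin ?sqr_ge0//.
  by rewrite int_W -EFinM mulrC.
exact: (measurable_fun_pair2 xi mW).
Qed.

Let int_W2 : (\int[nu]_q (Normc.normc (k q.2) ^+ 2 * W q)%:E = ((2 * pi) ^+ n)%:E * N)%E.
Proof.
have m2 : measurable_fun setT (fun q => (Normc.normc (k q.2) ^+ 2 * W q)%:E).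
  apply/measurable_EFinP; apply: measurable_funM => //.
  exact: (measurableT_comp mk2 measurable_snd).
have f0 q : (0 <= (Normc.normc (k q.2) ^+ 2 * W q)%:E)%E by rewrite lee_fin mulr_ge0 ?sqr_ge0.
rewrite [LHS](fubini_tonelli2 (m1 := mu) (m2 := mu) _ m2 f0).
rewrite -ge0_integralZl_EFin ?ltW ?pi2n_gt0//; last by move=> x; exact: sqr_ge0.
apply: eq_integral => eta _; rewrite /fubini_G /= ge0_integralZl_EFin ?sqr_ge0//.
  have -> : (\int[mu]_xi (W (xi, eta))%:E = ((2 * pi) ^+ n)%:E)%E.
    by rewrite -(int_W eta); apply: eq_integral => xi _; rewrite /W diff_sym.
  by rewrite -EFinM mulrC.
exact: (measurable_fun_pair1 eta mW).
Qed.

(** The cutoff makes the triple integral in x, xi, eta absolutely convergent: its modulus is [gs x]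
    times the moduli of k(xi) and k(eta). Integrating x first produces [W]. *)
Let cutoff_fubini : cintegral mu (fun x => (Normc.normc (hat x) ^+ 2 * gs x)%:C) =
  cintegral nu (fun q => K q * (W q)%:C).
Proof.
pose F (z : Rn R n * (Rn R n * Rn R n)) : R[i] :=
  K z.2 * (fchar (diff z.2) z.1 * (gs z.1)%:C).
have mF : cmeasurable F.
  apply: cmeasurableM; first exact: (cmeasurable_snd _ (cintegrable_measurable iK)).
  apply: cmeasurableM.
    by apply: cmeasurable_fchar => //; exact: (measurableT_comp measurable_diff measurable_snd).
  apply: cmeasurable_real; exact: measurable_fun_gauss.
have nF z : Normc.normc (F z) = gs z.1 * Normc.normc (K z.2).
  rewrite Normc.normcM normcMreal ?expR_ge0// normc_fchar mul1r mulrC//.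
have iF : cintegrable (mu \x nu)%E F.
  apply: (cintegrable_le mF (integrable_prodM (integrable_gauss_Rn n a0) (integrable_normc iK))).
  by move=> z; rewrite nF.
have iFx x : cintegrable nu (fun q => F (x, q)).
  apply: (cintegrable_le _ (integrableZl_EFin (gs x) (integrable_normc iK))) => [|q].
    by have [m1 m2] := mF; split;
      [exact: (measurable_fun_pair2 x m1)|exact: (measurable_fun_pair2 x m2)].
  by rewrite nF.
have iFq q : cintegrable mu (fun x => F (x, q)).
  exact: (cintegrableZ (K q) (cintegrable_fchar_gauss (diff q) a0)).
transitivity (cintegral mu (fun x => cintegral nu (fun q => F (x, q)))).
  congr cintegral; apply/funext => x; rewrite rmorphM /= hat_sqr mulrC -cintegralZ.
    by congr cintegral; apply/funext => q; rewrite /F /=; ring.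
  apply: (cintegrable_le _ (integrable_normc iK)) => [|q].
    apply: cmeasurableM; first exact: (cintegrable_measurable iK).
    exact: cmeasurable_fchar.
  by rewrite Normc.normcM normc_fchar mulr1.
rewrite (cintegral12 iF iFx) -(cintegral21 iF iFq).
congr cintegral; apply/funext => q; rewrite /F /= cintegralZ.
  by congr (_ * _); rewrite fourier_gauss.
exact: cintegrable_fchar_gauss.
Qed.

Lemma measurable_hat : cmeasurable hat.
Proof.
apply: (cmeasurable_cintegral_fst (T1 := Rn R n) mu
  (f := fun p : Rn R n * Rn R n => k p.1 * fchar p.2 p.1)).
apply: cmeasurableM; first exact: cmeasurable_fst.
exact: cmeasurable_fchar.
Qed.

(** Schur's test: the modulus of k(xi) conj k(eta) is at most half the sum of the two squares, and
    both marginals of [W] are (2 pi)^n. The bound is therefore uniform in the cutoff; [N] is allowed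
    to be infinite. *)
Lemma hat_cutoff_le : (\int[mu]_x (Normc.normc (hat x) ^+ 2 * gs x)%:E
  <= ((2 * pi) ^+ n)%:E * N)%E.
Proof.
(* Since [k] is integrable, [hat] is bounded; the left side is thus finite and can be compared with
   a real integral. *)
pose M := \int[mu]_x Normc.normc (k x).
have hatM x : Normc.normc (hat x) <= 2 * M.
  apply: normc_cintegral_le => //.
  by under eq_Rintegral do rewrite Normc.normcM normc_fchar mulr1.
have mh2 : measurable_fun setT (fun x => Normc.normc (hat x) ^+ 2).
  by apply: measurable_funX; apply: measurable_normc; exact: measurable_hat.
have ih : mu.-integrable setT (EFin \o (fun x => Normc.normc (hat x) ^+ 2 * gs x)).
  apply: (@le_integrable _ _ _ mu setT measurableT _ (EFin \o (fun x => (2 * M) ^+ 2 * gs x))).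
  - apply/measurable_EFinP; apply: measurable_funM => //; exact: measurable_gauss.
  - move=> x _; rewrite /= lee_fin !ger0_norm; last 2 first.
    + by rewrite mulr_ge0 ?sqr_ge0 ?expR_ge0.
    + by rewrite mulr_ge0 ?sqr_ge0 ?expR_ge0.
    have hx := normc_ge0 (hat x); rewrite ler_wpM2r ?expR_ge0// !expr2.
    exact: (ler_pM hx hx (hatM x) (hatM x)).
  - by apply: integrableZl_EFin; exact: integrable_gauss_Rn.
rewrite -(@fineK _ (\int[mu]_x _)%E); last exact: (integrable_fin_num _ ih).
have -> : fine (\int[mu]_x (Normc.normc (hat x) ^+ 2 * gs x)%:E) =
    complex.Re (cintegral nu (fun q => K q * (W q)%:C)).
  by rewrite -cutoff_fubini cintegral_real.
have mKW : cmeasurable (fun q => K q * (W q)%:C).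
  apply: cmeasurableM; first exact: (cintegrable_measurable iK).
  exact: cmeasurable_real.
have iKW : cintegrable nu (fun q => K q * (W q)%:C).
  apply: (cintegrable_le mKW (integrableZl_EFin (Num.sqrt (pi / a) ^+ n) (integrable_normc iK))).
  move=> q; rewrite normcMreal// mulrC ler_wpM2r ?normc_ge0//.
  rewrite -[leRHS]mulr1 ler_wpM2l ?exprn_ge0 ?sqrtr_ge0//.
  rewrite -expR0 ler_expR oppr_le0; apply: mulr_ge0; first exact: ltW.
  by rewrite -sqnorm_real; exact: sqnorm_ge0.
rewrite /cintegral /= /Rintegral fineK; last first.
  by have [i1 _] := iKW; exact: (integrable_fin_num _ i1).
apply: (@le_trans _ _ (\int[nu]_q (Normc.normc (K q * (W q)%:C))%:E)%E).
  have [i1 _] := iKW; apply: le_integral => //; first exact: integrable_normc.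
  by move=> q _; rewrite lee_fin; apply: le_trans (ler_norm _) (normr_Re_le _).
have mA : measurable_fun setT (fun q => 2^-1 * (Normc.normc (k q.1) ^+ 2 * W q)).
  apply: measurable_funM => //; apply: measurable_funM => //.
  exact: (measurableT_comp mk2 measurable_fst).
have mB : measurable_fun setT (fun q => 2^-1 * (Normc.normc (k q.2) ^+ 2 * W q)).
  apply: measurable_funM => //; apply: measurable_funM => //.
  exact: (measurableT_comp mk2 measurable_snd).
apply: (@le_trans _ _ (\int[nu]_q ((2^-1 * (Normc.normc (k q.1) ^+ 2 * W q))%:E +
   (2^-1 * (Normc.normc (k q.2) ^+ 2 * W q))%:E))%E).
  apply: ge0_le_integral => //.
  - by move=> q _; rewrite lee_fin normc_ge0.
  - by apply/measurable_EFinP; exact: measurable_normc.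
  - by apply: emeasurable_funD; exact/measurable_EFinP.
  - move=> q _; rewrite -EFinD lee_fin normcMreal// /K Normc.normcM normc_conj.
    rewrite -mulrDr -mulrDl mulrA ler_wpM2r//.
    by have := sqr_ge0 (Normc.normc (k q.1) - Normc.normc (k q.2)); rewrite sqrrB; lra.
rewrite ge0_integralD//; last 4 first.
- by move=> q _; rewrite lee_fin mulr_ge0// mulr_ge0 ?sqr_ge0.
- exact/measurable_EFinP.
- by move=> q _; rewrite lee_fin mulr_ge0// mulr_ge0 ?sqr_ge0.
- exact/measurable_EFinP.
have h2 : 0 <= 2^-1 :> R by rewrite invr_ge0.
rewrite !ge0_integralZl_EFin//; last 4 first.
- apply: measurable_funM => //; exact: (measurableT_comp mk2 measurable_snd).
- by move=> q; rewrite mulr_ge0 ?sqr_ge0.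
- apply: measurable_funM => //; exact: (measurableT_comp mk2 measurable_fst).
- by move=> q; rewrite mulr_ge0 ?sqr_ge0.
rewrite int_W1 int_W2 -ge0_muleDl ?lee_fin// -EFinD.
by rewrite (_ : 2^-1 + 2^-1 = 1) ?mul1e//; field.
Qed.

End cutoff.

Lemma plancherel_le : (\int[mu]_x (Normc.normc (hat x) ^+ 2)%:E <=
  ((2 * pi) ^+ n)%:E * \int[mu]_xi (Normc.normc (k xi) ^+ 2)%:E)%E.
Proof.
apply: integral_le_gauss_cutoff.
- by apply: measurable_funX; apply: measurable_normc; exact: measurable_hat.
- by move=> x; exact: sqr_ge0.
- by move=> a a0; exact: hat_cutoff_le.
Qed.

End plancherel.

(** * Sufficiency *)

Section gauss_bargmann_bound.
Context (R : realType) (n : nat).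
Local Notation mu := (lebesgue_Rn R n).
Local Notation nu := (lebesgue_Cn R n).
Implicit Types (x y xi : Rn R n).

Let shift xi y : Rn R n := affinet xi 2^-1 y.

Variable h : Rn R n -> R[i].
Hypothesis mh : cmeasurable h.
(** On the slice Im z = y the kernel e^{i z . xi - |xi|^2} equals e^{i x . xi} e^{-|xi + y/2|^2}
    e^{|y|^2/4}, so the transform restricted to the slice is an explicit factor times the Fourier
    transform of [k y]. *)
Let k y xi : R[i] := h xi * (expR (- (1 * rdot (shift xi y) (shift xi y))))%:C.
Hypothesis ik : forall y, cintegrable mu (k y).
Hypothesis entire_h : entire (gauss_bargmann h).

Let gauss_bargmannE x y : gauss_bargmann h (Cn_of (x, y)) =
  cexp (cdot (Cn_of (x, y)) (Cn_of (x, y)) / 4 + (4^-1 * rdot y y)%:C) * hat (k y) x.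
Proof.
rewrite /gauss_bargmann cexpD -mulrA; congr (_ * _).
have ikf : cintegrable mu (fun xi => k y xi * fchar x xi).
  apply: (cintegrable_le _ (integrable_normc (ik y))) => [|xi].
    apply: cmeasurableM; first exact: (cintegrable_measurable (ik y)).
    exact: cmeasurable_fchar.
  by rewrite Normc.normcM normc_fchar mulr1.
rewrite /hat -cintegralZ//; congr cintegral; apply/funext => xi.
rewrite /k /fchar -!cexp_real -[LHS]mulrA -[X in _ = _ * X]mulrA [RHS]mulrCA -!cexpD.
congr (_ * cexp _).
rewrite sqnorm_real Cn_ofE /= cdotDl cdotZl !cdot_real.
rewrite /shift !(rdot_affinetl, rdot_affinetr) (rdotC y xi).
apply: complex_ReIm_ext; rewrite !(ReDc, ImDc, ReNc, ImNc, ReMc, ImMc) /=; by field.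
Qed.

Let normc_gauss_bargmann x y :
  Normc.normc (gauss_bargmann h (Cn_of (x, y))) ^+ 2 * gaussC 2^-1 (x, y) =
  expR (- (2^-1 * rdot y y)) * Normc.normc (hat (k y) x) ^+ 2.
Proof.
rewrite gauss_bargmannE Normc.normcM normc_cexp exprMn mulrC mulrA.
congr (_ * _); rewrite /gaussC expr2 -!expRD; congr expR.
rewrite (_ : cdot _ _ / 4 = cdot (Cn_of (x, y)) (Cn_of (x, y)) * (4^-1)%:C); last first.
  by rewrite fmorphV rmorph_nat.
rewrite ReDc ReMreal Cn_ofE /= cdotDl !cdotDr !cdotZl !cdotZr !cdot_real.
by rewrite !(ReDc, ReMc, ImMc) /=; field.
Qed.

(** Plancherel's inequality in x on each slice, then integration over y. Its factor (2 pi)^n is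
    cancelled by the normalisation of the Fock weight. *)
Lemma gauss_bargmann_bound : (fock_sqnorm (gauss_bargmann h) <=
  (Num.sqrt pi ^+ n)%:E *
  \int[mu]_xi (Normc.normc (h xi) ^+ 2 * expR (- (1 * rdot xi xi)))%:E)%E.
Proof.
rewrite fock_sqnormE//.
have c0 : 0 < (2 * pi) ^+ n :> R by exact: pi2n_gt0.
rewrite -(@lee_pmul2l _ ((2 * pi) ^+ n)%:E)// muleA -EFinM mulfV ?gt_eqF// mul1e.
have mG := measurable_sqnormc_gauss 2^-1 entire_h.
have mGE : measurable_fun setT (fun p =>
  (Normc.normc (gauss_bargmann h (Cn_of p)) ^+ 2 * gaussC 2^-1 p)%:E) by exact/measurable_EFinP.
have G0 p : (0 <= (Normc.normc (gauss_bargmann h (Cn_of p)) ^+ 2 * gaussC 2^-1 p)%:E)%E.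
  by rewrite lee_fin mulr_ge0 ?sqr_ge0 ?gaussC_ge0.
rewrite [leLHS](fubini_tonelli2 (m1 := mu) (m2 := mu) _ mGE G0).
(* This is e^{-|y|^2/2} times the square of |k_y(xi)|, the exponent |y|^2/2 + 2|xi + y/2|^2 being
   regrouped as |xi|^2 + |xi + y|^2. The y-integral is then pi^{n/2} for every xi. *)
pose P p : R := Normc.normc (h p.1) ^+ 2 * expR (- (1 * rdot p.1 p.1)) *
  expR (- (1 * rdot (affinet p.1 1 p.2) (affinet p.1 1 p.2))).
have PE xi y : P (xi, y) = expR (- (2^-1 * rdot y y)) * Normc.normc (k y xi) ^+ 2.
  rewrite /P /k /= normcMreal ?expR_ge0// exprMn [RHS]mulrCA -mulrA; congr (_ * _).
  rewrite expr2 -!expRD; congr expR.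
  rewrite /shift !(rdot_affinetl, rdot_affinetr) (rdotC y xi).
  by field.
have P0 p : 0 <= P p.
  by apply: mulr_ge0; [apply: mulr_ge0; [exact: sqr_ge0|exact: expR_ge0]|exact: expR_ge0].
have mnh : measurable_fun setT (fun xi => Normc.normc (h xi) ^+ 2).
  by apply: measurable_funX; exact: measurable_normc.
have mP : measurable_fun setT P.
  apply: measurable_funM; first apply: measurable_funM.
  - exact: (measurableT_comp mnh measurable_fst).
  - exact: measurable_fun_gauss.
  - by apply: measurable_fun_gauss; exact: measurable_fun_affinet.
have mPE : measurable_fun setT (EFin \o P) by exact/measurable_EFinP.
have P0E p : (0 <= (EFin \o P) p)%E by rewrite lee_fin.
apply: (@le_trans _ _ (\int[mu]_y (((2 * pi) ^+ n)%:E * \int[mu]_xi (P (xi, y))%:E))%E).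
  apply: ge0_le_integral => //.
  - by move=> y _; apply: integral_ge0 => x _; exact: G0.
  - exact: (measurable_fun_fubini_tonelli_G _ mGE G0).
  - apply: emeasurable_funM; first exact: measurable_cst.
    exact: (measurable_fun_fubini_tonelli_G _ mPE P0E).
  move=> y _; rewrite /fubini_G /=.
  under eq_integral do rewrite normc_gauss_bargmann.
  rewrite ge0_integralZl_EFin ?expR_ge0//; last 2 first.
  - by apply: measurable_funX; apply: measurable_normc; exact: measurable_hat.
  - by move=> x; exact: sqr_ge0.
  under [in leRHS]eq_integral do rewrite PE.
  rewrite ge0_integralZl_EFin ?expR_ge0//; last 2 first.
  - apply: measurable_funX; apply: measurable_normc.
    exact: (cintegrable_measurable (ik y)).
  - by move=> x; exact: sqr_ge0.
  rewrite [leRHS]muleCA; apply: lee_wpmul2l; first by rewrite lee_fin expR_ge0.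
  exact: plancherel_le.
rewrite ge0_integralZl//; last 3 first.
- exact: (measurable_fun_fubini_tonelli_G _ mPE P0E).
- by move=> y _; apply: integral_ge0 => x _; exact: P0E.
- by rewrite lee_fin ltW.
apply: lee_wpmul2l; first by rewrite lee_fin ltW.
have -> : (\int[mu]_y \int[mu]_xi (P (xi, y))%:E = \int[mu]_xi \int[mu]_y (P (xi, y))%:E)%E.
  exact: (esym (fubini_tonelli (m1 := mu) (m2 := mu) _ mPE P0E)).
rewrite -ge0_integralZl_EFin ?exprn_ge0 ?sqrtr_ge0//; last 2 first.
- by apply: measurable_funM => //; exact: measurable_fun_gauss.
- by move=> xi; rewrite mulr_ge0 ?sqr_ge0 ?expR_ge0.
rewrite le_eqVlt; apply/orP; left; apply/eqP; apply: eq_integral => xi _.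
have q0 : 0 <= Normc.normc (h xi) ^+ 2 * expR (- (1 * rdot xi xi)).
  by apply: mulr_ge0; [exact: sqr_ge0|exact: expR_ge0].
rewrite /P /= ge0_integralZl_EFin//; last first.
  by apply: measurable_fun_gauss; exact: measurable_fun_affinet.
have [_ _ H] := change_var_affinet xi (oner_neq0 R).
have {}H : (\int[mu]_y (expR (- (1 * rdot (affinet xi 1 y) (affinet xi 1 y))))%:E =
    (`|1| ^- n)%:E * \int[mu]_x (expR (- (1 * rdot x x)))%:E)%E.
  apply: (H (fun x => (expR (- (1 * rdot x x)))%:E)).
    by apply/measurable_EFinP; exact: measurable_fun_gauss.
  by move=> x; rewrite lee_fin expR_ge0.
by rewrite H normr1 expr1n invr1 mul1e integral_gauss_Rn// divr1 -EFinM mulrC.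
Qed.

End gauss_bargmann_bound.

(** * Gram matrices and spans of exponentials *)

Section gram.
Context d (T : measurableType d) (R : realType) (m : {measure set T -> \bar R}).
Variables (W : T -> R) (k : nat) (c : 'I_k -> R[i]) (f : 'I_k -> T -> R[i]).
Hypothesis fi : forall i j, cintegrable m (fun x => f i x * conjc (f j x) * (W x)%:C).

Lemma gram_integral :
  (\int[m]_x (Normc.normc (\sum_(i < k) c i * f i x) ^+ 2 * W x)%:E)%E =
  (complex.Re (\sum_(i < k) \sum_(j < k)
     (c i * conjc (c j) * cintegral m (fun x => f i x * conjc (f j x) * (W x)%:C))))%:E.
Proof.
pose G x := \sum_(i < k) \sum_(j < k) (c i * conjc (c j)) * (f i x * conjc (f j x) * (W x)%:C).
have E x : (Normc.normc (\sum_(i < k) c i * f i x) ^+ 2 * W x)%:C = G x.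
  rewrite rmorphM /= (_ : (Normc.normc _ ^+ 2)%:C = (\sum_(i < k) c i * f i x) *
    conjc (\sum_(i < k) c i * f i x)); last first.
    rewrite sqr_normc_ReIm; case: (\sum_(i < k) _) => u v.
    by apply: complex_ReIm_ext => /=; ring.
  rewrite conjc_sum mulr_suml mulr_suml; apply: eq_bigr => i _.
  rewrite mulr_sumr mulr_suml; apply: eq_bigr => j _.
  by rewrite conjcM; ring.
have iG : cintegrable m G.
  by apply: cintegrable_sum => i; apply: cintegrable_sum => j; exact: cintegrableZ.
have GE : cintegral m G = \sum_(i < k) \sum_(j < k)
     (c i * conjc (c j) * cintegral m (fun x => f i x * conjc (f j x) * (W x)%:C)).
  rewrite cintegral_sum; last by move=> i; apply: cintegrable_sum => j; exact: cintegrableZ.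
  apply: eq_bigr => i _; rewrite cintegral_sum; last by move=> j; exact: cintegrableZ.
  by apply: eq_bigr => j _; rewrite cintegralZ.
rewrite -GE /= /Rintegral fineK; last by have [i1 _] := iG; exact: (integrable_fin_num _ i1).
by apply: eq_integral => x _; rewrite -E.
Qed.

End gram.

Section exponential_span.
Context (R : realType) (n : nat).
Local Notation mu := (lebesgue_Rn R n).
Local Notation nu := (lebesgue_Cn R n).
Implicit Types (x y xi : Rn R n) (z w a b zeta : Cn R n).

Let gs xi : R := expR (- (1 * rdot xi xi)).

Let cexp_gauss_shift zeta : exists q S (C : R[i]),
  [/\ change_var mu mu S 1, C = cexp (cdot zeta zeta / 4 + (4^-1 * rdot q q)%:C) &
   forall xi, cexp (cdot zeta (Rn_Cn xi)) * (gs xi)%:C =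
     C * (fchar q (S xi) * (gs (S xi))%:C)].
Proof.
pose p := Cn_coord zeta; pose S := affinet (affinet (tuple0 R n) (- 2^-1) p.1) 1.
exists p.2, S, (cexp (cdot zeta zeta / 4 + (4^-1 * rdot p.2 p.2)%:C)); split => //.
  exact: change_var_translate.
move=> xi; rewrite /gs /fchar -!cexp_real -!cexpD; congr cexp.
rewrite -[in LHS](Cn_coordK zeta) -[in RHS](Cn_coordK zeta) -/p Cn_ofE.
rewrite !(cdotDl, cdotDr, cdotZl, cdotZr) !cdot_real /S.
rewrite !(rdot_affinetl, rdot_affinetr) !rdot0l !rdot0r (rdotC p.2 p.1) (rdotC xi p.1).
apply: complex_ReIm_ext; rewrite !(ReDc, ImDc, ReNc, ImNc, ReMc, ImMc) /=; by field.
Qed.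

Lemma cintegrable_cexp_gauss zeta :
  cintegrable mu (fun xi => cexp (cdot zeta (Rn_Cn xi)) * (gs xi)%:C).
Proof.
have [q [S [C [cS _ E]]]] := cexp_gauss_shift zeta.
rewrite (_ : (fun xi => _) = fun xi => C * (fchar q (S xi) * (gs (S xi))%:C)); last first.
  by apply/funext => xi; exact: E.
apply: cintegrableZ.
exact: (change_var_cintegrable cS (cintegrable_fchar_gauss q ltr01)).
Qed.

Lemma cintegral_cexp_gauss zeta :
  cintegral mu (fun xi => cexp (cdot zeta (Rn_Cn xi)) * (gs xi)%:C) =
  (Num.sqrt pi ^+ n)%:C * cexp (cdot zeta zeta / 4).
Proof.
have [q [S [C [cS CE E]]]] := cexp_gauss_shift zeta.
rewrite (_ : (fun xi => _) = fun xi => C * (fchar q (S xi) * (gs (S xi))%:C)); last first.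
  by apply/funext => xi; exact: E.
have iq := cintegrable_fchar_gauss q (@ltr01 R).
rewrite cintegralZ; last exact: (change_var_cintegrable cS iq).
rewrite (change_var_cintegral cS iq) fourier_gauss// rmorph1 mul1r divr1 mulr1 CE.
set e := expR _; have -> : (Num.sqrt pi ^+ n * e)%:C = (Num.sqrt pi ^+ n)%:C * e%:C :> R[i].
  by rewrite rmorphM.
rewrite [LHS]mulrCA /e; congr (_ * _); rewrite -cexp_real -cexpD; congr cexp.
by rewrite -addrA -rmorphD /= addrN rmorph0 addr0.
Qed.

(* the conjugate of the Gauss-Bargmann kernel at [a]; its transform is a
   multiple of [kexp a] *)
Definition bexp a xi : R[i] :=
  cexp (cdot (- 'i%C *: conjv a) (Rn_Cn xi) + cdot (conjv a) (conjv a) / 4).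

Let bexp_gram a b : (fun xi => bexp a xi * conjc (bexp b xi) * (gs xi)%:C) =
  fun xi => cexp ((cdot (conjv a) (conjv a) + cdot b b) / 4) *
    (cexp (cdot ('i%C *: (b - conjv a)) (Rn_Cn xi)) * (gs xi)%:C).
Proof.
apply/funext => xi; rewrite mulrA; congr (_ * _).
have -> : conjc (bexp b xi) = cexp (cdot ('i%C *: b) (Rn_Cn xi) + cdot b b / 4).
  rewrite /bexp conjc_cexp; congr cexp.
  rewrite -[LHS]/(conjc (_ + _)) (rmorphD (@conjc R)) /=; congr (_ + _).
    rewrite -[LHS]/(conjc (cdot _ _)) cdot_conj conjvZ conjv_real conjvK; congr (cdot (_ *: _) _).
    by apply: complex_ReIm_ext => /=; ring.
  rewrite conjcM -[conjc (cdot _ _)]/((cdot _ _)^*) cdot_conj !conjvK; congr (_ * _).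
  by rewrite (fmorphV (@conjc R)) rmorph_nat.
rewrite /bexp -!cexpD; congr cexp; rewrite !cdotZl cdotDl cdotNl.
by field.
Qed.

Lemma cintegrable_bexp a b :
  cintegrable mu (fun xi => bexp a xi * conjc (bexp b xi) * (gs xi)%:C).
Proof. by rewrite bexp_gram; apply: cintegrableZ; exact: cintegrable_cexp_gauss. Qed.

(** The entry is pi^{n/2} [kexp a b], the value of the reproducing kernel; hence the common Gram
    matrix. *)
Lemma cintegral_bexp a b :
  cintegral mu (fun xi => bexp a xi * conjc (bexp b xi) * (gs xi)%:C) =
  (Num.sqrt pi ^+ n)%:C * cexp (cdot b (conjv a) / 2).
Proof.
rewrite bexp_gram cintegralZ; last exact: cintegrable_cexp_gauss.
rewrite cintegral_cexp_gauss mulrCA -cexpD; congr (_ * cexp _).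
rewrite cdotZl cdotZr !(cdotDl, cdotDr, cdotNl, cdotNr) (cdotC (conjv a) b).
have ii : 'i%C * 'i%C = -1 :> R[i] by rewrite -expr2 sqr_i.
by rewrite [X in _ + X / 4]mulrA ii; field.
Qed.

(** Inner products of exponentials are the case phi = 1 of [S_kernel], which is the reproducing
    property. *)
Let kexp_S_integrand a b : (fun p : Rn R n * Rn R n =>
    kexp a (Cn_of p) * conjc (kexp b (Cn_of p)) * (w0 (Cn_of p))%:C) =
  S_integrand (fun=> 1) a b.
Proof.
apply/funext => p; rewrite /S_integrand mulr1; congr (_ * _ * _).
rewrite /kexp conjc_cexp; congr cexp.
rewrite -[LHS]/(conjc (_ * _)) conjcM -[conjc (cdot _ _)]/((cdot _ _)^*) cdot_conj conjvK cdotC.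
by congr (_ * _); rewrite (fmorphV (@conjc R)) rmorph_nat.
Qed.

Variables (k : nat) (c : 'I_k -> R[i]) (a : 'I_k -> Cn R n).

Let F w : R[i] := \sum_(i < k) c i * kexp (a i) w.
Let g xi : R[i] := \sum_(i < k) c i * bexp (a i) xi.

Let fock1 : fock (fun _ : Cn R n => 1 : R[i]). Proof. exact: fock_cst. Qed.

Lemma fock_sqnorm_span : fock_sqnorm F = (complex.Re (\sum_(i < k) \sum_(j < k)
  (c i * conjc (c j) * cexp (cdot (a j) (conjv (a i)) / 2))))%:E.
Proof.
rewrite /fock_sqnorm (gram_integral (W := fun p => w0 (Cn_of p)) c
  (f := fun i p => kexp (a i) (Cn_of p))).
  congr (complex.Re _)%:E; apply: eq_bigr => i _; apply: eq_bigr => j _.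
  rewrite kexp_S_integrand; have [_ ->] := S_kernel (a i) (a j) fock1.
  by rewrite mul1r.
by move=> i j; rewrite kexp_S_integrand; have [] := S_kernel (a i) (a j) fock1.
Qed.

Lemma bexp_span_norm : (\int[mu]_xi (Normc.normc (g xi) ^+ 2 * gs xi)%:E =
  (Num.sqrt pi ^+ n)%:E * fock_sqnorm F)%E.
Proof.
rewrite (gram_integral (W := gs) c (f := fun i => bexp (a i))); last first.
  by move=> i j; exact: cintegrable_bexp.
rewrite fock_sqnorm_span -EFinM; congr EFin.
rewrite mulrC -ReMreal; congr complex.Re; rewrite mulr_suml; apply: eq_bigr => i _.
rewrite mulr_suml; apply: eq_bigr => j _; rewrite cintegral_bexp; ring.
Qed.

Variables (m : Rn R n -> R[i]) (B : R).
Hypothesis mm : cmeasurable m.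
Hypothesis mB : forall xi, Normc.normc (m xi) <= B.
Hypothesis fock_m : fock (gauss_bargmann m).

Let cintegrable_symbolM (f : Rn R n -> R[i]) : cintegrable mu f ->
  cintegrable mu (fun xi => m xi * f xi).
Proof.
move=> fi; apply: (cintegrable_le _ (integrableZl_EFin B (integrable_normc fi))) => [|xi].
  exact: (cmeasurableM mm (cintegrable_measurable fi)).
by rewrite Normc.normcM; apply: ler_pM (lexx _); rewrite ?mB//; exact: normc_ge0.
Qed.

Let h xi : R[i] := m xi * g xi.

(** It rests on (z - conj a)^2/4 + z . conj a / 2 = z^2/4 + (conj a)^2/4: the factor of [S_op] on an
    exponential removes the cross term of the Gaussian prefactor, so that what is left under the
    integral is [bexp a] times the kernel at z. *)
Let S_op_gauss_bargmann : S_op (gauss_bargmann m) F = gauss_bargmann h.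
Proof.
apply/funext => z; rewrite S_op_span//.
have E i : gauss_bargmann m (z - conjv (a i)) * cexp (cdot z (conjv (a i)) / 2) =
    cexp (cdot z z / 4) * cintegral mu (fun xi =>
      m xi * (bexp (a i) xi * (cexp (cdot ('i%C *: z) (Rn_Cn xi)) * (gs xi)%:C))).
  rewrite /gauss_bargmann [LHS]mulrAC -cexpD.
  have -> : cdot (z - conjv (a i)) (z - conjv (a i)) / 4 + cdot z (conjv (a i)) / 2 =
      cdot z z / 4 + cdot (conjv (a i)) (conjv (a i)) / 4.
    by rewrite !(cdotDl, cdotDr, cdotNl, cdotNr) (cdotC (conjv (a i)) z); field.
  rewrite cexpD -mulrA; congr (_ * _); rewrite -cintegralZ; last first.
    have := cintegrable_symbolM (cintegrable_cexp_gauss ('i%C *: (z - conjv (a i)))).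
    congr cintegrable; apply/funext => xi.
    by rewrite mulrA cdotZl /gs mul1r sqnorm_real.
  congr cintegral; apply/funext => xi.
  rewrite -[X in _ * X = _]mulrA [LHS]mulrCA; congr (_ * _).
  rewrite /gs mul1r sqnorm_real [LHS]mulrA [RHS]mulrA /bexp -!cexpD; congr (cexp _ * _).
  by rewrite !cdotZl cdotDl cdotNl; ring.
under eq_bigr do rewrite E mulrCA.
rewrite -mulr_sumr /gauss_bargmann; congr (_ * _).
have iE i : cintegrable mu (fun xi =>
      m xi * (bexp (a i) xi * (cexp (cdot ('i%C *: z) (Rn_Cn xi)) * (gs xi)%:C))).
  apply: cintegrable_symbolM.
  have := cintegrableZ (cexp (cdot (conjv (a i)) (conjv (a i)) / 4))
    (cintegrable_cexp_gauss ('i%C *: z - 'i%C *: conjv (a i))).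
  congr cintegrable; apply/funext => xi.
  rewrite [LHS]mulrA [RHS]mulrA /bexp -!cexpD; congr (cexp _ * _).
  by rewrite !(cdotDl, cdotNl, cdotZl); ring.
under eq_bigr do rewrite -cintegralZ//.
rewrite -cintegral_sum; last by move=> i; exact: cintegrableZ.
congr cintegral; apply/funext => xi; rewrite /h /g -[RHS]mulrA mulr_sumr mulr_suml.
apply: eq_bigr => i _; rewrite /gs mul1r sqnorm_real cdotZl.
move: (cexp _) (bexp _ _) => e1 e2; ring.
Qed.

(** The formula on spans exhibits a finite sum of products of entire functions; through
    [S_op_gauss_bargmann] this also makes the transform of [h] entire, as [gauss_bargmann_bound]
    requires. *)
Let entire_S_op : entire (S_op (gauss_bargmann m) F).
Proof.
have [dm _] := fock_m.
rewrite (_ : S_op _ _ = fun z => \sum_(i < k) c i *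
    (gauss_bargmann m (z - conjv (a i)) * kexp (a i) z)); last first.
  by apply/funext => z; rewrite S_op_span.
apply: entire_sum => i; apply: entireM; first exact: entire_cst.
by apply: entireM; [exact: entire_translate|exact: entire_kexp].
Qed.

Let B0 : 0 <= B.
Proof. exact: le_trans (normc_ge0 _) (mB (tuple0 R n)). Qed.

(** One factor pi^{n/2} comes from the bound on the transform, another from [bexp_span_norm], and
    [B ^+ 2] from the multiplier. *)
Lemma S_op_span_bound : (fock_sqnorm (S_op (gauss_bargmann m) F) <=
  ((Num.sqrt pi ^+ n * B) ^+ 2)%:E * fock_sqnorm F)%E.
Proof.
have dh := entire_S_op; rewrite S_op_gauss_bargmann in dh *.
have mg : cmeasurable g.
  apply: cmeasurable_sum => i; apply: cmeasurableM; first exact: cmeasurable_cst.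
  apply: cmeasurable_cexp; apply: cmeasurableD; last exact: cmeasurable_cst.
  rewrite /cdot; apply: cmeasurable_sum => j.
  apply: cmeasurableM; first exact: cmeasurable_cst.
  under eq_fun do rewrite mxE.
  by apply: cmeasurable_real; exact: measurable_tnth.
have mh : cmeasurable h by exact: cmeasurableM.
have s0 : 0 <= Num.sqrt pi ^+ n :> R by rewrite exprn_ge0 ?sqrtr_ge0.
apply: le_trans (gauss_bargmann_bound mh _ dh) _.
  (* Expanding |xi + y/2|^2 turns each summand into a constant times an exponential with a new
     linear term times the centred Gaussian. *)
  move=> y; rewrite (_ : (fun xi => _) = fun xi => m xi * \sum_(i < k) c i *
    (cexp (cdot (conjv (a i)) (conjv (a i)) / 4 - (4^-1 * rdot y y)%:C) *
     (cexp (cdot (- 'i%C *: conjv (a i) - Rn_Cn y) (Rn_Cn xi)) * (gs xi)%:C))).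
    apply: cintegrable_symbolM; apply: cintegrable_sum => i; do 2 apply: cintegrableZ.
    exact: cintegrable_cexp_gauss.
  apply/funext => xi; rewrite /h -mulrA; congr (_ * _).
  rewrite /g mulr_suml; apply: eq_bigr => i _; rewrite -[LHS]mulrA; congr (_ * _).
  rewrite /bexp /gs -!cexp_real -!cexpD; congr cexp.
  rewrite cdotDl cdotNl cdot_real !(rdot_affinetl, rdot_affinetr) (rdotC y xi).
  rewrite -!addrA addrCA; congr (_ + _); rewrite [RHS]addrCA; congr (_ + _).
  by apply: complex_ReIm_ext => /=; field.
have -> : ((Num.sqrt pi ^+ n * B) ^+ 2)%:E = ((Num.sqrt pi ^+ n)%:E * (B ^+ 2)%:E *
    (Num.sqrt pi ^+ n)%:E)%E :> \bar R.
  by rewrite -!EFinM; congr EFin; ring.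
rewrite -!muleA -bexp_span_norm; apply: lee_wpmul2l; first by rewrite lee_fin.
have mg2 : measurable_fun setT (fun xi => Normc.normc (g xi) ^+ 2 * gs xi).
  apply: measurable_funM; last exact: measurable_fun_gauss.
  by apply: measurable_funX; exact: measurable_normc.
rewrite -ge0_integralZl_EFin ?sqr_ge0//; last first.
  by move=> xi; apply: mulr_ge0; [exact: sqr_ge0|exact: expR_ge0].
apply: ge0_le_integral => //.
- by move=> xi _; rewrite lee_fin; apply: mulr_ge0; [exact: sqr_ge0|exact: expR_ge0].
- apply/measurable_EFinP; apply: measurable_funM; last exact: measurable_fun_gauss.
  by apply: measurable_funX; exact: measurable_normc.
- by apply/measurable_EFinP; exact: measurable_funM.
move=> xi _; rewrite lee_fin mulrA; apply: ler_wpM2r; first exact: expR_ge0.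
rewrite /h Normc.normcM exprMn; apply: ler_wpM2r; first exact: sqr_ge0.
have m0 := normc_ge0 (m xi); rewrite !expr2.
exact: (ler_pM m0 m0 (mB xi) (mB xi)).
Qed.

Lemma S_op_span_bounded : fock (S_op (gauss_bargmann m) F) /\
  fock_norm (S_op (gauss_bargmann m) F) <= Num.sqrt pi ^+ n * B * fock_norm F.
Proof.
have C0 : 0 <= Num.sqrt pi ^+ n * B by rewrite mulr_ge0 ?exprn_ge0 ?sqrtr_ge0.
have bd := S_op_span_bound; move: bd; rewrite fock_sqnorm_span.
set r := complex.Re _ => bd.
have Foo : (fock_sqnorm (S_op (gauss_bargmann m) F) < +oo)%E.
  by apply: le_lt_trans bd _; rewrite -EFinM ltry.
split; first by split => //; exact: entire_S_op.
have nn (G : Cn R n -> R[i]) : (0 <= fock_sqnorm G)%E.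
  apply: integral_ge0 => p _; rewrite lee_fin w0_gaussC mulr_ge0 ?sqr_ge0//.
  by rewrite mulr_ge0 ?gaussC_ge0// invr_ge0 ltW// pi2n_gt0.
have r0 : 0 <= r by rewrite -lee_fin -/r -fock_sqnorm_span nn.
rewrite /fock_norm fock_sqnorm_span /= -/r.
rewrite -[X in X * _](ger0_norm C0) -sqrtr_sqr -sqrtrM ?sqr_ge0//.
rewrite ler_wsqrtr// -lee_fin fineK ?EFinM//.
by rewrite ge0_fin_numE.
Qed.

End exponential_span.

Theorem theorem1p1 (R : realType) (n : nat) (hn : (0 < n)%N)
    (phi : Cn R n -> R[i]) (hphi : fock phi) :
  let sup_sq_int :=
    ereal_sup (range (fun a : Rn R n =>
      (\int[lebesgue_Cn R n]_p
        (Normc.normc (phi (Cn_of p + 'i%C *: Rn_Cn a)) ^+ 2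
         * expR (- (sqnorm (Cn_of p) / 2)))%:E)%E)) in
  (S_bounded phi ->
     (sup_sq_int < +oo)%E /\
     (forall x : Rn R n,
        (ereal_sup (range (fun y : Rn R n =>
           (Normc.normc (phi (Rn_Cn x + 'i%C *: Rn_Cn y))
            * expR (- (sqnorm (Rn_Cn x) / 4)))%:E)) < +oo)%E))
  /\
  ((sup_sq_int < +oo)%E ->
   (ereal_sup (range (fun y : Rn R n =>
      (\int[lebesgue_Rn R n]_x
         (Normc.normc (phi (Rn_Cn x + 'i%C *: Rn_Cn y))
          * expR (- (sqnorm (Rn_Cn x) / 4)))%:E)%E)) < +oo)%E ->
   (exists m : Rn R n -> R[i],
      Linfty m /\ phi = gauss_bargmann m)
   /\ S_bounded phi).
Proof.
move=> sup_sq_int; have [dphi _] := hphi; split=> [SB|_ supM].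
  have [M HM] := slice_sqnorm_le hphi SB; split.
    apply: le_lt_trans (ltry M); apply: ge_ereal_sup => _ [a _ <-]; exact: HM.
  (* [D] bounds the square of the modulus uniformly in y; t <= 1 + t^2 converts this into a bound on
     the modulus itself. *)
  move=> x; pose D := 2 * (expR (sqnorm (Rn_Cn x) / 2) * M) / (2 * pi) ^+ n.
  apply: (@le_lt_trans _ _ ((1 + D) * expR (- (sqnorm (Rn_Cn x) / 4)))%:E); last exact: ltry.
  apply: ge_ereal_sup => _ [y _ <-]; rewrite lee_fin ler_wpM2r ?expR_ge0//.
  have := slice_sqnorm_pointwise hphi HM x y; rewrite -/D.
  set t := Normc.normc _ => tD; have := sqr_ge0 (t - 1); rewrite sqrrB1.
  by have := normc_ge0 (phi (Rn_Cn x + 'i%C *: Rn_Cn y)); rewrite -/t; lra.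
have [M HM] : exists M : R, forall y : Rn R n, (\int[lebesgue_Rn R n]_x
    (Normc.normc (phi (Rn_Cn x + 'i%C *: Rn_Cn y))
     * expR (- (sqnorm (Rn_Cn x) / 4)))%:E <= M%:E)%E.
  move: supM; set s := ereal_sup _ => s_lt.
  have s_ub y : (\int[lebesgue_Rn R n]_x
      (Normc.normc (phi (Rn_Cn x + 'i%C *: Rn_Cn y))
       * expR (- (sqnorm (Rn_Cn x) / 4)))%:E <= s)%E.
    by apply: ereal_sup_ubound; exists y.
  (* [fine] reads an infinite value as 0, so [s] has to be bounded below as well; any one of the
     integrals does this. *)
  have s0 : (0 <= s)%E.
    apply: le_trans (s_ub (tuple0 R n)); apply: integral_ge0 => x _.
    by rewrite lee_fin mulr_ge0 ?expR_ge0 ?normc_ge0.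
  by exists (fine s) => y; rewrite fineK ?ge0_fin_numE.
have mE := gauss_bargmann_symbol dphi HM.
split; first by exists (symbol phi); split; [exact: Linfty_symbol HM|].
(* The factor pi^{n/2} of [S_op_span_bounded] times the bound of [symbol_le] on m. *)
exists (Num.sqrt pi ^+ n * ((2 * pi) ^- n * (2 * M))) => _ [k [c [a ->]]].
have fock_m : fock (gauss_bargmann (symbol phi)) by rewrite mE.
have := S_op_span_bounded c a (cmeasurable_symbol dphi) (symbol_le dphi HM) fock_m.
by rewrite mE.
Qed.
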